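(* Let $\mathcal{C}$ be a fusion category, let $\Pi\in\mathcal{C}$, let $Q$ be the rank two fusion quiver over $\mathcal{C}$ with two vertices $a,b$ and one edge $a\xrightarrow{\ \Pi\ }b$, and let $\mathcal{M}$ be a finite semisimple left module category over $\mathcal{C}$. Then the following are equivalent: (1) $\operatorname{Rep}_{\mathcal{M}}(Q)$ has finitely many indecomposable objects up to isomorphism; (2) as an operator on $[\mathcal{M}]\oplus[\mathcal{M}]\cong[\operatorname{Rep}_{\mathcal{M}}(Q)]$, $\sigma_a\circ\sigma_b$ has finite order; (3) as an operator on $[\mathcal{C}]\oplus[\mathcal{C}]$, $\sigma_a\circ\sigma_b\in\mathbb{W}(Q)$ has finite order; (4) there exists an integer $m\ge2$ such that $\operatorname{FPdim}(\Pi)=2\cos(\pi/m)<2$. Moreover, the order of $\sigma_a\circ\sigma_b$ is exactly $m$ (the integer $m$ of condition (4), when these conditions hold). In particular, the property that $\operatorname{Rep}_{\mathcal{M}}(Q)$ has finitely many indecomposable objects only depends on the rank two fusion quiver $Q$ and is independent of the choice of module category $\mathcal{M}$.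
   Context: $\Bbbk$ is an algebraically closed field; all categories and functors are $\Bbbk$-linear. A fusion category is a semisimple finite abelian rigid monoidal category with simple unit; $[\mathcal{C}]$ is its Grothendieck ring. A left module category over $\mathcal{C}$ is an abelian category $\mathcal{M}$ with an additive monoidal functor $\mathcal{C}\to\operatorname{End}(\mathcal{M})$, written $C\mapsto C\otimes-$; it is finite semisimple if it is a finite abelian category that is semisimple. The Grothendieck group $[\mathcal{M}]$ is a left $[\mathcal{C}]$-module. An object of $\operatorname{Rep}_{\mathcal{M}}(Q)$ is a pair of objects $X_a,X_b\in\mathcal{M}$ with a morphism $\phi:\Pi\otimes X_a\to X_b$; a morphism $(X,\phi)\to(Y,\psi)$ is a pair $\rho_a:X_a\to Y_a$, $\rho_b:X_b\to Y_b$ with $\rho_b\phi=\psi(\mathrm{id}_\Pi\otimes\rho_a)$. Its Grothendieck group is identified with $[\mathcal{M}]\oplus[\mathcal{M}]$ via $[(X,\phi)]\mapsto([X_a],[X_b])$. With ${}^*\Pi$ the left dual of $\Pi$, the operators $\sigma_a=\begin{bmatrix}-1&[{}^*\Pi]\\0&1\end{bmatrix}$ and $\sigma_b=\begin{bmatrix}1&0\\ [\Pi]&-1\end{bmatrix}$ (entries in $[\mathcal{C}]$) act on column vectors in $[\mathcal{C}]\oplus[\mathcal{C}]$ or $[\mathcal{M}]\oplus[\mathcal{M}]$ by left multiplication (first coordinate for vertex $a$, second for $b$). $\mathbb{W}(Q)\subseteq GL_2([\mathcal{C}])$ is the group generated by $\sigma_a$ and $\sigma_b$. $\operatorname{FPdim}(\Pi)$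 is the Frobenius--Perron eigenvalue of left multiplication by $[\Pi]$ on $[\mathcal{C}]$ in the basis of simple objects.
   Formalization: The module category M (and any other module category it is compared with) is assumed nonzero; for M = 0 conditions (1) and (2) hold for every Π while (3) and (4) can fail, e.g. Π = 1⊕1. *)

(* Defs.v *)
From HB Require Import structures.
From mathcomp Require Import all_boot all_order all_algebra generic_quotient.
From mathcomp Require Import boolp classical_sets reals trigo.

Set Implicit Arguments.
Unset Strict Implicit.
Unset Printing Implicit Defensive.

Import Order.TTheory GRing.Theory Num.Theory.
Local Open Scope ring_scope.

Record linCat (k : fieldType) := LinCat {
  obj :> Type;
  hom : obj -> obj -> lmodType k;
  idm : forall X, hom X X;
  ccomp : forall X Y Z, hom Y Z -> hom X Y -> hom X Z;
  compA : forall W X Y Z (h : hom Y Z) (g : hom X Y) (f : hom W X),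
    ccomp h (ccomp g f) = ccomp (ccomp h g) f;
  comp1m : forall X Y (f : hom X Y), ccomp (idm Y) f = f;
  compm1 : forall X Y (f : hom X Y), ccomp f (idm X) = f;
  comp_linl : forall X Y Z (c : k) (f g : hom Y Z) (h : hom X Y),
    ccomp (c *: f + g) h = c *: ccomp f h + ccomp g h;
  comp_linr : forall X Y Z (c : k) (h : hom Y Z) (f g : hom X Y),
    ccomp h (c *: f + g) = c *: ccomp h f + ccomp h g }.

Arguments hom {k l} _ _.
Arguments idm {k l} X.
Arguments ccomp {k l X Y Z} _ _.

Declare Scope cat_scope.
Delimit Scope cat_scope with cat.
Local Open Scope cat_scope.
Notation "g \oc f" := (ccomp g f) (at level 40, left associativity) : cat_scope.

Record iso (k : fieldType) (A : linCat k) (X Y : A) := Iso {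
  fwd :> hom X Y;
  bwd : hom Y X;
  bwdK : bwd \oc fwd = idm X;
  fwdK : fwd \oc bwd = idm Y }.

Section LinearCategories.
Variables (k : fieldType) (A : linCat k).
Implicit Types X Y Z S T : A.

Definition isomorphic X Y := inhabited (iso X Y).

Definition is_iso X Y (f : hom X Y) :=
  exists g : hom Y X, g \oc f = idm X /\ f \oc g = idm Y.

Definition is_zero Z :=
  forall X, (forall f : hom X Z, f = 0) /\ (forall f : hom Z X, f = 0).

Definition is_mono X Y (f : hom X Y) :=
  forall T (g h : hom T X), f \oc g = f \oc h -> g = h.

Definition is_epi X Y (f : hom X Y) :=
  forall T (g h : hom Y T), g \oc f = h \oc f -> g = h.

Definition is_kernel X Y K (f : hom X Y) (i : hom K X) :=
  f \oc i = 0 /\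
  forall T (t : hom T X), f \oc t = 0 -> exists! u : hom T K, i \oc u = t.

Definition is_cokernel X Y K (f : hom X Y) (p : hom Y K) :=
  p \oc f = 0 /\
  forall T (t : hom Y T), t \oc f = 0 -> exists! u : hom K T, u \oc p = t.

Definition short_exact X Y Z (f : hom X Y) (g : hom Y Z) :=
  is_kernel g f /\ is_cokernel f g.

Definition is_biproduct X Y S
    (i1 : hom X S) (i2 : hom Y S) (p1 : hom S X) (p2 : hom S Y) :=
  [/\ p1 \oc i1 = idm X, p2 \oc i2 = idm Y, p1 \oc i2 = 0, p2 \oc i1 = 0
    & i1 \oc p1 + i2 \oc p2 = idm S].

Definition is_dsum X Y S := exists i1 i2 p1 p2, @is_biproduct X Y S i1 i2 p1 p2.

Definition is_bigdsum n (F : 'I_n -> A) S :=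
  exists (i : forall a, hom (F a) S) (p : forall a, hom S (F a)),
  [/\ forall a, p a \oc i a = idm (F a),
      forall a b, a != b -> p a \oc i b = 0
    & \sum_a i a \oc p a = idm S].

Definition is_abelian :=
  [/\ exists Z : A, is_zero Z,
      forall X Y, exists S, is_dsum X Y S,
      forall X Y (f : hom X Y),
        (exists K (i : hom K X), is_kernel f i) /\
        (exists K (p : hom Y K), is_cokernel f p),
      forall X Y (f : hom X Y), is_mono f ->
        exists Z (g : hom Y Z), is_kernel g f
    & forall X Y (f : hom X Y), is_epi f ->
        exists Z (g : hom Z X), is_cokernel g f].

Definition is_simple X :=
  ~ is_zero X /\
  forall Y (f : hom Y X), is_mono f -> f = 0 \/ is_iso f.

Definition semisimple_obj X :=
  exists n (F : 'I_n -> A), (forall a, is_simple (F a)) /\ is_bigdsum F X.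

Definition is_semisimple := forall X, semisimple_obj X.

Inductive finite_length : A -> Prop :=
| FL_zero X : is_zero X -> finite_length X
| FL_ext X Y S (f : hom X Y) (g : hom Y S) :
    short_exact f g -> is_simple S -> finite_length X -> finite_length Y.

Definition is_projective P :=
  forall X Y (g : hom X Y) (f : hom P Y), is_epi g ->
  exists h : hom P X, g \oc h = f.

Definition fin_dim (V : lmodType k) :=
  exists n (e : 'I_n -> V), forall v, exists c : 'I_n -> k,
  v = \sum_i c i *: e i.

Definition is_finite_abelian :=
  [/\ is_abelian, forall X Y, fin_dim (hom X Y), forall X, finite_length X,
      forall X, exists P (f : hom P X), is_projective P /\ is_epi f
    & exists n (S : 'I_n -> A), forall X, is_simple X ->
        exists i, isomorphic X (S i)].

Definition is_indecomposable X :=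
  ~ is_zero X /\ forall Y Z, is_dsum Y Z X -> is_zero Y \/ is_zero Z.

Definition finitely_many_indecomposables :=
  exists n (I : 'I_n -> A), forall X, is_indecomposable X ->
  exists i, isomorphic X (I i).

(** [S] lists the simple objects, each isomorphism class exactly once. *)
Definition simple_reps n (S : 'I_n -> A) :=
  [/\ forall i, is_simple (S i),
      forall i j, isomorphic (S i) (S j) -> i = j
    & forall X, is_simple X -> exists i, isomorphic X (S i)].

Lemma compDl X Y Z (f g : hom Y Z) (h : hom X Y) :
  (f + g) \oc h = f \oc h + g \oc h.
Proof. by have := comp_linl 1 f g h; rewrite !scale1r. Qed.

Lemma compDr X Y Z (h : hom Y Z) (f g : hom X Y) :
  h \oc (f + g) = h \oc f + h \oc g.
Proof. by have := comp_linr 1 h f g; rewrite !scale1r. Qed.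

Lemma comp0m X Y Z (h : hom X Y) : (0 : hom Y Z) \oc h = 0.
Proof. by apply: (@addIr _ (0 \oc h)); rewrite -compDl !add0r. Qed.

Lemma compm0 X Y Z (h : hom Y Z) : h \oc (0 : hom X Y) = 0.
Proof. by apply: (@addIr _ (h \oc 0)); rewrite -compDr !add0r. Qed.

Lemma compNl X Y Z (f : hom Y Z) (h : hom X Y) : (- f) \oc h = - (f \oc h).
Proof. by apply: (@addIr _ (f \oc h)); rewrite -compDl !addNr comp0m. Qed.

Lemma compNr X Y Z (h : hom Y Z) (f : hom X Y) : h \oc (- f) = - (h \oc f).
Proof. by apply: (@addIr _ (h \oc f)); rewrite -compDr !addNr compm0. Qed.

Lemma compBl X Y Z (f g : hom Y Z) (h : hom X Y) :
  (f - g) \oc h = f \oc h - g \oc h.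
Proof. by rewrite compDl compNl. Qed.

Lemma compBr X Y Z (h : hom Y Z) (f g : hom X Y) :
  h \oc (f - g) = h \oc f - h \oc g.
Proof. by rewrite compDr compNr. Qed.

Lemma comp_suml X Y Z I (r : seq I) (P : pred I) (F : I -> hom Y Z)
    (h : hom X Y) :
  (\sum_(i <- r | P i) F i) \oc h = \sum_(i <- r | P i) F i \oc h.
Proof.
by apply: (big_morph (fun f => f \oc h)); [move=> ? ?; apply: compDl|apply: comp0m].
Qed.

Lemma comp_sumr X Y Z I (r : seq I) (P : pred I) (F : I -> hom X Y)
    (h : hom Y Z) :
  h \oc (\sum_(i <- r | P i) F i) = \sum_(i <- r | P i) h \oc F i.
Proof.
by apply: (big_morph (fun f => h \oc f)); [move=> ? ?; apply: compDr|apply: compm0].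
Qed.

Lemma is_zeroP Z : idm Z = 0 -> is_zero Z.
Proof.
move=> Z0 X; split=> f; first by rewrite -[f]comp1m Z0 comp0m.
by rewrite -[f]compm1 Z0 compm0.
Qed.

Lemma kernel_mono X Y K (f : hom X Y) (i : hom K X) : is_kernel f i -> is_mono i.
Proof.
move=> [fi0 ker] T g h gh.
have [|u [_ uniq]] := ker T (i \oc g); first by rewrite compA fi0 comp0m.
by rewrite -(uniq g) // -(uniq h).
Qed.

Lemma cokernel_epi X Y K (f : hom X Y) (p : hom Y K) :
  is_cokernel f p -> is_epi p.
Proof.
move=> [pf0 cok] T g h gh.
have [|u [_ uniq]] := cok T (g \oc p); first by rewrite -compA pf0 compm0.
by rewrite -(uniq g) // -(uniq h).
Qed.

Lemma iso_zero X Y (f : hom X Y) : is_iso f -> f = 0 -> is_zero X.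
Proof.
by move=> [g [gf _]] f0; apply: is_zeroP; rewrite -gf f0 compm0.
Qed.

Hypothesis abA : is_abelian.

Lemma Schur S T (f : hom S T) :
  is_simple S -> is_simple T -> f <> 0 -> is_iso f.
Proof.
move=> [S0 simS] [T0 simT] fN0.
have [_ _ kc _ _] := abA.
have [[K [i kf]] _] := kc _ _ f.
have i0 : i = 0.
  case: (simS _ i (kernel_mono kf)) => // -[j [_ ij]].
  by case: fN0; rewrite -[f]compm1 -ij compA kf.1 comp0m.
have mf : is_mono f.
  move=> U g h /eqP; rewrite -subr_eq0 -compBr => /eqP /(kf.2 _)[u [iu _]].
  by apply/eqP; rewrite -subr_eq0 -iu i0 comp0m.
by case: (simT _ f mf).
Qed.

Lemma epi_split n : forall (F : 'I_n -> A) Z Y (g : hom Y Z),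
  is_semisimple -> (forall a, is_simple (F a)) -> is_bigdsum F Z -> is_epi g ->
  exists s : hom Z Y, g \oc s = idm Z.
Proof.
have [_ _ kc _ epi] := abA.
elim: n => [|n IH] F Z Y g ssA simF [i [p [pi1 pi0 ip1]]] epg.
  by exists 0; rewrite compm0 -ip1 big_ord0.
pose T := F ord0; pose p0 : hom Z T := p ord0; pose t : hom T Z := i ord0.
have pt : p0 \oc t = idm T by exact: pi1.
have ep0 : is_epi (p0 \oc g).
  move=> U u v; rewrite !compA => /epg uv.
  by rewrite -[u]compm1 -[v]compm1 -pt !compA uv.
have [s0 ps0] : exists s0 : hom T Y, p0 \oc g \oc s0 = idm T.
  have [m [G [simG [i' [p' [_ _ ip1']]]]]] := ssA Y.
  have [a Na] : exists a, p0 \oc g \oc i' a <> 0.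
    apply: contrapT => none; apply: (simF ord0).1; apply: is_zeroP.
    apply: ep0; rewrite comp1m comp0m -[LHS]compm1 -ip1' comp_sumr big1 // => a _.
    have -> : p0 \oc g \oc (i' a \oc p' a) = (p0 \oc g \oc i' a) \oc p' a.
      by rewrite compA.
    suff -> : p0 \oc g \oc i' a = 0 by rewrite comp0m.
    by apply: contrapT => ?; apply: none; exists a.
  have [h [_ h1]] := Schur (simG a) (simF ord0) Na.
  by exists (i' a \oc h); rewrite compA.
have [[Z' [i' kp]] _] := kc _ _ p0.
have mi' := kernel_mono kp.
have [Y' [j kj]] := (kc _ _ (p0 \oc g)).1.
have [p' ip'] : exists p' : hom Z Z', i' \oc p' = idm Z - t \oc p0.
  have [|u [iu _]] := kp.2 _ (idm Z - t \oc p0); last by exists u.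
  by rewrite compBr compm1 compA pt comp1m subrr.
have pi' : p' \oc i' = idm Z'.
  by apply: mi'; rewrite compA ip' compBl comp1m compm1 -compA kp.1 compm0 subr0.
have dZ' : is_bigdsum (fun a : 'I_n => F (lift ord0 a)) Z'.
  have ex a : exists u, i' \oc u = i (lift ord0 a).
    have [|u [iu _]] := kp.2 _ (i (lift ord0 a)); last by exists u.
    exact: pi0.
  pose ii a := sval (cid (ex a)).
  have iiE a : i' \oc ii a = i (lift ord0 a) := svalP (cid (ex a)).
  exists ii, (fun a => p (lift ord0 a) \oc i'); split=> [a|a b ab|].
  - by rewrite -compA iiE pi1.
  - by rewrite -compA iiE pi0 // (inj_eq lift_inj).
  apply: mi'; rewrite comp_sumr compm1.
  under eq_bigr do rewrite !compA iiE.
  rewrite -comp_suml.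
  have -> : \sum_(a < n) i (lift ord0 a) \oc p (lift ord0 a) = idm Z - t \oc p0.
    by rewrite -ip1 big_ord_recl addrC addKr.
  by rewrite compBl comp1m -compA kp.1 compm0 subr0.
have ep' : is_epi (p' \oc g \oc j).
  move=> U u v /eqP; rewrite -subr_eq0 -compBl => /eqP.
  set w := u - v => w0.
  have [X0 [h ch]] := epi _ _ _ ep0.
  have [x [jx _]] := kj.2 _ h ch.1.
  have [|y [yp _]] := ch.2 _ (w \oc (p' \oc g)).
    by rewrite -jx -compA [_ \oc (j \oc x)]compA compA w0 comp0m.
  have wp : w \oc p' = y \oc p0 by apply: epg; rewrite -!compA.
  apply/eqP; rewrite -subr_eq0 -/w -[w]compm1 -pi' compA wp -compA kp.1 compm0.
  exact: eqxx.
have [s' es'] := IH _ _ _ _ ssA (fun a => simF _) dZ' ep'.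
exists (s0 \oc p0 + j \oc s' \oc (p' - p' \oc g \oc s0 \oc p0)).
have gj : g \oc j \oc s' = i'.
  have E : i' \oc p' \oc (g \oc j) = g \oc j.
    by rewrite ip' compBl comp1m -(compA t) [p0 \oc (g \oc j)]compA kj.1 compm0 subr0.
  by rewrite -E; move: es'; rewrite -!compA => ->; rewrite compm1.
rewrite compDr !compA gj compBr !compA ip' !compBl !comp1m.
have -> : t \oc p0 \oc g \oc s0 \oc p0 = t \oc p0.
  by rewrite -[t \oc p0 \oc g]compA -(compA t) ps0 compm1.
by rewrite opprB addrC -addrA !subrK.
Qed.

Lemma short_exact_split X Y Z (f : hom X Y) (g : hom Y Z) :
  is_semisimple -> short_exact f g -> exists r s, is_biproduct f s r g.
Proof.
move=> ssA [kg cf]; have [n [F [simF dZ]]] := ssA Z.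
have [s gs] := epi_split ssA simF dZ (cokernel_epi cf).
have [|r [fr _]] := kg.2 _ (idm Y - s \oc g).
  by rewrite compBr compm1 compA gs comp1m subrr.
have mf := kernel_mono kg.
exists r, s; split=> //.
- by apply: mf; rewrite compA fr compBl comp1m compm1 -compA kg.1 compm0 subr0.
- by apply: mf; rewrite compA fr compBl comp1m compm0 -compA gs compm1 subrr.
- exact: kg.1.
- by rewrite fr subrK.
Qed.

End LinearCategories.

Lemma biproduct_short_exact (k : fieldType) (A : linCat k) (X Y S : A)
    (i1 : hom X S) (i2 : hom Y S) (p1 : hom S X) (p2 : hom S Y) :
  is_biproduct i1 i2 p1 p2 -> short_exact i1 p2.
Proof.
move=> [p1i1 p2i2 p1i2 p2i1 ip1]; split; split=> // T t t0.
  have tE : i1 \oc (p1 \oc t) = t.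
    by rewrite -[RHS]comp1m -ip1 compDl -!compA t0 compm0 addr0.
  exists (p1 \oc t); split=> // u <-; by rewrite compA p1i1 comp1m.
have tE : t \oc i2 \oc p2 = t.
  by rewrite -[RHS]compm1 -ip1 compDr !compA t0 comp0m add0r.
exists (t \oc i2); split=> // u <-; by rewrite -compA p2i2 compm1.
Qed.

Record monCat (k : fieldType) := MonCat {
  mcat :> linCat k;
  tens : mcat -> mcat -> mcat;
  tensm : forall X X' Y Y',
    hom X X' -> hom Y Y' -> hom (tens X Y) (tens X' Y');
  tensm1 : forall X Y, tensm (idm X) (idm Y) = idm (tens X Y);
  tensm_comp : forall X X' X'' Y Y' Y'' (f' : hom X' X'') (f : hom X X')
      (g' : hom Y' Y'') (g : hom Y Y'),
    tensm (f' \oc f) (g' \oc g) = tensm f' g' \oc tensm f g;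
  tensm_linl : forall X X' Y Y' (c : k) (f f' : hom X X') (g : hom Y Y'),
    tensm (c *: f + f') g = c *: tensm f g + tensm f' g;
  tensm_linr : forall X X' Y Y' (c : k) (f : hom X X') (g g' : hom Y Y'),
    tensm f (c *: g + g') = c *: tensm f g + tensm f g';
  tunit : mcat;
  assoc : forall X Y Z, iso (tens (tens X Y) Z) (tens X (tens Y Z));
  lunit : forall X, iso (tens tunit X) X;
  runit : forall X, iso (tens X tunit) X;
  assoc_nat : forall X X' Y Y' Z Z'
      (f : hom X X') (g : hom Y Y') (h : hom Z Z'),
    tensm f (tensm g h) \oc assoc X Y Z
      = assoc X' Y' Z' \oc tensm (tensm f g) h;
  lunit_nat : forall X X' (f : hom X X'),
    f \oc lunit X = lunit X' \oc tensm (idm tunit) f;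
  runit_nat : forall X X' (f : hom X X'),
    f \oc runit X = runit X' \oc tensm f (idm tunit);
  pentagon : forall W X Y Z,
    assoc W X (tens Y Z) \oc assoc (tens W X) Y Z
      = tensm (idm W) (assoc X Y Z) \oc assoc W (tens X Y) Z
          \oc tensm (assoc W X Y) (idm Z);
  triangle : forall X Y,
    tensm (idm X) (lunit Y) \oc assoc X tunit Y = tensm (runit X) (idm Y) }.

Arguments tensm {k m X X' Y Y'} _ _.
Arguments tunit {k} m.
Arguments assoc {k m} X Y Z.
Arguments lunit {k m} X.
Arguments runit {k m} X.

Infix "\ox" := tens (at level 40, left associativity) : cat_scope.

Section Monoidal.
Variables (k : fieldType) (C : monCat k).

(** A left dual [D] of [X] has evaluation [X \ox D -> 1], so
    that [D \ox -] is right adjoint to [X \ox -]. In a fusion category left and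
    right duals have the same class in the Grothendieck ring. *)
Definition is_left_dual (X D : C) :=
  exists (ev : hom (X \ox D) (tunit C)) (coev : hom (tunit C) (D \ox X)),
    runit D \oc tensm (idm D) ev \oc assoc D X D
        \oc tensm coev (idm D) \oc bwd (lunit D) = idm D
    /\
    lunit X \oc tensm ev (idm X) \oc bwd (assoc X D X)
        \oc tensm (idm X) coev \oc bwd (runit X) = idm X.

Definition is_right_dual (X D : C) := is_left_dual D X.

Definition is_rigid := forall X : C,
  (exists D, is_left_dual X D) /\ (exists D, is_right_dual X D).

Definition is_fusion :=
  [/\ is_finite_abelian C, is_semisimple C, is_rigid & is_simple (tunit C)].

End Monoidal.

Record fusionCat (k : fieldType) := FusionCat {
  fmon :> monCat k;
  fusionP : is_fusion fmon }.

Lemma left_dual_exists (k : fieldType) (C : fusionCat k) (X : C) :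
  exists D, is_left_dual X D.
Proof. by have [_ _ rigC _] := fusionP C; case: (rigC X). Qed.

Definition ldual (k : fieldType) (C : fusionCat k) (X : C) : C :=
  sval (cid (left_dual_exists X)).

(** A left module category, with the monoidal functor [C -> End(M)] written out
    as a bilinear action bifunctor with its coherence isomorphisms. *)
Record modCat (k : fieldType) (C : monCat k) := ModCat {
  modcat :> linCat k;
  act : C -> modcat -> modcat;
  actm : forall (X X' : C) (M M' : modcat),
    hom X X' -> hom M M' -> hom (act X M) (act X' M');
  actm1 : forall X M, actm (idm X) (idm M) = idm (act X M);
  actm_comp : forall (X X' X'' : C) (M M' M'' : modcat)
      (f' : hom X' X'') (f : hom X X') (g' : hom M' M'') (g : hom M M'),
    actm (f' \oc f) (g' \oc g) = actm f' g' \oc actm f g;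
  actm_linl : forall (X X' : C) (M M' : modcat) (c : k)
      (f f' : hom X X') (g : hom M M'),
    actm (c *: f + f') g = c *: actm f g + actm f' g;
  actm_linr : forall (X X' : C) (M M' : modcat) (c : k)
      (f : hom X X') (g g' : hom M M'),
    actm f (c *: g + g') = c *: actm f g + actm f g';
  massoc : forall X Y M, iso (act (X \ox Y) M) (act X (act Y M));
  munit : forall M, iso (act (tunit C) M) M;
  massoc_nat : forall (X X' Y Y' : C) (M M' : modcat)
      (f : hom X X') (g : hom Y Y') (h : hom M M'),
    actm f (actm g h) \oc massoc X Y M = massoc X' Y' M' \oc actm (tensm f g) h;
  munit_nat : forall (M M' : modcat) (f : hom M M'),
    f \oc munit M = munit M' \oc actm (idm (tunit C)) f;
  mpentagon : forall X Y Z M,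
    massoc X Y (act Z M) \oc massoc (X \ox Y) Z M
      = actm (idm X) (massoc Y Z M) \oc massoc X (Y \ox Z) M
          \oc actm (assoc X Y Z) (idm M);
  mtriangle : forall X M,
    actm (idm X) (munit M) \oc massoc X (tunit C) M = actm (runit X) (idm M) }.

Arguments act {k C m} _ _.
Arguments actm {k C m X X' M M'} _ _.
Arguments massoc {k C m} X Y M.
Arguments munit {k C m} M.

Infix "\act" := act (at level 40, left associativity) : cat_scope.

Record fssModCat (k : fieldType) (C : monCat k) := FssModCat {
  fmod :> modCat C;
  fmod_finite : is_finite_abelian fmod;
  fmod_semisimple : is_semisimple fmod }.

Definition regularMod (k : fieldType) (C : monCat k) : modCat C :=
  @ModCat k C C (@tens k C) (@tensm k C) (@tensm1 k C) (@tensm_comp k C)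
    (@tensm_linl k C) (@tensm_linr k C) (@assoc k C) (@lunit k C)
    (@assoc_nat k C) (@lunit_nat k C) (@pentagon k C) (@triangle k C).

Section Grothendieck.
Variables (k : fieldType) (A : linCat k).

Inductive gterm := GCls of A | GZero | GOpp of gterm | GAdd of gterm & gterm.

(** The abelian group presented by the objects of [A] and the relations
    [Y] = [X] + [Z] for every short exact sequence 0 -> X -> Y -> Z -> 0. *)
Inductive geq : gterm -> gterm -> Prop :=
| geq_refl s : geq s s
| geq_sym s t : geq s t -> geq t s
| geq_trans s t u : geq s t -> geq t u -> geq s u
| geq_opp s t : geq s t -> geq (GOpp s) (GOpp t)
| geq_add s s' t t' : geq s s' -> geq t t' -> geq (GAdd s t) (GAdd s' t')
| geq_addA s t u : geq (GAdd s (GAdd t u)) (GAdd (GAdd s t) u)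
| geq_addC s t : geq (GAdd s t) (GAdd t s)
| geq_add0 s : geq (GAdd GZero s) s
| geq_addN s : geq (GAdd (GOpp s) s) GZero
| geq_exact X Y Z (f : hom X Y) (g : hom Y Z) :
    short_exact f g -> geq (GCls Y) (GAdd (GCls X) (GCls Z)).

HB.instance Definition _ := gen_eqMixin gterm.
HB.instance Definition _ := gen_choiceMixin gterm.

Definition geqb (s t : gterm) : bool := `[< geq s t >].

Lemma geqb_equiv : equiv_class_of geqb.
Proof.
split=> [s|s t|t s u].
- by apply/asboolP; apply: geq_refl.
- by apply/asboolP/asboolP; apply: geq_sym.
- by move=> /asboolP st /asboolP tu; apply/asboolP; apply: geq_trans tu.
Qed.

Canonical geqb_equivrel := EquivRelPack geqb_equiv.

Definition K0 := {eq_quot geqb_equivrel}%qT.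

HB.instance Definition _ := Choice.on K0.
HB.instance Definition _ := EqQuotient.on K0.

Definition cls (X : A) : K0 := \pi_K0%qT (GCls X).

Lemma geqP (s t : gterm) : geq s t <-> \pi_K0%qT s = \pi_K0%qT t.
Proof.
by split=> [st|/eqmodP/asboolP//]; apply/eqmodP/asboolP.
Qed.

Lemma geq_repr (s : gterm) : geq (repr (\pi_K0%qT s)) s.
Proof. by apply/geqP; rewrite reprK. Qed.

Definition K0zero : K0 := \pi%qT GZero.
Definition K0opp (x : K0) : K0 := \pi%qT (GOpp (repr x)).
Definition K0add (x y : K0) : K0 := \pi%qT (GAdd (repr x) (repr y)).

Lemma pi_opp s : K0opp (\pi_K0%qT s) = \pi%qT (GOpp s).
Proof. by apply/geqP/geq_opp/geq_repr. Qed.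

Lemma pi_add s t : K0add (\pi_K0%qT s) (\pi_K0%qT t) = \pi%qT (GAdd s t).
Proof. by apply/geqP/geq_add; apply: geq_repr. Qed.

Lemma K0addA : associative K0add.
Proof.
move=> x y z; elim/quotW: x => s; elim/quotW: y => t; elim/quotW: z => u.
by rewrite (pi_add t u) (pi_add s t) !pi_add; apply/geqP/geq_addA.
Qed.

Lemma K0addC : commutative K0add.
Proof.
by move=> x y; rewrite -[x]reprK -[y]reprK !pi_add; apply/geqP/geq_addC.
Qed.

Lemma K0add0 : left_id K0zero K0add.
Proof. by move=> x; rewrite -[x]reprK pi_add; apply/geqP/geq_add0. Qed.

Lemma K0addN : left_inverse K0zero K0opp K0add.
Proof.
by move=> x; rewrite -[x]reprK pi_opp pi_add; apply/geqP/geq_addN.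
Qed.

HB.instance Definition _ :=
  GRing.isZmodule.Build K0 K0addA K0addC K0add0 K0addN.

Lemma cls_exact (X Y Z : A) (f : hom X Y) (g : hom Y Z) :
  short_exact f g -> cls Y = cls X + cls Z.
Proof.
move=> fg; rewrite [RHS]pi_add; apply/geqP; exact: geq_exact fg.
Qed.

Lemma K0_ind (P : K0 -> Prop) :
  P 0 -> (forall X, P (cls X)) -> (forall x, P x -> P (- x)) ->
  (forall x y, P x -> P y -> P (x + y)) -> forall x, P x.
Proof.
move=> P0 Pc Po Pa x; rewrite -[x]reprK.
elim: (repr x) => [X||s IH|s IHs t IHt]; [exact: Pc|exact: P0| |].
- by have := Po _ IH; rewrite [- _]pi_opp.
- by have := Pa _ _ IHs IHt; rewrite [_ + _]pi_add.
Qed.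

Section Lift.
Variables (G : zmodType) (f : A -> G).

Definition exact_additive := forall (X Y Z : A) (u : hom X Y) (v : hom Y Z),
  short_exact u v -> f Y = f X + f Z.

Fixpoint geval (t : gterm) : G := match t with
  | GCls X => f X
  | GZero => 0
  | GOpp t => - geval t
  | GAdd s t => geval s + geval t
  end.

Definition K0lift (x : K0) : G := geval (repr x).

Hypothesis fE : exact_additive.

Lemma geval_geq s t : geq s t -> geval s = geval t.
Proof.
elim=> //=.
- by move=> ? ? ? _ -> _ ->.
- by move=> ? ? _ ->.
- by move=> ? ? ? ? _ -> _ ->.
- by move=> ? ? ?; rewrite addrA.
- by move=> ? ?; rewrite addrC.
- by move=> ?; rewrite add0r.
- by move=> ?; rewrite addNr.
Qed.

Lemma K0lift_pi s : K0lift (\pi%qT s) = geval s.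
Proof. exact/geval_geq/geq_repr. Qed.

Lemma K0lift_cls X : K0lift (cls X) = f X.
Proof. exact: K0lift_pi. Qed.

Lemma K0lift0 : K0lift 0 = 0.
Proof. exact: K0lift_pi. Qed.

Lemma K0liftN x : K0lift (- x) = - K0lift x.
Proof. by elim/quotW: x => s; rewrite [- _]pi_opp !K0lift_pi. Qed.

Lemma K0liftD x y : K0lift (x + y) = K0lift x + K0lift y.
Proof.
elim/quotW: x => s; elim/quotW: y => t.
by rewrite [X in K0lift X]pi_add !K0lift_pi.
Qed.

End Lift.

Lemma cls_iso (X Y : A) : is_abelian A -> iso X Y -> cls X = cls Y.
Proof.
move=> [[Z zZ] _ _ _ _] [f g gf fg].
have e0 (T : A) (h : hom X T) (h' : hom T X) : h' \oc h = idm X ->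
    h \oc h' = idm T -> cls T = cls X + cls Z.
  move=> h'h hh'.
  apply: (@cls_exact _ _ _ h 0); apply: (@biproduct_short_exact _ _ _ _ _ h 0 h' 0).
  by split; rewrite ?compm0 ?comp0m ?addr0 // ((zZ _).1 (idm Z)).
by rewrite (e0 Y f g gf fg) -(e0 X (idm X) (idm X)) ?comp1m.
Qed.

End Grothendieck.

Section Action.
Variables (k : fieldType) (C : monCat k) (M : modCat C).

(** The biadditive extension of ([X], [N]) |-> [X \act N]. *)
Definition K0act (x : K0 C) (y : K0 M) : K0 M :=
  K0lift (fun X : C => K0lift (fun N : M => cls (X \act N)) y) x.

Lemma actm_biprodl (X Y S : C) (N : M) i1 i2 p1 p2 :
  @is_biproduct k C X Y S i1 i2 p1 p2 ->
  is_biproduct (actm i1 (idm N)) (actm i2 (idm N))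
               (actm p1 (idm N)) (actm p2 (idm N)).
Proof.
have actm0 (U V : C) : actm (0 : hom U V) (idm N) = 0.
  apply: (@addIr _ (actm 0 (idm N))).
  by have := actm_linl 1 (0 : hom U V) 0 (idm N); rewrite !scale1r !add0r.
move=> [p1i1 p2i2 p1i2 p2i1 ip]; split;
  rewrite -?actm_comp ?comp1m ?p1i1 ?p2i2 ?p1i2 ?p2i1 ?actm1 ?actm0 //.
have := actm_linl 1 (i1 \oc p1) (i2 \oc p2) (idm N).
by rewrite !scale1r ip actm1.
Qed.

Lemma actm_biprodr (X : C) (N P S : M) i1 i2 p1 p2 :
  @is_biproduct k M N P S i1 i2 p1 p2 ->
  is_biproduct (actm (idm X) i1) (actm (idm X) i2)
               (actm (idm X) p1) (actm (idm X) p2).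
Proof.
have actm0 (U V : M) : actm (idm X) (0 : hom U V) = 0.
  apply: (@addIr _ (actm (idm X) 0)).
  by have := actm_linr 1 (idm X) (0 : hom U V) 0; rewrite !scale1r !add0r.
move=> [p1i1 p2i2 p1i2 p2i1 ip]; split;
  rewrite -?actm_comp ?comp1m ?p1i1 ?p2i2 ?p1i2 ?p2i1 ?actm1 ?actm0 //.
have := actm_linr 1 (idm X) (i1 \oc p1) (i2 \oc p2).
by rewrite !scale1r ip actm1.
Qed.

Hypotheses (abC : is_abelian C) (ssC : is_semisimple C).
Hypotheses (abM : is_abelian M) (ssM : is_semisimple M).

Lemma act_exactr (X : C) : exact_additive (fun N : M => cls (X \act N)).
Proof.
move=> N P Q u v uv; have [r [s bi]] := short_exact_split abM ssM uv.
exact: cls_exact (biproduct_short_exact (actm_biprodr X bi)).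
Qed.

Lemma act_exactl y :
  exact_additive (fun X : C => K0lift (fun N : M => cls (X \act N)) y).
Proof.
move=> X Y Z u v uv; have [r [s bi]] := short_exact_split abC ssC uv.
elim/K0_ind: y => [|N|y IH|y z IHy IHz].
- by rewrite !(K0lift0 (act_exactr _)) addr0.
- rewrite !(K0lift_cls (act_exactr _)).
  exact: cls_exact (biproduct_short_exact (actm_biprodl N bi)).
- by rewrite !(K0liftN (act_exactr _)) IH opprD.
- by rewrite !(K0liftD (act_exactr _)) IHy IHz addrACA.
Qed.

Lemma K0act_cls X N : K0act (cls X) (cls N) = cls (X \act N).
Proof.
by rewrite /K0act (K0lift_cls (act_exactl _)) (K0lift_cls (act_exactr _)).
Qed.

Lemma K0actDl x x' y : K0act (x + x') y = K0act x y + K0act x' y.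
Proof. exact: K0liftD (act_exactl _) _ _. Qed.

Lemma K0act0l y : K0act 0 y = 0.
Proof. exact: K0lift0 (act_exactl _). Qed.

Lemma K0actNl x y : K0act (- x) y = - K0act x y.
Proof. exact: K0liftN (act_exactl _) _. Qed.

Lemma K0actDr x y y' : K0act x (y + y') = K0act x y + K0act x y'.
Proof.
elim/K0_ind: x => [|X|x IH|x z IHx IHz].
- by rewrite !K0act0l addr0.
- by rewrite /K0act !(K0lift_cls (act_exactl _)) (K0liftD (act_exactr _)).
- by rewrite !K0actNl IH opprD.
- by rewrite !K0actDl IHx IHz addrACA.
Qed.

Lemma K0act0r x : K0act x 0 = 0.
Proof. by apply: (@addIr _ (K0act x 0)); rewrite -K0actDr !add0r. Qed.

Lemma K0actNr x y : K0act x (- y) = - K0act x y.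
Proof. by apply: (@addIr _ (K0act x y)); rewrite -K0actDr !addNr K0act0r. Qed.

Lemma K0act1 y : K0act (cls (tunit C)) y = y.
Proof.
elim/K0_ind: y => [|N|y IH|y z IHy IHz].
- by rewrite K0act0r.
- by rewrite K0act_cls; apply: cls_iso abM (munit N).
- by rewrite K0actNr IH.
- by rewrite K0actDr IHy IHz.
Qed.

End Action.

Definition K0mul (k : fieldType) (C : monCat k) (x y : K0 C) : K0 C :=
  @K0act k C (regularMod C) x y.

Lemma K0actA (k : fieldType) (C : monCat k) (M : modCat C)
    (abC : is_abelian C) (ssC : is_semisimple C)
    (abM : is_abelian M) (ssM : is_semisimple M) (x y : K0 C) (z : K0 M) :
  K0act x (K0act y z) = K0act (K0mul x y) z.
Proof.
have mDl := @K0actDl k C (regularMod C) abC ssC abC ssC.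
have mDr := @K0actDr k C (regularMod C) abC ssC abC ssC.
have mNl := @K0actNl k C (regularMod C) abC ssC abC ssC.
have mNr := @K0actNr k C (regularMod C) abC ssC abC ssC.
have m0l := @K0act0l k C (regularMod C) abC ssC abC ssC.
have m0r := @K0act0r k C (regularMod C) abC ssC abC ssC.
have aDl := K0actDl abC ssC abM ssM; have aDr := K0actDr abC ssC abM ssM.
have aNl := K0actNl abC ssC abM ssM; have aNr := K0actNr abC ssC abM ssM.
have a0l := K0act0l abC ssC abM ssM; have a0r := K0act0r abC ssC abM ssM.
have ac := K0act_cls abC ssC abM ssM.
have mc := @K0act_cls k C (regularMod C) abC ssC abC ssC.
rewrite /K0mul; elim/K0_ind: x => [|X|x IH|x x' IHx IHx'].
- by rewrite m0l !a0l.
- elim/K0_ind: y => [|Y|y IH|y y' IHy IHy'].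
  + by rewrite m0r a0l a0r.
  + elim/K0_ind: z => [|N|z IH|z z' IHz IHz'].
    * by rewrite !a0r.
    * by rewrite mc !ac; apply/esym/(cls_iso abM)/massoc.
    * by rewrite !aNr IH.
    * by rewrite !aDr IHz IHz'.
  + by rewrite mNr !aNl aNr IH.
  + by rewrite mDr !aDl aDr IHy IHy'.
- by rewrite mNl !aNl IH.
- by rewrite mDl !aDl IHx IHx'.
Qed.

Lemma fusion_abelian (k : fieldType) (C : fusionCat k) : is_abelian C.
Proof. by have [[]] := fusionP C. Qed.

Lemma fusion_semisimple (k : fieldType) (C : fusionCat k) : is_semisimple C.
Proof. by have [] := fusionP C. Qed.

Arguments fusion_semisimple {k} C _.
Arguments fmod_semisimple {k C} f _.

Lemma fss_abelian (k : fieldType) (C : monCat k) (M : fssModCat C) :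
  is_abelian M.
Proof. by have [] := fmod_finite M. Qed.

Definition GrRing (k : fieldType) (C : fusionCat k) := K0 C.

Section GrRing.
Variables (k : fieldType) (C : fusionCat k).
Let abC := fusion_abelian C.
Let ssC := fusion_semisimple C.

HB.instance Definition _ := GRing.Zmodule.on (GrRing C).

Definition Gr1 : GrRing C := cls (tunit C).
Definition Grmul (x y : GrRing C) : GrRing C := K0mul x y.

Lemma GrmulA : associative Grmul.
Proof. move=> x y z; exact: (@K0actA k C (regularMod C) abC ssC abC ssC). Qed.

Lemma Grmul1l : left_id Gr1 Grmul.
Proof. move=> x; exact: (@K0act1 k C (regularMod C) abC ssC abC ssC). Qed.

Lemma GrmulDl : left_distributive Grmul +%R.
Proof. move=> x y z; exact: (@K0actDl k C (regularMod C) abC ssC abC ssC). Qed.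

Lemma GrmulDr : right_distributive Grmul +%R.
Proof. move=> x y z; exact: (@K0actDr k C (regularMod C) abC ssC abC ssC). Qed.

Lemma Grmul1r : right_id Gr1 Grmul.
Proof.
move=> x; rewrite /Grmul /K0mul /Gr1; elim/K0_ind: x => [|X|x IH|x y IHx IHy].
- exact: (@K0act0l k C (regularMod C) abC ssC abC ssC).
- rewrite (@K0act_cls k C (regularMod C) abC ssC abC ssC).
  exact: cls_iso abC (runit X).
- by rewrite (@K0actNl k C (regularMod C) abC ssC abC ssC) IH.
- by rewrite (@K0actDl k C (regularMod C) abC ssC abC ssC) IHx IHy.
Qed.

HB.instance Definition _ := GRing.Zmodule_isPzRing.Build (GrRing C)
  GrmulA Grmul1l Grmul1r GrmulDl GrmulDr.

End GrRing.

Definition GrMod (k : fieldType) (C : fusionCat k) (M : fssModCat C) := K0 M.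

Section GrMod.
Variables (k : fieldType) (C : fusionCat k) (M : fssModCat C).
Let abC := fusion_abelian C.
Let ssC := fusion_semisimple C.
Let abM := fss_abelian M.
Let ssM := fmod_semisimple M.

HB.instance Definition _ := GRing.Zmodule.on (GrMod M).

Definition Gract (x : GrRing C) (y : GrMod M) : GrMod M := K0act x y.

Lemma GractA x y z : Gract x (Gract y z) = Gract (x * y) z.
Proof. exact: K0actA. Qed.

Lemma Gract1 : left_id 1 Gract.
Proof. by move=> y; apply: K0act1. Qed.

Lemma GractDr : right_distributive Gract +%R.
Proof. by move=> x y z; apply: K0actDr. Qed.

Lemma GractDl y : {morph Gract^~ y : x x' / x + x'}.
Proof. by move=> x x'; apply: K0actDl. Qed.

HB.instance Definition _ := GRing.Zmodule_isLmodule.Build (GrRing C) (GrMod M)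
  GractA Gract1 GractDr GractDl.

End GrMod.

Definition clsC (k : fieldType) (C : fusionCat k) (X : C) : GrRing C := cls X.
Definition clsM (k : fieldType) (C : fusionCat k) (M : fssModCat C) (N : M) :
  GrMod M := cls N.

Lemma clsC_tens (k : fieldType) (C : fusionCat k) (X Y : C) :
  clsC X * clsC Y = clsC (X \ox Y).
Proof.
have abC := fusion_abelian C; have ssC := fusion_semisimple C.
exact: (@K0act_cls k C (regularMod C) abC ssC abC ssC).
Qed.

Lemma clsM_act (k : fieldType) (C : fusionCat k) (M : fssModCat C)
    (X : C) (N : M) :
  clsC X *: clsM N = clsM (X \act N).
Proof.
exact: (K0act_cls (fusion_abelian C) (fusion_semisimple C)
                  (fss_abelian M) (fmod_semisimple M)).
Qed.

Section Rep.
Variables (k : fieldType) (C : monCat k) (M : modCat C) (P : C).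

Record rep := Rep {
  rep_a : M;
  rep_b : M;
  rep_map : hom (P \act rep_a) rep_b }.

Section RepHom.
Variables X Y : rep.

Definition rep_comm : pred (hom (rep_a X) (rep_a Y) * hom (rep_b X) (rep_b Y)) :=
  fun r => r.2 \oc rep_map X == rep_map Y \oc actm (idm P) r.1.

Record rep_hom := RepHom {
  rep_hom_val :> hom (rep_a X) (rep_a Y) * hom (rep_b X) (rep_b Y);
  rep_homP : rep_comm rep_hom_val }.

HB.instance Definition _ := [isSub for rep_hom_val].
HB.instance Definition _ := [Choice of rep_hom by <:].

Lemma rep_comm_submod : submod_closed rep_comm.
Proof.
split=> [|c r s]; rewrite !unfold_in /rep_comm /=.
  apply/eqP; rewrite comp0m.
  suff -> : actm (idm P) (0 : hom (rep_a X) (rep_a Y)) = 0 by rewrite compm0.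
  apply: (@addIr _ (actm (idm P) 0)).
  by have := actm_linr 1 (idm P) (0 : hom (rep_a X) (rep_a Y)) 0;
    rewrite !scale1r !add0r.
move=> /eqP rc /eqP sc; apply/eqP.
by rewrite comp_linl rc sc actm_linr comp_linr.
Qed.

HB.instance Definition _ := GRing.isSubmodClosed.Build k _ rep_comm
  rep_comm_submod.
HB.instance Definition _ := [SubChoice_isSubLmodule of rep_hom by <:].

End RepHom.

Lemma rep_id_comm X : rep_comm (X := X) (Y := X) (idm (rep_a X), idm (rep_b X)).
Proof. by apply/eqP; rewrite /= actm1 comp1m compm1. Qed.

Definition rep_id X : rep_hom X X := RepHom (rep_id_comm X).

Lemma rep_comp_comm X Y Z (s : rep_hom Y Z) (r : rep_hom X Y) :
  rep_comm (X := X) (Y := Z)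
    ((rep_hom_val s).1 \oc (rep_hom_val r).1,
     (rep_hom_val s).2 \oc (rep_hom_val r).2).
Proof.
apply/eqP; move: (rep_homP s) (rep_homP r) => /eqP sP /eqP rP /=.
by rewrite -compA rP compA sP -compA -actm_comp comp1m.
Qed.

Definition rep_comp X Y Z (s : rep_hom Y Z) (r : rep_hom X Y) : rep_hom X Z :=
  RepHom (rep_comp_comm s r).

Definition RepCat : linCat k.
Proof.
refine (@LinCat k rep (fun X Y => rep_hom X Y : lmodType k) rep_id rep_comp
          _ _ _ _ _).
- by move=> W X Y Z h g f; apply: val_inj; rewrite /= !compA.
- by move=> X Y f; apply: val_inj; rewrite /= !comp1m; case: (rep_hom_val f).
- by move=> X Y f; apply: val_inj; rewrite /= !compm1; case: (rep_hom_val f).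
- by move=> X Y Z c f g h; apply: val_inj; rewrite /= !comp_linl.
- by move=> X Y Z c h f g; apply: val_inj; rewrite /= !comp_linr.
Defined.

End Rep.

Definition mat2 (R : pzRingType) (x y z t : R) : 'M[R]_2 :=
  \matrix_(i, j) if i == 0 then if j == 0 then x else y
                 else if j == 0 then z else t.

Section Coxeter.
Variables (k : fieldType) (C : fusionCat k) (P : C).

Definition sigma_a : 'M[GrRing C]_2 := mat2 (-1) (clsC (ldual P)) 0 1.
Definition sigma_b : 'M[GrRing C]_2 := mat2 1 0 (clsC P) (-1).

(** The subgroup of GL_2([C]) generated by [sigma_a] and [sigma_b]; matrices
    over a noncommutative ring have no [unitmx], so inverses are explicit. *)
Inductive in_W : 'M[GrRing C]_2 -> Prop :=
| W_a : in_W sigma_a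
| W_b : in_W sigma_b
| W_one : in_W 1%:M
| W_mul A B : in_W A -> in_W B -> in_W (A *m B)
| W_inv A B : in_W A -> A *m B = 1%:M -> B *m A = 1%:M -> in_W B.

Definition coxC (v : 'cV[GrRing C]_2) : 'cV[GrRing C]_2 :=
  (sigma_a *m sigma_b) *m v.

End Coxeter.

Definition mxact (R : pzRingType) (V : lmodType R) (A : 'M[R]_2)
  (v : 'cV[V]_2) : 'cV[V]_2 := \col_i \sum_j A i j *: v j 0.

Definition coxM (k : fieldType) (C : fusionCat k) (P : C) (M : fssModCat C)
  (v : 'cV[GrMod M]_2) : 'cV[GrMod M]_2 := mxact (sigma_a P *m sigma_b P) v.

Definition has_order (T : Type) (f : T -> T) (n : nat) :=
  [/\ (0 < n)%N, iter n f =1 id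
    & forall m, (0 < m < n)%N -> ~ (iter m f =1 id)].

Definition finite_order (T : Type) (f : T -> T) :=
  exists2 n, (0 < n)%N & iter n f =1 id.

(** [N] is the matrix of left multiplication by [P] in the basis of simple
    objects [S]: row [i] holds the coordinates of [P] * [S i], as [eigenvalue]
    is about the action on row vectors. *)
Definition left_mult_matrix (k : fieldType) (C : fusionCat k) (P : C)
    n (S : 'I_n -> C) (N : 'M[int]_n) :=
  forall i, clsC P * clsC (S i) = \sum_j clsC (S j) *~ N i j.

(** The largest nonnegative eigenvalue; it does not depend on the labelling of
    the simple objects. *)
Definition FPdim (R : realType) (k : fieldType) (C : fusionCat k) (P : C) : R :=
  sup [set c : R | 0 <= c /\
    exists n (S : 'I_n -> C) (N : 'M[int]_n),
    [/\ simple_reps S, left_mult_matrix P S N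
      & eigenvalue (map_mx intr N) c]]%classic.

Arguments FPdim R {k C} P.

(* Main.v *)
From HB Require Import structures.
From mathcomp Require Import all_boot all_order all_algebra.
From mathcomp Require Import boolp classical_sets functions reals trigo.
From mathcomp Require topology normedtype derive.
From mathcomp Require Import ring lra.
Require Import Defs.

(** All four conditions say that [d = FPdim P] is less than 2. The group of
    classes of [M] has the simple objects as a basis; let [N] be the nonnegative
    integer matrix by which [P] acts. By the adjunction between the actions of
    dual objects (adj_up_lin_equiv) and Schur's lemma, [ldual P] acts by the
    transpose of [N].

    Perron-Frobenius theory enters once. In the regular module, right
    multiplication by the sum of the simple objects has a positive matrix, so its
    positive eigenvector is unique up to scaling and is an eigenvector of all
    left multiplications, which commute with it. The eigenvalues are the
    Frobenius-Perron dimensions; letting this eigenvector act on [M] yields an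
    additive functional [f], positive on simple objects, with
    [f (X y) = FPdim X * f y] for all [X] (FPdim_functional). In particular [f]
    multiplies by [d] along both [P] and its dual.

    The orbit of a simple class under the Coxeter element consists of
    noncommutative Chebyshev polynomials in [P] and its dual, so its weights
    under [f] are the Chebyshev numbers [cheb d n]. If [d >= 2] they grow
    strictly and the order is infinite. If [d < 2], write [d = 2 cos t]; the
    weights are proportional to [sin (n t)]. Schur's test with the positive
    eigenvector shows that the Tits form is positive definite. It is integral and
    invariant under the reflections, so every vector of the orbit, having form
    value 1, is nonnegative or nonpositive (tits_sign_coherent). Now let [m] be
    minimal with [m t >= pi]. The weights number [m - 1] and [m] cannot have
    strictly opposite signs, hence [m t = pi] (norm_cos); and the [m]th term of
    the Chebyshev sequence, being nonnegative of weight zero, vanishes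
    (alt_vanish). A Chebyshev sequence is antisymmetric about its zeros, and so
    the Coxeter element has order [m]. This handles the operator on [M] and, with
    the regular module for [M], the one on [C].

    For representations, an indecomposable one either is simple and concentrated
    at the sink, or has an epimorphic structure map. In the latter case it is
    determined by the kernel of this map, read through the adjunction as a
    representation for a dual of [P] (reflected_indecomposable,
    reflected_isomorphic); this reflection changes the pair of values of [f] by
    the Chebyshev recursion. If [d = 2 cos (pi / m)] the recursion changes signs
    after [m] steps, so every indecomposable representation reduces to a simple
    one in fewer than [m] reflections, which leaves finitely many (finite_reps).
    If [d >= 2], reflecting simple representations at the source any number of
    times yields indecomposable representations with infinitely many values of
    [f] (infinite_reps). *)

Set Implicit Arguments.
Unset Strict Implicit.
Unset Printing Implicit Defensive.

Import Order.TTheory GRing.Theory Num.Theory.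
Local Open Scope ring_scope.
Local Open Scope cat_scope.

(** * Dimension of hom spaces *)

Section Dimension.
Variable k : fieldType.
Implicit Types V W : lmodType k.

Definition lin_equiv V W (f : V -> W) (g : W -> V) :=
  [/\ linear f, cancel f g & cancel g f].

Definition has_dim V (n : nat) := exists (f : 'rV[k]_n -> V) g, lin_equiv f g.

Lemma lin_equiv_sym V W (f : V -> W) g : lin_equiv f g -> lin_equiv g f.
Proof.
move=> [fL fK gK]; split=> // a u v.
by rewrite -[u in LHS]gK -[v in LHS]gK -fL fK.
Qed.

Lemma lin_equiv_trans V W (U : lmodType k) (f : V -> W) g (h : W -> U) l :
  lin_equiv f g -> lin_equiv h l -> lin_equiv (h \o f) (g \o l).
Proof.
move=> [fL fK gK] [hL hK lK]; split; [|exact: can_comp|exact: can_comp].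
by move=> a u v /=; rewrite fL hL.
Qed.

(** A linear bijection between coordinate spaces has a matrix with independent
    rows, which bounds their number by that of the columns. *)
Lemma has_dim_uniq V m n : has_dim V m -> has_dim V n -> m = n.
Proof.
have le a b : has_dim V a -> has_dim V b -> (a <= b)%N.
  move=> [f [f' ff']] [g [g' gg']].
  have [hL hK _] := lin_equiv_trans ff' (lin_equiv_sym gg').
  pose h : {linear 'rV[k]_a -> 'rV[k]_b} :=
    HB.pack (g' \o f) (GRing.isLinear.Build _ _ _ _ (g' \o f) hL).
  have inj : injective h by exact: can_inj hK.
  have : row_free (lin1_mx h).
    rewrite -kermx_eq0 -submx0; apply/row_subP => i.
    have : row i (kermx (lin1_mx h)) *m lin1_mx h = 0.
      by rewrite -row_mul mulmx_ker row0.
    by rewrite mul_rV_lin1 -(linear0 h) => /inj ->; rewrite sub0mx.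
  by rewrite /row_free => /eqP <-; apply: rank_leq_col.
by move=> Vm Vn; apply/eqP; rewrite eqn_leq !le.
Qed.

Lemma has_dim_equiv V W (f : V -> W) g n : lin_equiv f g -> has_dim V n -> has_dim W n.
Proof.
by move=> fg [h [l hl]]; exists (f \o h), (l \o g); apply: lin_equiv_trans fg.
Qed.

Lemma has_dim0 V : (forall v : V, v = 0) -> has_dim V 0.
Proof.
move=> V0; exists (fun=> 0), (fun=> 0); split=> [a u v|u|v].
- by rewrite scaler0 addr0.
- by rewrite [u]thinmx0.
- by rewrite [RHS]V0.
Qed.

Lemma has_dim1 V (e : V) : e != 0 -> (forall v, exists c, v = c *: e) ->
  has_dim V 1.
Proof.
move=> e0 sp; pose g v := (sval (cid (sp v)))%:M : 'rV[k]_1.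
exists (fun u : 'rV_1 => u 0 0 *: e), g; split=> [a u v|u|v].
- by rewrite !mxE scalerDl scalerA.
- rewrite [RHS]mx11_scalar /g; case: cid => c /= /eqP.
  by rewrite -subr_eq0 -scalerBl scaler_eq0 (negPf e0) orbF subr_eq0 => /eqP->.
- by rewrite mxE eqxx mulr1n /g; case: cid.
Qed.

Lemma has_dimD V1 V2 V m n (j1 : V1 -> V) (j2 : V2 -> V) (q1 : V -> V1)
    (q2 : V -> V2) :
    linear j1 -> linear j2 ->
    (forall v, j1 (q1 v) + j2 (q2 v) = v) ->
    (forall u v, q1 (j1 u + j2 v) = u) -> (forall u v, q2 (j1 u + j2 v) = v) ->
  has_dim V1 m -> has_dim V2 n -> has_dim V (m + n).
Proof.
move=> j1L j2L jq q1E q2E [f [f' [fL fK f'K]]] [g [g' [gL gK g'K]]].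
exists (fun v : 'rV_(m + n) => j1 (f (lsubmx v)) + j2 (g (rsubmx v))),
  (fun v => row_mx (f' (q1 v)) (g' (q2 v))); split=> [a u v|u|v].
- rewrite !linearP /= fL gL j1L j2L scalerDr !addrA; congr (_ + _).
  by rewrite addrAC.
- by rewrite q1E q2E fK gK hsubmxK.
- by rewrite row_mxKl row_mxKr f'K g'K jq.
Qed.

(** The value 0 at spaces of infinite dimension is a mere default. *)
Definition lmod_dim V : nat := xget 0%N (has_dim V).

Lemma lmod_dimE V n : has_dim V n -> lmod_dim V = n.
Proof.
by move=> Vn; apply: (has_dim_uniq (V := V)) => //; apply: (@xgetPex _ 0%N); exists n.
Qed.

End Dimension.

(** * Semisimple linear categories and their Grothendieck groups *)

Section Abelian.
Variables (k : fieldType) (A : linCat k).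
Hypothesis abA : is_abelian A.
Implicit Types X Y Z S T : A.

Lemma comp_linear_l X Y Z (h : hom X Y) : linear (fun f : hom Y Z => f \oc h).
Proof. by move=> a f g; rewrite comp_linl. Qed.

Lemma comp_linear_r X Y Z (h : hom Y Z) : linear (fun f : hom X Y => h \oc f).
Proof. by move=> a f g; rewrite comp_linr. Qed.

Lemma isomorphic_sym X Y : isomorphic X Y -> isomorphic Y X.
Proof. by case=> -[f g gf fg]; exists; exists g f. Qed.

Lemma isomorphic_trans X Y Z :
  isomorphic X Y -> isomorphic Y Z -> isomorphic X Z.
Proof.
case=> -[f g gf fg] [[h l lh hl]]; exists; exists (h \oc f) (g \oc l).
  by rewrite -compA [l \oc _]compA lh comp1m.
by rewrite -compA [f \oc _]compA fg comp1m.
Qed.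

Lemma is_iso_isomorphic X Y (f : hom X Y) : is_iso f -> isomorphic X Y.
Proof. by case=> g [gf fg]; exists; exists f g. Qed.

Lemma zero_id Z : is_zero Z -> idm Z = 0.
Proof. by move=> Z0; apply: (Z0 Z).1. Qed.

Lemma zero_isomorphic X Y : isomorphic X Y -> is_zero X -> is_zero Y.
Proof.
case=> -[f g _ fg] X0; apply: is_zeroP.
by rewrite -fg ((X0 Y).1 g) compm0.
Qed.

Lemma simple_isomorphic X Y : isomorphic X Y -> is_simple X -> is_simple Y.
Proof.
move=> iXY [nX sX]; split=> [/(zero_isomorphic (isomorphic_sym iXY))//|Z f mf].
case: iXY => -[u v vu uv].
have mvf : is_mono (v \oc f).
  move=> T g h E; apply: mf; rewrite -[f]comp1m -uv -!compA.
  by congr (_ \oc _); rewrite !compA.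
case: (sX _ _ mvf) => [vf0|[g [gvf vfg]]].
  by left; rewrite -[f]comp1m -uv -compA vf0 compm0.
right; exists (g \oc v); split; first by rewrite -compA.
by rewrite -[LHS]comp1m -uv -!compA [f \oc _]compA [v \oc (f \oc _ \oc _)]compA [v \oc (f \oc g)]compA
    vfg comp1m.
Qed.

(** The summand is the kernel of the complementary idempotent. *)
Lemma idempotent_split X (e : hom X X) : e \oc e = e ->
  exists Y (i : hom Y X) (p : hom X Y), p \oc i = idm Y /\ i \oc p = e.
Proof.
move=> ee; have [_ _ kc _ _] := abA.
have [[Y [i ki]] _] := kc _ _ (idm X - e).
have [|p [ip _]] := ki.2 _ e; first by rewrite compBl comp1m ee subrr.
exists Y, i, p; split=> //; apply: (kernel_mono ki).
have := ki.1; rewrite compBl comp1m => /eqP; rewrite subr_eq0 => /eqP ie.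
by rewrite compA ip compm1 -ie.
Qed.

Lemma idempotent_dsum X (e : hom X X) : e \oc e = e ->
  exists Y Z (i1 : hom Y X) (i2 : hom Z X) p1 p2,
    [/\ is_biproduct i1 i2 p1 p2, i1 \oc p1 = e & i2 \oc p2 = idm X - e].
Proof.
move=> ee; have [Y [i1 [p1 [pi1 ip1]]]] := idempotent_split ee.
have ff : (idm X - e) \oc (idm X - e) = idm X - e.
  by rewrite !compBl !compBr !comp1m compm1 ee subrr subr0.
have [Z [i2 [p2 [pi2 ip2]]]] := idempotent_split ff.
exists Y, Z, i1, i2, p1, p2; split=> //; split=> //.
- rewrite -[LHS]compm1 -pi2 -[LHS]comp1m -pi1 -!compA.
  rewrite [i1 \oc (p1 \oc _)]compA ip1 [i2 \oc (p2 \oc _)]compA ip2.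
  by rewrite [e \oc _]compA compBr compm1 ee subrr comp0m compm0.
- rewrite -[LHS]compm1 -pi1 -[LHS]comp1m -pi2 -!compA.
  rewrite [i1 \oc (p1 \oc _)]compA ip1 [i2 \oc (p2 \oc _)]compA ip2.
  by rewrite [(idm X - e) \oc _]compA compBl comp1m ee subrr comp0m compm0.
- by rewrite ip1 ip2 addrC subrK.
Qed.

Lemma bigdsum_split n (F : 'I_n.+1 -> A) X : is_bigdsum F X ->
  exists2 X', is_dsum (F ord0) X' X & is_bigdsum (fun a => F (lift ord0 a)) X'.
Proof.
move=> [i [p [pi1 pi0 ip1]]].
pose f := idm X - i ord0 \oc p ord0.
have ff : f \oc f = f.
  rewrite /f !compBl !compBr !comp1m compm1 -compA [p ord0 \oc _]compA pi1 comp1m.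
  by rewrite subrr subr0.
have [X' [i' [p' [pi' ip']]]] := idempotent_split ff.
have fi a : f \oc i (lift ord0 a) = i (lift ord0 a).
  by rewrite /f compBl comp1m -compA pi0 // compm0 subr0.
have pf a : p (lift ord0 a) \oc f = p (lift ord0 a).
  by rewrite /f compBr compm1 compA pi0 // comp0m subr0.
have p0f : p ord0 \oc f = 0 by rewrite /f compBr compm1 compA pi1 comp1m subrr.
have fi0 : f \oc i ord0 = 0 by rewrite /f compBl comp1m -compA pi1 compm1 subrr.
exists X'.
  exists (i ord0), i', (p ord0), p'; split=> //.
  - by rewrite -[i']compm1 -pi' [i' \oc _]compA ip' compA p0f comp0m.
  - by rewrite -[p']comp1m -pi' -!compA [i' \oc _]compA ip' fi0 compm0.
  - by rewrite ip' /f addrC subrK.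
exists (fun a => p' \oc i (lift ord0 a)), (fun a => p (lift ord0 a) \oc i').
split=> [a|a b ab|].
- by rewrite -compA [i' \oc _]compA ip' fi pi1.
- by rewrite -compA [i' \oc _]compA ip' fi pi0 // (inj_eq lift_inj).
have -> : idm X' = p' \oc f \oc i'.
  by rewrite -ip' compA pi' comp1m pi'.
have fE : f = \sum_(a < n) i (lift ord0 a) \oc p (lift ord0 a).
  by rewrite /f -ip1 big_ord_recl addrC addKr.
rewrite [in RHS]fE comp_sumr comp_suml; apply: eq_bigr => a _.
by rewrite !compA.
Qed.

(** Invariants that add up over direct sums are compared one simple summand at
    a time. *)
Lemma semisimple_ind (Q : A -> Prop) :
  (forall Z, is_zero Z -> Q Z) ->
  (forall S X Y, is_simple S -> is_dsum S X Y -> Q X -> Q Y) ->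
  is_semisimple A -> forall X, Q X.
Proof.
move=> Q0 QD ssA X; have [n [F [sF dF]]] := ssA X.
elim: n X F sF dF => [|n IH] X F sF dF.
  case: dF => i [p [_ _ ip1]]; apply: Q0; apply: is_zeroP.
  by rewrite -ip1 big_ord0.
have [X' dX dX'] := bigdsum_split dF.
by apply: QD dX _ => //; apply: (IH X' (fun a => F (lift ord0 a))).
Qed.

Lemma cls_dsum X Y S : is_dsum X Y S -> cls S = cls X + cls Y.
Proof.
move=> [i1 [i2 [p1 [p2 bi]]]].
exact: cls_exact (biproduct_short_exact bi).
Qed.

Lemma cls_zero Z : is_zero Z -> cls Z = 0.
Proof.
move=> Z0; have /cls_dsum : is_dsum Z Z Z.
  exists 0, 0, 0, 0.
  by split; rewrite ?comp0m ?addr0 // zero_id.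
by rewrite -[LHS]addr0 => /addrI.
Qed.

Lemma cls_isomorphic X Y : isomorphic X Y -> cls X = cls Y.
Proof. by case=> f; apply: cls_iso f. Qed.

Lemma has_dim_hom_dsum T X Y S m n : is_dsum X Y S ->
  has_dim (hom T X) m -> has_dim (hom T Y) n -> has_dim (hom T S) (m + n).
Proof.
move=> [i1 [i2 [p1 [p2 [e1 e2 e12 e21 e]]]]].
apply: (@has_dimD _ _ _ _ _ _ (fun f => i1 \oc f) (fun f => i2 \oc f)
  (fun f => p1 \oc f) (fun f => p2 \oc f)); try exact: comp_linear_r.
- by move=> f; rewrite !compA -compDl e comp1m.
- by move=> f g; rewrite compDr !compA e1 e12 comp1m comp0m addr0.
- by move=> f g; rewrite compDr !compA e2 e21 comp1m comp0m add0r.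
Qed.

Lemma has_dim_hom_dsum_l T X Y S m n : is_dsum X Y S ->
  has_dim (hom X T) m -> has_dim (hom Y T) n -> has_dim (hom S T) (m + n).
Proof.
move=> [i1 [i2 [p1 [p2 [e1 e2 e12 e21 e]]]]].
apply: (@has_dimD _ _ _ _ _ _ (fun f => f \oc p1) (fun f => f \oc p2)
  (fun f => f \oc i1) (fun f => f \oc i2)); try exact: comp_linear_l.
- by move=> f; rewrite -!compA -compDr e compm1.
- by move=> f g; rewrite compDl -!compA e1 e21 compm1 compm0 addr0.
- by move=> f g; rewrite compDl -!compA e2 e12 compm1 compm0 add0r.
Qed.

Lemma short_exact_dsum X Y Z (f : hom X Y) (g : hom Y Z) :
  is_semisimple A -> short_exact f g -> is_dsum X Z Y.
Proof.
move=> ssA fg; have [r [s bi]] := short_exact_split abA ssA fg.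
by exists f, s, r, g.
Qed.

Lemma epi_section X Y (g : hom Y X) : is_semisimple A -> is_epi g ->
  exists s, g \oc s = idm X.
Proof. by move=> ssA; have [n [F [sF dF]]] := ssA X; apply: epi_split dF. Qed.

(** An epimorphism is the cokernel of something, and that something factors
    through the kernel. *)
Lemma epi_cokernel X Y K (f : hom X Y) (i : hom K X) :
  is_kernel f i -> is_epi f -> is_cokernel i f.
Proof.
have [_ _ _ _ epi] := abA.
move=> ki /epi[Z [g [fg0 cg]]]; split=> [|T t ti0]; first exact: ki.1.
have [u [iu _]] := ki.2 _ _ fg0.
by apply: cg; rewrite -iu compA ti0 comp0m.
Qed.

Lemma nonzero_simple_summand X : is_semisimple A -> ~ is_zero X ->
  exists2 S, is_simple S & exists (i : hom S X) p, p \oc i = idm S.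
Proof.
move=> ssA; move: X; apply: semisimple_ind => // S X Y sS [i1 [_ [p1 [_ [e1 _ _ _ _]]]]] _ _.
by exists S => //; exists i1, p1.
Qed.

End Abelian.

Section Semisimple.
Variables (k : closedFieldType) (A : linCat k).
Hypothesis abA : is_abelian A.
Hypothesis finA : forall X Y : A, fin_dim (hom X Y).
Hypothesis ssA : is_semisimple A.
Implicit Types X Y Z S T : A.

(** Over an algebraically closed field: composition with an endomorphism [f]
    is a linear operator on the finite-dimensional space of endomorphisms, so
    that it has an eigenvector [g]; as [g] is invertible, [f] is its
    eigenvalue. *)
Lemma endo_simple_scalar S (f : hom S S) : is_simple S ->
  exists c, f = c *: idm S.
Proof.
move=> sS.
have idS : idm S <> 0 by move=> /is_zeroP /sS.1.
pose gen n := `[< exists e : 'I_n -> hom S S, forall v, exists c : 'I_n -> k,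
  v = \sum_i c i *: e i >].
have exg : exists n, gen n.
  by have [n [e es]] := finA S S; exists n; apply/asboolP; exists e.
case: (ex_minnP exg) => n /asboolP[e es] min.
have freeE (v : 'rV[k]_n) : \sum_i v 0 i *: e i = 0 -> v = 0.
  case: n e es min v => [|n] e es min v v0; first by rewrite [v]thinmx0.
  apply/rowP => i0; rewrite mxE; apply/eqP; apply: contraT => vi0.
  suff /min : gen n by rewrite ltnn.
  apply/asboolP; exists (fun j => e (lift i0 j)) => g.
  have [c ->] := es g.
  have ei0 : e i0 = \sum_j (- (v 0 i0)^-1 * v 0 (lift i0 j)) *: e (lift i0 j).
    move: v0; rewrite (bigD1_ord i0) //= => /eqP; rewrite addr_eq0 => /eqP E.
    rewrite -[LHS]scale1r -(mulVf vi0) -scalerA E scalerN scaler_sumr -sumrN.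
    by apply: eq_bigr => j _; rewrite scalerA mulNr scaleNr.
  exists (fun j => c i0 * (- (v 0 i0)^-1 * v 0 (lift i0 j)) + c (lift i0 j)).
  rewrite (bigD1_ord i0) //= ei0 scaler_sumr -big_split /=.
  by apply: eq_bigr => j _; rewrite scalerDl !scalerA.
have [B BE] : exists B : 'M[k]_n, forall i, f \oc e i = \sum_j B i j *: e j.
  exists (\matrix_(i, j) sval (cid (es (f \oc e i))) j) => i.
  by under eq_bigr do rewrite mxE; exact: (svalP (cid (es (f \oc e i)))).
case: n {min} e es freeE B BE => [|n] e es freeE B BE.
  by case: idS; have [c ->] := es (idm S); rewrite big_ord0.
have [|c] := @closed_rootP k (char_poly B) _; first by rewrite size_char_poly.
rewrite -eigenvalue_root_char => /eigenvalueP[v vB v0].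
pose g := \sum_i v 0 i *: e i.
have fg : f \oc g = c *: g.
  rewrite /g comp_sumr scaler_sumr.
  under eq_bigr do rewrite -[_ *: e _]addr0 comp_linr compm0 addr0 BE scaler_sumr.
  rewrite exchange_big; apply: eq_bigr => j _ /=.
  have := congr1 (fun u : 'rV_n.+1 => u 0 j) vB; rewrite !mxE scalerA => <-.
  by rewrite scaler_suml; apply: eq_bigr => i _; rewrite scalerA.
have [h [_ gh]] : is_iso g.
  apply: Schur => // g0; move/eqP: v0; apply; exact: freeE.
exists c; rewrite -[f]compm1 -gh compA fg.
by rewrite -[c *: g]addr0 comp_linl comp0m addr0.
Qed.

Lemma has_dim_hom_simple S T : is_simple S -> is_simple T ->
  has_dim (hom S T) `[< isomorphic S T >].
Proof.
move=> sS sT; case: asboolP => [[f]|nST].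
  have fK : cancel (fun h : hom S S => f \oc h) (fun h => bwd f \oc h).
    by move=> h; rewrite compA bwdK comp1m.
  apply: (@has_dim_equiv _ (hom S S) _ (fun h => f \oc h) (fun h => bwd f \oc h)).
    split=> [|//|h]; first exact: comp_linear_r.
    by rewrite compA fwdK comp1m.
  apply: (has_dim1 (e := idm S)); first by apply/eqP=> /is_zeroP /sS.1.
  by move=> h; apply: endo_simple_scalar.
apply: has_dim0 => f; apply: contrapT => f0; apply: nST.
exact: is_iso_isomorphic (Schur abA sS sT f0).
Qed.

(** Both spaces add up over the simple summands of [X], and Schur's lemma is
    symmetric in two simple objects. This symmetry is what makes the matrices of
    dual objects transposes of each other. *)
Lemma has_dim_hom T X : is_simple T ->
  exists n, has_dim (hom T X) n /\ has_dim (hom X T) n.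
Proof.
move=> sT; move: X.
apply: (semisimple_ind abA _ _ ssA) => [Z Z0|S X Y sS dY [n [h1 h2]]].
  by exists 0%N; split; apply: has_dim0 => f; have [] := Z0 T.
exists (`[< isomorphic S T >] + n)%N; split.
  apply: has_dim_hom_dsum dY _ h1.
  rewrite (_ : `[< _ >] = `[< isomorphic T S >]); first exact: has_dim_hom_simple.
  by apply: asbool_equiv_eq; split; apply: isomorphic_sym.
by apply: has_dim_hom_dsum_l dY _ h2; apply: has_dim_hom_simple.
Qed.

Definition mult T X : nat := lmod_dim (hom T X).

Lemma mult_has_dim T X : is_simple T -> has_dim (hom T X) (mult T X).
Proof. by move=> /(has_dim_hom X)[n [/[dup] /lmod_dimE <-]]. Qed.

Lemma mult_sym T X : is_simple T -> lmod_dim (hom X T) = mult T X.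
Proof. by move=> /(has_dim_hom X)[n [/lmod_dimE + /lmod_dimE]] => <-. Qed.

Lemma mult_simple S T : is_simple S -> is_simple T ->
  mult S T = `[< isomorphic S T >].
Proof. by move=> sS sT; apply/lmod_dimE/has_dim_hom_simple. Qed.

Lemma mult_zero T Z : is_zero Z -> mult T Z = 0%N.
Proof. by move=> Z0; apply/lmod_dimE/has_dim0/(Z0 T).1. Qed.

Lemma mult_dsum T X Y Z : is_simple T -> is_dsum X Y Z ->
  mult T Z = (mult T X + mult T Y)%N.
Proof.
by move=> sT dZ; apply/lmod_dimE/(has_dim_hom_dsum dZ); apply: mult_has_dim.
Qed.

Lemma mult_exact T : is_simple T ->
  exact_additive (fun X => (mult T X)%:Z).
Proof.
move=> sT X Y Z f g fg.
by rewrite (mult_dsum sT (short_exact_dsum abA ssA fg)) PoszD.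
Qed.

Definition K0mult T (x : K0 A) : int := K0lift (fun X => (mult T X)%:Z) x.

Lemma K0mult_cls T X : is_simple T -> K0mult T (cls X) = mult T X.
Proof. by move=> sT; apply/K0lift_cls/mult_exact. Qed.

Lemma K0multD T x y : is_simple T -> K0mult T (x + y) = K0mult T x + K0mult T y.
Proof. by move=> sT; apply/K0liftD/mult_exact. Qed.

Lemma K0mult0 T : is_simple T -> K0mult T 0 = 0.
Proof. by move=> sT; apply/K0lift0/mult_exact. Qed.

Lemma K0multN T x : is_simple T -> K0mult T (- x) = - K0mult T x.
Proof. by move=> sT; apply/K0liftN/mult_exact. Qed.

Lemma K0mult_sum T n (F : 'I_n -> K0 A) : is_simple T ->
  K0mult T (\sum_i F i) = \sum_i K0mult T (F i).
Proof.
move=> sT; apply: (big_morph (K0mult T)) => [x y|]; first exact: K0multD.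
exact: K0mult0.
Qed.

Lemma K0multMz T x m : is_simple T -> K0mult T (x *~ m) = K0mult T x * m.
Proof.
move=> sT; have nat_case p : K0mult T (x *+ p) = K0mult T x * p%:Z.
  elim: p => [|p IH]; first by rewrite mulr0n mulr0 K0mult0.
  by rewrite mulrS K0multD // IH intS mulrDr mulr1.
case: m => m; first exact: nat_case.
by rewrite NegzE mulrNz K0multN // mulrN; congr (- _); apply: nat_case.
Qed.

Section Coordinates.
Variables (n : nat) (S : 'I_n -> A).
Hypothesis repS : simple_reps S.
Let sS i : is_simple (S i) := let: And3 s _ _ := repS in s i.

Lemma mult_reps i j : mult (S i) (S j) = (i == j).
Proof.
rewrite mult_simple //; case: asboolP => [|nij].
  by have [_ inj _] := repS; move=> /inj ->; rewrite eqxx.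
case: eqP => // ij; case: nij; rewrite ij.
by exists; exists (idm _) (idm _); rewrite comp1m.
Qed.

(** The classes of the simple objects form a basis of the Grothendieck group:
    they span by additivity, and the multiplicities are the dual basis. *)
Lemma K0_expand x : x = \sum_i cls (S i) *~ K0mult (S i) x.
Proof.
elim/K0_ind: x => [|X|x IH|x y IHx IHy].
- by rewrite big1 // => i _; rewrite K0mult0.
- under eq_bigr do rewrite K0mult_cls //.
  move: X; apply: (semisimple_ind abA _ _ ssA) => [Z Z0|T X Y sT dY IH].
    rewrite cls_zero // big1 // => i _.
    by rewrite mult_zero.
  rewrite (cls_dsum dY) IH; have [_ _ /(_ T sT)[j Tj]] := repS.
  under [in RHS]eq_bigr do rewrite (mult_dsum _ dY) // PoszD mulrzDr.
  rewrite big_split /=; congr (_ + _).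
  rewrite (cls_isomorphic abA Tj) (bigD1 j) //= big1 ?addr0 => [|i ij].
    rewrite mult_simple // asboolT //; exact: isomorphic_sym.
  rewrite mult_simple // asboolF // => /isomorphic_trans /(_ Tj).
  by have [_ inj _] := repS => /inj ji; rewrite ji eqxx in ij.
- rewrite [LHS](congr1 -%R IH) -sumrN.
  by apply: eq_bigr => i _; rewrite K0multN // mulrNz.
- rewrite [LHS](congr2 +%R IHx IHy) -big_split /=.
  by apply: eq_bigr => i _; rewrite K0multD // mulrzDr.
Qed.

Lemma K0mult_inj x y : (forall i, K0mult (S i) x = K0mult (S i) y) -> x = y.
Proof.
by move=> xy; rewrite (K0_expand x) (K0_expand y); apply: eq_bigr => i _; rewrite xy.
Qed.

Lemma mult_zeroP X : (forall i, mult (S i) X = 0%N) -> is_zero X.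
Proof.
move=> X0; apply: contrapT => /(nonzero_simple_summand abA ssA)[T sT [i [p pi]]].
have [_ _ /(_ T sT)[j Tj]] := repS; case: (isomorphic_sym Tj) => u.
have := mult_has_dim X (sS j); rewrite X0 => -[f [g [fL fK gK]]].
have iu0 : i \oc u = 0 by rewrite -[LHS]gK -[RHS]gK; congr (f _); rewrite [LHS]thinmx0 [RHS]thinmx0.
apply: sT.1; apply: is_zeroP.
by rewrite -pi -[i]compm1 -(fwdK u) [i \oc _]compA iu0 comp0m compm0.
Qed.

End Coordinates.

(** Keep, in a list meeting every class of simple objects, the first simple
    member of each class. *)
Lemma simple_reps_exist n (S0 : 'I_n -> A) :
    (forall X, is_simple X -> exists i, isomorphic X (S0 i)) ->
  exists m (S : 'I_m -> A), simple_reps S.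
Proof.
move=> allS.
pose good (i : 'I_n) := `[< is_simple (S0 i) >] &&
  [forall j : 'I_n, (j < i)%N ==> ~~ `[< isomorphic (S0 i) (S0 j) >]].
exists #|good|, (fun a => S0 (enum_val a)).
have gP (a : 'I_#|good|) : good (enum_val a) by have := enum_valP a.
split=> [a|a b iab|X sX].
- by have /andP[/asboolP] := gP a.
- apply: enum_val_inj; apply: val_inj; apply/eqP; rewrite eqn_leq.
  rewrite (leqNgt (enum_val a)) (leqNgt (enum_val b)).
  apply/andP; split; apply/negP => lt.
    have /andP[_ /forallP/(_ (enum_val b))] := gP a.
    by rewrite lt /= => /negP; apply; apply/asboolP.
  have /andP[_ /forallP/(_ (enum_val a))] := gP b.
  by rewrite lt /= => /negP; apply; apply/asboolP; apply: isomorphic_sym.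
have ex : exists i, (i < n)%N && `[< exists i0 : 'I_n, i = i0 /\ isomorphic X (S0 i0) >].
  have [i iX] := allS X sX; exists i; rewrite ltn_ord /=.
  by apply/asboolP; exists i.
case: (ex_minnP ex) => i /andP[_ /asboolP[i0 [-> Xi]]] min.
have gi : i0 \in good.
  rewrite unfold_in /good; apply/andP; split.
    exact/asboolP/(simple_isomorphic Xi).
  apply/forallP => j; apply/implyP => lt; apply/negP => /asboolP ij.
  have := min j; rewrite ltn_ord /= leqNgt lt => /(_ _)/negP; apply => //.
  by apply/asboolP; exists j; split=> //; apply: isomorphic_trans ij.
by exists (enum_rank_in gi i0); rewrite enum_rankK_in.
Qed.

End Semisimple.

(** * Duals act by adjoint functors *)

Section Adjunction.
Variables (k : fieldType) (C : monCat k) (M : modCat C).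
Implicit Types (X Y Z : C) (N K A : M).

Local Notation "X <| f" := (actm (idm X) f) (at level 39).
Local Notation "f |> N" := (actm f (idm N)) (at level 39).

Lemma actl_comp X N N' N'' (g : hom N' N'') (f : hom N N') :
  X <| (g \oc f) = X <| g \oc X <| f.
Proof. by rewrite -actm_comp comp1m. Qed.

Lemma actr_comp X X' X'' N (g : hom X' X'') (f : hom X X') :
  (g \oc f) |> N = g |> N \oc f |> N.
Proof. by rewrite -actm_comp comp1m. Qed.

Lemma act_exchange X X' N N' (f : hom X X') (g : hom N N') :
  f |> N' \oc X <| g = X' <| g \oc f |> N.
Proof. by rewrite -!actm_comp !comp1m !compm1. Qed.

Lemma actl_linear X N N' : linear (fun f : hom N N' => X <| f).
Proof. by move=> c f g; rewrite actm_linr. Qed.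

Lemma actl0 X N N' : X <| (0 : hom N N') = 0.
Proof.
have := actl_linear X (- 1) (0 : hom N N') 0.
by rewrite scaler0 addr0 scaleN1r addNr.
Qed.

Lemma act_zero X N : is_zero N -> is_zero (X \act N).
Proof.
by move=> /zero_id N0; apply: is_zeroP; rewrite -actm1 N0 actl0.
Qed.

Lemma act_zero_l X N : is_zero X -> is_zero (X \act N).
Proof.
move=> /zero_id X0; apply: is_zeroP; rewrite -actm1 X0.
have := actm_linl (- 1) (0 : hom X X) 0 (idm N).
by rewrite scaler0 addr0 scaleN1r addNr.
Qed.

(** Rewriting with an equation between composites inside a longer,
    right-associated, composite. *)
Lemma comp_in (B : linCat k) (S T U W : B) (g : hom T U) (f : hom S T)
    (h : hom S U) : g \oc f = h ->
  forall x : hom W S, g \oc (f \oc x) = h \oc x.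
Proof. by move=> <- x; rewrite compA. Qed.

Lemma massoc_actl X Y N N' (f : hom N N') :
  X <| (Y <| f) \oc massoc X Y N = massoc X Y N' \oc (X \ox Y) <| f.
Proof. by rewrite massoc_nat tensm1. Qed.

Lemma massoc_actr X X' Y N (f : hom X X') :
  f |> (Y \act N) \oc massoc X Y N = massoc X' Y N \oc tensm f (idm Y) |> N.
Proof. by rewrite -massoc_nat actm1. Qed.

Lemma massoc_actm X Y Y' N (f : hom Y Y') :
  X <| (f |> N) \oc massoc X Y N = massoc X Y' N \oc tensm (idm X) f |> N.
Proof. by rewrite -massoc_nat. Qed.

Lemma cancel_iso_r (B : linCat k) (S T U : B) (f : iso S T) (g h : hom T U) :
  g \oc f = h \oc f -> g = h.
Proof. by move=> gh; rewrite -[g]compm1 -[h]compm1 -(fwdK f) !compA gh. Qed.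

Lemma cancel_iso_l (B : linCat k) (S T U : B) (f : iso S T) (g h : hom U S) :
  f \oc g = f \oc h -> g = h.
Proof. by move=> gh; rewrite -[g]comp1m -[h]comp1m -(bwdK f) -!compA gh. Qed.

(** Kelly's argument: the compatibility of the two left unit constraints
    follows from the pentagon and the triangles, after acting by the unit
    object, which is faithful. *)
Lemma munit_massoc X N :
  munit (X \act N) \oc massoc (tunit C) X N = lunit X |> N.
Proof.
pose I := tunit C.
have aux (B : M) (f g : hom B (X \act N)) : I <| f = I <| g -> f = g.
  move=> fg; apply: (cancel_iso_r (f := munit B)).
  by rewrite !munit_nat fg.
apply: aux.
apply: (cancel_iso_r (f := massoc I (I \ox X) N)).
have an : is_iso (assoc I I X |> N).
  exists (bwd (assoc I I X) |> N).
  by rewrite -!actr_comp bwdK fwdK !actm1.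
have [b [_ ab]] := an.
suff E : I <| (munit (X \act N) \oc massoc I X N) \oc massoc I (I \ox X) N
      \oc assoc I I X |> N
    = I <| (lunit X |> N) \oc massoc I (I \ox X) N \oc assoc I I X |> N.
  by rewrite -[LHS]compm1 -[RHS]compm1 -ab !compA E.
rewrite actl_comp -[LHS]compA -compA [I <| massoc _ _ _ \oc _]compA.
rewrite -mpentagon compA mtriangle massoc_actr -triangle.
by rewrite actr_comp compA massoc_actm.
Qed.

Section DualPair.
Variables (L P : C) (ev : hom (L \ox P) (tunit C)) (coev : hom (tunit C) (P \ox L)).
Hypothesis zigP : runit P \oc tensm (idm P) ev \oc assoc P L P
        \oc tensm coev (idm P) \oc bwd (lunit P) = idm P.
Hypothesis zigL : lunit L \oc tensm ev (idm L) \oc bwd (assoc L P L)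
        \oc tensm (idm L) coev \oc bwd (runit L) = idm L.

Definition adj_up K A (g : hom (L \act K) A) : hom K (P \act A) :=
  P <| g \oc massoc P L K \oc coev |> K \oc bwd (munit K).

Definition adj_down K A (h : hom K (P \act A)) : hom (L \act K) A :=
  munit A \oc ev |> A \oc bwd (massoc L P A) \oc L <| h.

Lemma adj_up_nat K A A' (f : hom A A') (g : hom (L \act K) A) :
  adj_up (f \oc g) = P <| f \oc adj_up g.
Proof. by rewrite /adj_up actl_comp !compA. Qed.

Lemma adj_down_nat K K' A (h : hom K (P \act A)) (f : hom K' K) :
  adj_down (h \oc f) = adj_down h \oc L <| f.
Proof. by rewrite /adj_down actl_comp !compA. Qed.

Lemma bwd_massoc_actl X Y N N' (f : hom N N') :
  bwd (massoc X Y N') \oc X <| (Y <| f) = (X \ox Y) <| f \oc bwd (massoc X Y N).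
Proof.
apply: (cancel_iso_l (f := massoc X Y N')); rewrite compA fwdK comp1m.
by rewrite compA -massoc_actl -compA fwdK compm1.
Qed.

Lemma bwd_munit_nat N N' (f : hom N N') :
  bwd (munit N') \oc f = tunit C <| f \oc bwd (munit N).
Proof.
apply: (cancel_iso_l (f := munit N')); rewrite compA fwdK comp1m.
by rewrite compA -munit_nat -compA fwdK compm1.
Qed.

Lemma bwd_massoc_actr X X' Y N (f : hom X X') :
  bwd (massoc X' Y N) \oc f |> (Y \act N)
    = tensm f (idm Y) |> N \oc bwd (massoc X Y N).
Proof.
apply: (cancel_iso_l (f := massoc X' Y N)); rewrite compA fwdK comp1m.
by rewrite compA -massoc_actr -compA fwdK compm1.
Qed.

Lemma bwd_massoc_actm X Y Y' N (f : hom Y Y') :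
  bwd (massoc X Y' N) \oc X <| (f |> N)
    = tensm (idm X) f |> N \oc bwd (massoc X Y N).
Proof.
apply: (cancel_iso_l (f := massoc X Y' N)); rewrite compA fwdK comp1m.
by rewrite compA -massoc_actm -compA fwdK compm1.
Qed.

(** By naturality it suffices to treat the identity of [L \act K], where the
    claim is the zigzag identity of [L] acting on [K], up to coherence. *)
Lemma adj_upK K A (g : hom (L \act K) A) : adj_down (adj_up g) = g.
Proof.
have nat1 : adj_down (adj_up g) = g \oc adj_down (adj_up (idm (L \act K))).
  rewrite -[g in LHS]compm1 adj_up_nat /adj_down !actl_comp.
  rewrite -!compA (comp_in (bwd_massoc_actl _ _ _)) -!compA.
  rewrite (comp_in (act_exchange _ _)) -!compA (comp_in (esym (munit_nat _))).
  by rewrite -!compA.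
rewrite nat1 -[RHS]compm1; congr (_ \oc _).
rewrite /adj_down /adj_up actm1 comp1m !actl_comp.
have pent : bwd (massoc L P (L \act K)) \oc L <| massoc P L K
    = massoc (L \ox P) L K \oc bwd (assoc L P L) |> K
        \oc bwd (massoc L (P \ox L) K).
  apply: (cancel_iso_l (f := massoc L P (L \act K))).
  rewrite compA fwdK comp1m !compA mpentagon.
  apply: (cancel_iso_r (f := massoc L (P \ox L) K)).
  rewrite -[RHS]compA bwdK compm1 -[RHS]compA -actr_comp fwdK actm1.
  by rewrite compm1.
have runitK : bwd (massoc L (tunit C) K) \oc L <| bwd (munit K)
    = bwd (runit L) |> K.
  apply: (cancel_iso_l (f := massoc L (tunit C) K)); rewrite compA fwdK comp1m.
  have ri : is_iso (L <| munit K).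
    exists (L <| bwd (munit K)).
    by rewrite -!actl_comp bwdK fwdK !actm1.
  case: ri => l [lr _]; rewrite -[LHS]comp1m -[RHS]comp1m -lr -!compA.
  congr (_ \oc _); rewrite [RHS]compA mtriangle -actl_comp -actr_comp.
  by rewrite !fwdK !actm1.
rewrite -!compA (comp_in pent) -!compA (comp_in (bwd_massoc_actm _ _ _)).
rewrite -!compA runitK (comp_in (massoc_actr _ _ _)).
rewrite -!compA (comp_in (munit_massoc _ _)).
by rewrite -!actr_comp -actm1 -[in RHS]zigL !compA.
Qed.

(** The same with the zigzag identity of [P] acting on [A]. *)
Lemma adj_downK K A (h : hom K (P \act A)) : adj_up (adj_down h) = h.
Proof.
have nat1 : adj_up (adj_down h) = adj_up (adj_down (idm (P \act A))) \oc h.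
  rewrite -[h in LHS]comp1m adj_down_nat /adj_up !actl_comp.
  rewrite -!compA (comp_in (massoc_actl _ _ _)) -!compA.
  rewrite (comp_in (esym (act_exchange _ _))) -!compA.
  by rewrite -bwd_munit_nat.
rewrite nat1 -[RHS]comp1m; congr (_ \oc _).
rewrite /adj_down /adj_up actm1 compm1 !actl_comp.
have pent : P <| bwd (massoc L P A) \oc massoc P L (P \act A)
    = massoc P (L \ox P) A \oc assoc P L P |> A
        \oc bwd (massoc (P \ox L) P A).
  apply: (cancel_iso_r (f := massoc (P \ox L) P A)).
  rewrite -[RHS]compA bwdK compm1 -[LHS]compA mpentagon !compA -actl_comp.
  by rewrite bwdK actm1 comp1m.
have lunitA : bwd (massoc (tunit C) P A) \oc bwd (munit (P \act A))
    = bwd (lunit P) |> A.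
  apply: (cancel_iso_l (f := massoc (tunit C) P A)); rewrite compA fwdK comp1m.
  apply: (cancel_iso_l (f := munit (P \act A))); rewrite fwdK compA.
  by rewrite munit_massoc -actr_comp fwdK actm1.
rewrite -!compA (comp_in pent) -!compA (comp_in (bwd_massoc_actr _ _ _)).
rewrite -!compA lunitA (comp_in (massoc_actm _ _ _)) -!compA.
by rewrite (comp_in (mtriangle _ _)) -!actr_comp -actm1 -[in RHS]zigP !compA.
Qed.

Lemma adj_up_lin_equiv K A :
  lin_equiv (@adj_up K A) (@adj_down K A).
Proof.
split=> [c f g|f|f]; [|exact: adj_upK|exact: adj_downK].
by rewrite /adj_up actm_linr !comp_linl.
Qed.

End DualPair.
End Adjunction.

(** * Perron eigenvectors of positive matrices *)

Section Perron.
Import topology normedtype derive numFieldNormedType.Exports.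
Local Open Scope classical_set_scope.
Variables (R : realType) (n : nat) (T : 'M[R]_n).
Hypotheses (n0 : (0 < n)%N) (T0 : forall i j, 0 < T i j).

Lemma positive_image (v : 'rV[R]_n) : (forall i, 0 <= v 0 i) -> v != 0 ->
  forall j, 0 < (v *m T) 0 j.
Proof.
move=> v0 vN0 j; rewrite mxE lt_neqAle sumr_ge0 ?andbT => [|i _]; last first.
  by rewrite mulr_ge0 // ltW.
rewrite eq_sym psumr_neq0 => [|i _]; last by rewrite mulr_ge0 // ltW.
have /rV0Pn[i vi] := vN0.
by apply/hasP; exists i; rewrite ?mem_index_enum //= mulr_gt0 // lt_def vi v0.
Qed.

(** The maximum of [c] over the compact set of pairs of a probability vector [x]
    and a number [c >= 0] with [c x <= x T]; a pair is stored as one row vector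
    whose entry at [ord0] is [c]. *)
Lemma max_subeigenvector : exists (x : 'rV[R]_n) (c : R),
  [/\ forall i, 0 <= x 0 i, x != 0, forall j, c * x 0 j <= (x *m T) 0 j
    & forall (y : 'rV[R]_n) b, (forall i, 0 <= y 0 i) -> y != 0 ->
        (forall j, b * y 0 j <= (y *m T) 0 j) -> b <= c].
Proof.
pose B := \sum_j \sum_i T i j.
pose I (i : 'I_n.+1) : set R := if i == 0 then `[0, B] else `[0, 1].
pose box := [set v : 'rV[R]_n.+1 | forall i, I i (v ord0 i)].
have cbox : compact box.
  apply: rV_compact => i; rewrite /I; case: ifP => _; exact: segment_compact.
pose g j (v : 'rV[R]_n.+1) :=
  \sum_i v 0 (lift ord0 i) * T i j - v 0 ord0 * v 0 (lift ord0 j).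
pose K := [set v : 'rV[R]_n.+1 | forall i, 0 <= v 0 i]
   `&` [set v | \sum_i v 0 (lift ord0 i) * 1 = 1]
   `&` [set v | forall j, 0 <= g j v].
have csum (a : 'I_n -> R) :
    continuous (fun v : 'rV[R]_n.+1 => \sum_i v 0 (lift ord0 i) * a i).
  elim: (index_enum _) => [|i s IH] v.
    rewrite (_ : (fun _ => _) = cst 0); first exact: cst_continuous.
    by apply: funext => w; rewrite big_nil.
  rewrite (_ : (fun _ => _) = (fun w : 'rV_n.+1 => w 0 (lift ord0 i) * a i) \+
    (fun w : 'rV_n.+1 => \sum_(i <- s) w 0 (lift ord0 i) * a i)).
    apply: continuousD; last exact: IH.
    by apply: continuousM; [exact: coord_continuous|exact: cst_continuous].
  by apply: funext => w; rewrite big_cons.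
have closed_ge0 (h : 'rV[R]_n.+1 -> R) :
    continuous h -> closed [set v | 0 <= h v].
  by move=> ch; apply: (preimage_closed _ (@closed_ge _ 0)) => v _; apply: ch.
have closed_all m (h : 'I_m -> 'rV[R]_n.+1 -> R) :
    (forall j, continuous (h j)) -> closed [set v | forall j, 0 <= h j v].
  move=> ch; rewrite (_ : mkset _ = \bigcap_(j in setT) [set v | 0 <= h j v]).
    by apply: closed_bigI => j _; apply/closed_ge0/ch.
  by apply/seteqP; split=> [v vP j _|v vP j]; apply: vP.
have clK : closed K.
  apply: closedI; [apply: closedI|].
  - by apply: closed_all => j; apply: coord_continuous.
  - by apply: (preimage_closed _ (@closed_eq _ 1)) => v _; apply: csum.
  - apply: closed_all => j v.
    rewrite (_ : g j = (fun v : 'rV[R]_n.+1 => \sum_i v 0 (lift ord0 i) * T i j) \+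
      ((fun v : 'rV_n.+1 => v 0 ord0) \* (fun v : 'rV_n.+1 => v 0 (lift ord0 j)))
        \* cst (- 1)); last by apply: funext => w /=; rewrite mulrN1.
    apply: continuousD; first exact: csum.
    apply: continuousM; last exact: cst_continuous.
    by apply: continuousM; apply: coord_continuous.
have sub1 (v : 'rV[R]_n.+1) i : (forall i, 0 <= v 0 i) ->
    \sum_i v 0 (lift ord0 i) * 1 = 1 -> v 0 (lift ord0 i) <= 1.
  move=> v0 <-; rewrite (bigD1 i) //= mulr1 lerDl sumr_ge0 // => l _.
  by rewrite mulr1.
have cK : compact K.
  apply: (subclosed_compact clK cbox) => v [[v0 v1] gv] i; rewrite /I.
  case: (unliftP 0 i) => [j|] -> /=; rewrite in_itv /= v0 /=; first exact: sub1.
  rewrite -[leLHS]mulr1 -[in leLHS]v1 mulr_sumr; apply: ler_sum => j _.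
  rewrite mulr1; apply: le_trans (_ : \sum_i v 0 (lift ord0 i) * T i j <= _).
    by rewrite -subr_ge0; apply: gv.
  by apply: ler_sum => l _; rewrite ler_piMl ?sub1 // ltW.
pose pair (c : R) (y : 'rV[R]_n) : 'rV[R]_n.+1 :=
  \row_i if unlift ord0 i is Some j then y 0 j else c.
have pair0 c y : pair c y 0 ord0 = c by rewrite mxE unlift_none.
have pairS c y j : pair c y 0 (lift ord0 j) = y 0 j by rewrite mxE liftK.
have normK (y : 'rV[R]_n) (b : R) : 0 <= b -> (forall i, 0 <= y 0 i) -> y != 0 ->
    (forall j, b * y 0 j <= (y *m T) 0 j) ->
    K (pair b ((\sum_i y 0 i)^-1 *: y)).
  move=> b0 y0 /rV0Pn[i0 yi0] yT; set s := \sum_i _.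
  have s0 : 0 < s.
    rewrite /s (bigD1 i0) //= ltr_pwDl ?sumr_ge0 //.
    by rewrite lt_def yi0 y0.
  split; [split|] => [i||j] /=.
  - case: (unliftP 0 i) => [j|] ->; rewrite ?pairS ?pair0 //.
    by rewrite mxE mulr_ge0 // invr_ge0 ltW.
  - under eq_bigr do rewrite pairS mxE mulr1.
    by rewrite -mulr_sumr mulVf // gt_eqF.
  rewrite /g pair0 pairS; under eq_bigr do rewrite pairS mxE -mulrA.
  rewrite -mulr_sumr mxE mulrCA -mulrBr mulr_ge0 ?invr_ge0 ?(ltW s0) //.
  by rewrite subr_ge0; have := yT j; rewrite mxE.
have K0 : K !=set0.
  exists (pair 0 ((\sum_i (const_mx 1 : 'rV_n) 0 i)^-1 *: (const_mx 1 : 'rV[R]_n))).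
  apply: normK => // [i||j]; first by rewrite mxE.
    by apply/rV0Pn; exists (Ordinal n0); rewrite mxE oner_neq0.
  by rewrite mul0r mxE sumr_ge0 // => i _; rewrite mxE mul1r ltW.
have cf : {within K, continuous (fun v : 'rV[R]_n.+1 => v 0 ord0)}.
  by apply: continuous_subspaceT => v; apply: coord_continuous.
have [v /set_mem[[v0 v1] gv] vmax] := EVT_max_rV K0 cK cf.
exists (\row_j v 0 (lift ord0 j)), (v 0 ord0); split=> [i||j|y b y0 yN0 yT].
- by rewrite mxE.
- apply/eqP => v0'; move: v1 => /=.
  rewrite big1 => [/eqP|i _]; first by rewrite eq_sym oner_eq0.
  by have := congr1 (fun u : 'rV_n => u 0 i) v0'; rewrite !mxE => ->; rewrite mul0r.
- rewrite !mxE -subr_ge0; under eq_bigr do rewrite mxE; exact: gv.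
case: (lerP 0 b) => b0; last exact/ltW/(lt_le_trans b0).
by have := vmax _ (mem_set (normK y b b0 y0 yN0 yT)); rewrite pair0.
Qed.

Lemma dominated_scaling (u y : 'rV[R]_n) : (forall i, 0 < u 0 i) ->
  (forall i, 0 < y 0 i) -> exists2 b, 0 < b & forall j, b * y 0 j <= u 0 j.
Proof.
move=> u0 y0; pose s := \sum_i y 0 i / u 0 i.
have yu i : 0 < y 0 i / u 0 i by rewrite divr_gt0.
have s0 : 0 < s.
  rewrite /s (bigD1 (Ordinal n0)) //= ltr_pwDl ?sumr_ge0 // => i _.
  exact: ltW.
(* The reciprocal of a sum of positive ratios is below each inverse ratio. *)
exists s^-1 => [|j]; first by rewrite invr_gt0.
rewrite ler_pdivrMl // -ler_pdivrMr // /s (bigD1 j) //= lerDl sumr_ge0 // => i _.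
exact: ltW.
Qed.

(** If [x T - c x] were nonzero for a maximal [c], then applying [T] would make
    the defect of [x T] positive in every coordinate and leave room for a
    larger [c]. *)
Lemma positive_eigenvector : exists (r : 'rV[R]_n) (c : R),
  (forall i, 0 < r 0 i) /\ r *m T = c *: r.
Proof.
have [x [c [x0 xN0 xT cmax]]] := max_subeigenvector.
have xT0 := positive_image x0 xN0.
have eqT : x *m T = c *: x.
  apply/eqP; rewrite -subr_eq0; apply: contraT => e0.
  set e := x *m T - c *: x in e0.
  have ege0 i : 0 <= e 0 i.
    by have := xT i; rewrite -subr_ge0 /e !mxE.
  have [b b0 be] := dominated_scaling (positive_image ege0 e0) xT0.
  suff : c + b <= c by rewrite gerDl leNgt b0.
  apply: (cmax (x *m T)) => [i||j]; first exact: ltW.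
    by apply/rV0Pn; exists (Ordinal n0); rewrite gt_eqF.
  have := be j; rewrite /e mulmxBl -scalemxAl.
  have coordB (a d : 'rV[R]_n) : (a - c *: d) 0 j = a 0 j - c * d 0 j.
    by rewrite !mxE.
  by rewrite coordB mulrDl lerBrDl.
have rT : (x *m T) *m T = c *: (x *m T) by rewrite {1}eqT scalemxAl.
by exists (x *m T), c.
Qed.

(** Subtract from [v] the largest multiple of [r] below it: the difference is
    nonnegative with a zero coordinate, which [T] would make positive if the
    difference were not zero. *)
Lemma eigenvector_unique (r v : 'rV[R]_n) c : (forall i, 0 < r 0 i) ->
  r *m T = c *: r -> v *m T = c *: v -> exists t, v = t *: r.
Proof.
move=> r0 rT vT; pose q i := v 0 i / r 0 i.
have [i0 _ qmin] := Order.TotalTheory.arg_minP q (isT : xpredT (Ordinal n0)).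
exists (q i0); apply/eqP; rewrite -subr_eq0; apply: contraT => u0.
set u := v - _ in u0.
have uge0 i : 0 <= u 0 i.
  by rewrite !mxE subr_ge0 -ler_pdivlMr //; apply: qmin.
have uT : u *m T = c *: u by rewrite mulmxBl vT -scalemxAl rT scalerBr !scalerA mulrC.
have := positive_image uge0 u0 i0; rewrite uT.
by rewrite !mxE divfK ?subrr ?mulr0 ?ltxx // gt_eqF.
Qed.

(** As the eigenspace of [r] is a line, [r] is an eigenvector of everything that
    commutes with [T]. *)
Lemma common_positive_eigenvector : exists r : 'rV[R]_n,
  (forall i, 0 < r 0 i) /\
  forall L : 'M[R]_n, L *m T = T *m L -> exists d, r *m L = d *: r.
Proof.
have [r [c [r0 rT]]] := positive_eigenvector; exists r; split=> // L LT.
apply: (eigenvector_unique r0 rT).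
by rewrite -mulmxA LT mulmxA rT scalemxAl.
Qed.

End Perron.

(** * Frobenius-Perron functionals on module categories *)

Section OperatorMatrix.
Variables (k : closedFieldType) (A : linCat k).
Hypothesis abA : is_abelian A.
Hypothesis finA : forall X Y : A, fin_dim (hom X Y).
Hypothesis ssA : is_semisimple A.
Variables (n : nat) (S : 'I_n -> A).
Hypothesis repS : simple_reps S.

Definition K0coord (x : K0 A) : 'rV[int]_n := \row_i K0mult (S i) x.

Definition opmx (phi : K0 A -> K0 A) : 'M[int]_n :=
  \matrix_(i, j) K0mult (S j) (phi (cls (S i))).

Let sS i : is_simple (S i) := let: And3 s _ _ := repS in s i.

Lemma additive_expand (G : zmodType) (phi : K0 A -> G) x :
  {morph phi : y z / y + z} ->
  phi x = \sum_i phi (cls (S i)) *~ K0mult (S i) x.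
Proof.
move=> phiD; have phi0 : phi 0 = 0.
  by apply: (addrI (phi 0)); rewrite -phiD !addr0.
have phiN y : phi (- y) = - phi y.
  by apply: (addrI (phi y)); rewrite -phiD !subrr phi0.
have phiM y m : phi (y *~ m) = phi y *~ m.
  have nat_case l : phi (y *+ l) = phi y *+ l.
    by elim: l => [|l IH]; rewrite ?mulr0n // !mulrS phiD IH.
  by case: m => l; rewrite ?NegzE ?mulrNz ?phiN; [|congr (- _)]; apply: nat_case.
rewrite {1}(K0_expand abA finA ssA repS x) (big_morph phi phiD phi0).
by apply: eq_bigr => i _; rewrite phiM.
Qed.

Lemma K0coordD x y : K0coord (x + y) = K0coord x + K0coord y.
Proof. by apply/rowP => i; rewrite !mxE K0multD. Qed.

Lemma K0coordN x : K0coord (- x) = - K0coord x.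
Proof. by apply/rowP => i; rewrite !mxE K0multN. Qed.

Lemma K0coord_inj : injective K0coord.
Proof.
move=> x y xy; apply: (K0mult_inj abA finA ssA repS) => i.
by have := congr1 (fun u : 'rV_n => u 0 i) xy; rewrite !mxE.
Qed.

Lemma K0coord_cls i : K0coord (cls (S i)) = delta_mx 0 i.
Proof.
apply/rowP => j; rewrite !mxE K0mult_cls // eqxx /=.
by rewrite (mult_reps abA finA repS) natz.
Qed.

Lemma K0coord_op phi x : {morph phi : y z / y + z} ->
  K0coord (phi x) = K0coord x *m opmx phi.
Proof.
move=> phiD; apply/rowP => j; rewrite !mxE (additive_expand _ phiD) K0mult_sum //.
by apply: eq_bigr => i _; rewrite !mxE K0multMz // mulrC.
Qed.

Lemma K0coord_surj v : exists x, K0coord x = v.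
Proof.
exists (\sum_i cls (S i) *~ v 0 i); apply/rowP => j; rewrite mxE K0mult_sum //.
under eq_bigr do rewrite K0multMz // K0mult_cls // (mult_reps abA finA repS).
rewrite (bigD1 j) //= eqxx mul1r big1 ?addr0 // => i ij.
by rewrite eq_sym (negPf ij) mul0r.
Qed.

Lemma opmx_comm phi psi : {morph phi : y z / y + z} ->
    {morph psi : y z / y + z} -> (forall x, phi (psi x) = psi (phi x)) ->
  opmx phi *m opmx psi = opmx psi *m opmx phi.
Proof.
move=> phiD psiD comm; apply/row_matrixP => i.
by rewrite !rowE -K0coord_cls !mulmxA -!K0coord_op // comm.
Qed.

End OperatorMatrix.

Section FusionModule.
Variables (k : closedFieldType) (C : fusionCat k).

Lemma fusion_fin_dim (X Y : C) : fin_dim (hom X Y).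
Proof. by have [[]] := fusionP C. Qed.

Lemma fss_fin_dim (M : fssModCat C) (X Y : M) : fin_dim (hom X Y).
Proof. by have [] := fmod_finite M. Qed.

Lemma fss_simple_reps (M : fssModCat C) : exists n (S : 'I_n -> M), simple_reps S.
Proof. by have [_ _ _ _ [n [S /simple_reps_exist]]] := fmod_finite M. Qed.

Definition regular_fss : fssModCat C :=
  @FssModCat k C (regularMod C) (let: And4 f _ _ _ := fusionP C in f)
    (fusion_semisimple C).

(** The adjunction between the actions of [L] and [P], followed by the symmetry
    of multiplicities. *)
Lemma mult_dual (M : fssModCat C) (L P : C) (S T : M) : is_left_dual L P ->
  is_simple S -> is_simple T -> mult S (P \act T) = mult T (L \act S).
Proof.
move=> [ev [coev [z1 z2]]] sS sT.
have abM := fss_abelian M; have finM := @fss_fin_dim M.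
have ssM := fmod_semisimple M.
have ae := lin_equiv_sym (@adj_up_lin_equiv _ _ M _ _ ev coev z1 z2 S T).
rewrite -(mult_sym abM finM ssM _ sT).
by apply/esym/lmod_dimE/(has_dim_equiv ae)/mult_has_dim.
Qed.

(** The zigzag identity exhibits the identity of [X] as a composite through
    [coev]. *)
Lemma coev_neq0 (X D : C) (ev : hom (X \ox D) (tunit C)) (coev : hom (tunit C) (D \ox X)) :
  lunit X \oc tensm ev (idm X) \oc bwd (assoc X D X)
        \oc tensm (idm X) coev \oc bwd (runit X) = idm X ->
  ~ is_zero X -> coev <> 0.
Proof.
move=> z X0 c0; apply/X0/is_zeroP; rewrite -z c0.
have -> : tensm (idm X) (0 : hom (tunit C) (D \ox X)) = 0.
  have := tensm_linr (- 1) (idm X) (0 : hom (tunit C) (D \ox X)) 0.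
  by rewrite scaler0 addr0 scaleN1r addNr.
by rewrite compm0 comp0m.
Qed.

(** The unit object is a direct summand of [D \ox X], so that [N] is one of
    [D \act (X \act N)]. *)
Lemma act_neq0 (M : fssModCat C) (X : C) (N : M) :
  ~ is_zero X -> ~ is_zero N -> ~ is_zero (X \act N).
Proof.
move=> X0 N0 XN0; apply: N0.
have abC := fusion_abelian C; have ssC := fusion_semisimple C.
have [D [ev [coev [_ z2]]]] := left_dual_exists X.
have c0 := coev_neq0 z2 X0.
have [_ _ _ s1] := fusionP C.
have [n [F [sF [i [p [pi _ ip]]]]]] := ssC (D \ox X).
have [a pa] : exists a, p a \oc coev <> 0.
  apply: contrapT => none; apply: c0; rewrite -[coev]comp1m -ip comp_suml.
  apply: big1 => a _; rewrite -compA.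
  suff -> : p a \oc coev = 0 by rewrite compm0.
  by apply: contrapT => ?; apply: none; exists a.
have [h [hp _]] := Schur abC s1 (sF a) pa.
have DX0 : is_zero ((D \ox X) \act N).
  apply: (zero_isomorphic (X := D \act (X \act N))); last exact: act_zero.
  by apply: isomorphic_sym; exists; apply: massoc.
apply: (zero_isomorphic (X := tunit C \act N)); first by exists; apply: munit.
apply: is_zeroP; rewrite -actm1 -hp compA actr_comp.
by rewrite ((DX0 (tunit C \act N)).1 (actm coev _)) compm0.
Qed.

Section ModuleMatrix.
Variables (M : fssModCat C) (n : nat) (S : 'I_n -> M).
Hypothesis repS : simple_reps S.
Let abM := fss_abelian M.
Let finM := @fss_fin_dim M.
Let ssM := fmod_semisimple M.
Let sS i : is_simple (S i) := let: And3 s _ _ := repS in s i.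

Definition actmx (X : C) : 'M[int]_n :=
  opmx S (fun y : GrMod M => clsC X *: y : GrMod M).

Lemma actmxE X i j : actmx X i j = mult (S j) (X \act S i).
Proof.
rewrite mxE (_ : clsC X *: _ = clsM (X \act S i)); last exact: clsM_act.
exact: K0mult_cls.
Qed.

Lemma K0coord_act X (y : GrMod M) : K0coord S (clsC X *: y : GrMod M) = K0coord S y *m actmx X.
Proof.
rewrite /actmx -(K0coord_op abM finM ssM repS) // => u v; exact: (@scalerDr _ (GrMod M)).
Qed.

Lemma actmx_dual L P : is_left_dual L P -> actmx P = (actmx L)^T.
Proof.
by move=> LP; apply/matrixP => i j; rewrite [RHS]mxE !actmxE (mult_dual LP).
Qed.

End ModuleMatrix.

Section RegularModule.
Variables (R : realType) (n : nat) (S : 'I_n -> regular_fss).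
Hypothesis repS : simple_reps S.
Let abC := fusion_abelian C.
Let finC := fusion_fin_dim.
Let ssC := fusion_semisimple C.
Let sS i : is_simple (S i) := let: And3 s _ _ := repS in s i.

Let total : GrRing C := \sum_i clsC (S i).

Definition right_mult_total (y : K0 regular_fss) : K0 regular_fss :=
  (y : GrRing C) * total.

Lemma right_mult_totalD : {morph right_mult_total : y z / y + z}.
Proof. by move=> y z; apply: (@mulrDl (GrRing C)). Qed.

(** By duality a simple constituent [S l] of the nonzero object [D \ox S j], with
    [D] dual to [S i], has [S j] in [S i \ox S l]. *)
Lemma right_mult_total_gt0 i j : 0 < opmx S right_mult_total i j.
Proof.
have [D LD] := left_dual_exists (S i : C).
have [l Dl] : exists l, mult (S l) ((D \act S j) : regular_fss) <> 0%N.
  apply: contrapT => none.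
  have D0 : ~ is_zero D.
    move=> D0; have [ev [coev [_ z2]]] := LD.
    apply: (coev_neq0 z2 (sS i).1).
    exact: ((act_zero_l (M := regularMod C) (S i) D0) _).1.
  apply: (act_neq0 D0 (sS j).1); apply: (mult_zeroP abC finC ssC repS) => l.
  by apply: contrapT => Dl; apply: none; exists l.
have mE m : @K0mult k C (S j) (clsC (S i) * clsC (S m))
    = @mult k C (S j) (@tens k C (S i) (S m)).
  by rewrite clsC_tens; exact: (K0mult_cls abC finC ssC _ (sS j)).
rewrite mxE /right_mult_total /total mulr_sumr K0mult_sum //.
rewrite (bigD1 l) //= ltr_pwDl //; last first.
  by apply: sumr_ge0 => m _; rewrite mE.
rewrite (mult_dual LD (sS l) (sS j)) in Dl.
by rewrite mE ltz_nat lt0n; apply/eqP.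
Qed.

(** Left multiplications commute with the positive operator of right
    multiplication by the sum of the simple objects, hence share its Perron
    eigenvector. *)
Lemma Perron_regular : exists (r : 'rV[R]_n) (d : C -> R),
  (forall i, 0 < r 0 i) /\
  forall X, r *m map_mx intr (actmx S X) = d X *: r.
Proof.
have n0 : (0 < n)%N.
  have [_ _ _ s1] := fusionP C; have [_ _ all] := repS.
  by have [i _] := all _ s1; apply: leq_ltn_trans (ltn_ord i).
pose T : 'M[R]_n := map_mx intr (opmx S right_mult_total).
have T0 i j : 0 < T i j by rewrite mxE ltr0z right_mult_total_gt0.
have [r [r0 rL]] := common_positive_eigenvector n0 T0.
have ex X : exists d, r *m map_mx intr (actmx S X) = d *: r.
  apply: rL; rewrite /T -!map_mxM; congr map_mx.
  apply: (opmx_comm abC finC ssC repS) => [y z|y z|y].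
  - exact: (@scalerDr _ (GrMod regular_fss)).
  - exact: right_mult_totalD.
  - exact: (@mulrA (GrRing C)).
by exists r, (fun X => sval (cid (ex X))); split=> // X; case: cid.
Qed.

End RegularModule.

Section FPFunctional.
Variables (R : realType) (n : nat) (S : 'I_n -> regular_fss).
Hypothesis repS : simple_reps S.
Variables (r : 'rV[R]_n) (d : C -> R).
Hypothesis r0 : forall i, 0 < r 0 i.
Hypothesis rd : forall X, r *m map_mx intr (actmx S X) = d X *: r.
Let abC := fusion_abelian C.
Let finC := fusion_fin_dim.
Let ssC := fusion_semisimple C.

Let n0 : (0 < n)%N.
Proof.
have [_ _ _ s1] := fusionP C; have [_ _ all] := repS.
by have [i _] := all _ s1; apply: leq_ltn_trans (ltn_ord i).
Qed.

Lemma eigenvalue_ge0 X : 0 <= d X.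
Proof.
have : 0 <= (r *m map_mx intr (actmx S X)) 0 (Ordinal n0).
  rewrite mxE sumr_ge0 // => i _; rewrite mulr_ge0 ?(ltW (r0 i)) // mxE ler0z.
  by rewrite (actmxE repS).
by rewrite rd mxE pmulr_lge0.
Qed.

(** Evaluate the quadratic form of the matrix of [P] at [r]: transposition, which
    gives the matrix of [L], does not change it. *)
Lemma eigenvalue_dual L P : is_left_dual L P -> d P = d L.
Proof.
move=> LP; have rr : (r *m r^T) 0 0 != 0.
  rewrite mxE gt_eqF // (bigD1 (Ordinal n0)) //= ltr_pwDl //.
    by rewrite mxE mulr_gt0.
  by apply: sumr_ge0 => i _; rewrite mxE mulr_ge0 // ltW.
have E X : (r *m map_mx intr (actmx S X) *m r^T) 0 0 = d X * (r *m r^T) 0 0.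
  by rewrite rd -scalemxAl mxE.
apply: (mulIf rr); rewrite -!E (actmx_dual repS LP) -map_trmx.
by rewrite -[r *m _ *m r^T]trmxK mxE !trmx_mul !trmxK mulmxA.
Qed.

Section OnModule.
Variable M : fssModCat C.
Let abM := fss_abelian M.
Let finM := @fss_fin_dim M.
Let ssM := fmod_semisimple M.

(** Acting by the Perron eigenvector of [C] on the sum of the simple objects of
    [M] gives an eigenvector of the whole of [C]; pairing with it is the wanted
    functional, since transposition exchanges the matrices of dual objects. *)
Lemma FP_functional : exists f : GrMod M -> R,
  [/\ {morph f : y z / y + z}, forall T, is_simple T -> 0 < f (clsM T)
    & forall X y, f (clsC X *: y) = d X * f y].
Proof.
have [m [T repT]] := fss_simple_reps M.
have sT i : is_simple (T i) by have [] := repT.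
pose total : GrMod M := \sum_l clsM (T l).
pose a i j : int := K0mult (T j) (clsC (S i) *: total : GrMod M).
have a0 i j : 0 <= a i j.
  rewrite /a /total scaler_sumr (K0mult_sum abM finM ssM _ (sT j)) sumr_ge0 // => l _.
  by rewrite clsM_act (K0mult_cls abM finM ssM _ (sT j)).
pose w j : R := \sum_i r 0 i * (a i j)%:~R.
have w0 j : 0 < w j.
  have [_ _ _ s1] := fusionP C; have [_ _ all] := repS.
  have [i0 i0P] := all _ s1.
  rewrite /w (bigD1 i0) //= ltr_pwDl //; last first.
    by apply: sumr_ge0 => i _; rewrite mulr_ge0 ?ler0z ?(ltW (r0 i)).
  rewrite mulr_gt0 // ltr0z /a.
  have -> : clsC (S i0) = 1 :> GrRing C.
    exact/esym/(cls_isomorphic abC).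
  rewrite scale1r /total (K0mult_sum abM finM ssM _ (sT j)) (bigD1 j) //=.
  rewrite (K0mult_cls abM finM ssM _ (sT j)) (mult_reps abM finM repT) eqxx.
  rewrite ltr_pwDl // sumr_ge0 // => l _.
  by rewrite (K0mult_cls abM finM ssM _ (sT j)).
have wX X l : \sum_j w j * (actmx T X j l)%:~R = d X * w l.
  transitivity (\sum_i r 0 i * (K0mult (T l) (clsC X *: (clsC (S i) *: total)
      : GrMod M))%:~R).
    rewrite /w; under eq_bigr do rewrite mulr_suml.
    rewrite exchange_big; apply: eq_bigr => i _ /=.
    have := congr1 (fun u : 'rV_m => u 0 l) (K0coord_act repT X (clsC (S i) *: total)).
    rewrite /= !mxE => ->; rewrite rmorph_sum mulr_sumr.
    by apply: eq_bigr => j _; rewrite rmorphM /= !mxE mulrA.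
  transitivity (\sum_i r 0 i * \sum_h (actmx S X i h)%:~R * (a h l)%:~R).
    apply: eq_bigr => i _; congr (_ * _).
    rewrite scalerA.
    have addl : {morph (fun x : GrRing C => K0mult (T l) (x *: total : GrMod M))
        : x y / x + y}.
      by move=> x y; rewrite scalerDl (K0multD abM finM ssM).
    rewrite (additive_expand abC finC ssC repS _ addl) rmorph_sum.
    apply: eq_bigr => h _; rewrite -/(a h l).
    rewrite -mulrzr rmorphM /= mulrC; congr (_ * _).
    by rewrite mxE intz.
  under eq_bigr do rewrite mulr_sumr.
  rewrite exchange_big /= mulr_sumr; apply: eq_bigr => h _.
  have := congr1 (fun u : 'rV_n => u 0 h) (rd X); rewrite /= !mxE mulrA => <-.
  by rewrite mulr_suml; apply: eq_bigr => i _; rewrite ?mxE ?mulrA.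
pose f (y : GrMod M) : R := \sum_j w j * (K0mult (T j) y)%:~R.
have fD : {morph f : y z / y + z}.
  move=> y z; rewrite /f -big_split; apply: eq_bigr => j _ /=.
  by rewrite (K0multD abM finM ssM _ _ (sT j)) rmorphD mulrDr.
exists f; split=> // [U sU|X y].
  have [_ _ all] := repT; have [j Uj] := all _ sU.
  rewrite /f (bigD1 j) //= ltr_pwDl //.
    rewrite (K0mult_cls abM finM ssM _ (sT j)).
    rewrite (mult_simple abM finM) // asboolT; first by rewrite mulr1.
    exact: isomorphic_sym.
  apply: sumr_ge0 => i _; rewrite mulr_ge0 ?(ltW (w0 i)) //.
  by rewrite (K0mult_cls abM finM ssM _ (sT i)) ler0z.
have [D XD] := left_dual_exists X.
rewrite /f -(eigenvalue_dual XD) mulr_sumr.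
transitivity (\sum_j w j * (\sum_i (K0mult (T i) y)%:~R * (actmx T D j i)%:~R)).
  apply: eq_bigr => j _; congr (_ * _).
  have := congr1 (fun u : 'rV_m => u 0 j) (K0coord_act repT X y).
  rewrite /= !mxE => ->; rewrite rmorph_sum.
  by apply: eq_bigr => i _; rewrite rmorphM /= [actmx T D](actmx_dual repT XD) !mxE.
under eq_bigr do rewrite mulr_sumr.
rewrite exchange_big; apply: eq_bigr => i _ /=.
rewrite mulrA -wX mulr_suml; apply: eq_bigr => j _.
by rewrite [RHS]mulrAC mulrA.
Qed.

End OnModule.

(** The number [d X] is an eigenvalue with eigenvector [r]. For any other
    eigenvector [v], with nonnegative eigenvalue [c], the matrix of [X] maps the
    vector of absolute values of [v] to at least [c] times it; pairing with the
    positive functional on [C] itself gives [c <= d X], whatever the labelling of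
    the simple objects. *)
Lemma FPdim_eigenvalue (X : C) : FPdim R X = d X.
Proof.
have [f [fD f0 fX]] := FP_functional regular_fss.
have ub c : 0 <= c -> (exists m (T : 'I_m -> C) (N : 'M[int]_m),
    [/\ simple_reps T, left_mult_matrix X T N & eigenvalue (map_mx intr N) c]) ->
  c <= d X.
  move=> c0 [m [T [N [repT NX /eigenvalueP[v vN v0]]]]].
  have sT i : is_simple (T i) by have [] := repT.
  have NE i j : N i j = mult (T j) (X \ox T i).
    have := congr1 (K0mult (T j)) (NX i).
    rewrite clsC_tens (K0mult_cls abC finC ssC _ (sT j)) => ->.
    rewrite (K0mult_sum abC finC ssC _ (sT j)).
    under eq_bigr do rewrite (K0multMz abC finC ssC _ _ (sT j))
      (K0mult_cls abC finC ssC _ (sT j)) (mult_reps abC finC repT).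
    rewrite (bigD1 j) //= eqxx mul1r big1 ?addr0 // => h hj.
    by rewrite eq_sym (negPf hj) mul0r.
  pose g i : R := f (clsM (T i : regular_fss)).
  have g0 i : 0 < g i by apply: f0.
  have XT i : \sum_j (N i j)%:~R * g j = d X * g i.
    have -> : d X * g i = f (@cls k C (X \ox T i)).
      by rewrite -fX; congr f; apply: (clsM_act (M := regular_fss)).
    rewrite (additive_expand abC finC ssC repT _ fD).
    apply: eq_bigr => j _; rewrite -[RHS]mulrzl; congr (_%:~R * _).
    by rewrite NE (K0mult_cls abC finC ssC _ (sT j)).
  pose s := \sum_i `|v 0 i| * g i.
  have s0 : 0 < s.
    have /rV0Pn[i vi] := v0; rewrite /s (bigD1 i) //= ltr_pwDl //.
      by rewrite mulr_gt0 // normr_gt0.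
    by apply: sumr_ge0 => j _; rewrite mulr_ge0 // ltW.
  rewrite -(ler_pM2r s0) /s !mulr_sumr.
  apply: (@le_trans _ _ (\sum_j (\sum_i `|v 0 i| * (N i j)%:~R) * g j)).
    apply: ler_sum => j _; rewrite mulrA ler_wpM2r ?(ltW (g0 j)) //.
    have := congr1 (fun u : 'rV_m => `|u 0 j|) vN; rewrite /= !mxE.
    rewrite normrM (ger0_norm c0) => <-; apply: le_trans (ler_norm_sum _ _ _) _.
    apply: ler_sum => i _; rewrite normrM mxE [`|_%:~R|]ger0_norm //.
    by rewrite NE ler0z.
  under eq_bigr do rewrite mulr_suml.
  rewrite exchange_big /= ler_sum // => i _.
  rewrite mulrCA -XT mulr_sumr; apply: ler_sum => j _.
  by rewrite mulrA.
have dE : [set c : R | 0 <= c /\ exists m (T : 'I_m -> C) (N : 'M[int]_m),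
    [/\ simple_reps T, left_mult_matrix X T N
      & eigenvalue (map_mx intr N) c]]%classic (d X).
  split; first exact: eigenvalue_ge0.
  exists n, S, (actmx S X); split=> //.
    move=> i; rewrite [LHS](K0_expand abC finC ssC repS).
    by apply: eq_bigr => j _; rewrite mxE.
  apply/eigenvalueP; exists r; first exact: rd.
  by apply/rV0Pn; exists (Ordinal n0); rewrite gt_eqF.
apply/le_anti/andP; split.
  by apply: ge_sup; [exists (d X)|move=> c [c0 cP]; apply: ub].
by apply: ub_le_sup dE; exists (d X) => c [c0 cP]; apply: ub.
Qed.

End FPFunctional.

Section FPdimTheory.
Variable R : realType.

Lemma FPdim_functional (M : fssModCat C) : exists f : GrMod M -> R,
  [/\ {morph f : y z / y + z}, forall T, is_simple T -> 0 < f (clsM T)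
    & forall (X : C) y, f (clsC X *: y) = FPdim R X * f y].
Proof.
have [n [S repS]] := fss_simple_reps regular_fss.
have [r [d [r0 rd]]] := Perron_regular R repS.
have [f [fD f0 fX]] := FP_functional repS r0 rd M.
by exists f; split=> // X y; rewrite (FPdim_eigenvalue repS r0 rd).
Qed.

Lemma FPdim_ge0 (X : C) : 0 <= FPdim R X.
Proof.
have [n [S repS]] := fss_simple_reps regular_fss.
have [r [d [r0 rd]]] := Perron_regular R repS.
by rewrite (FPdim_eigenvalue repS r0 rd) (eigenvalue_ge0 repS r0 rd).
Qed.

Lemma FPdim_dual (L P : C) : is_left_dual L P -> FPdim R P = FPdim R L.
Proof.
have [n [S repS]] := fss_simple_reps regular_fss.
have [r [d [r0 rd]]] := Perron_regular R repS => LP.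
by rewrite !(FPdim_eigenvalue repS r0 rd) (eigenvalue_dual repS r0 rd LP).
Qed.

End FPdimTheory.
End FusionModule.

(** * Chebyshev sequences and the Coxeter element *)

Section AlternatingSequence.
Variable V : zmodType.
Implicit Types (p q : {additive V -> V}) (x y : V).

Definition refl_a q (v : V * V) := (q v.2 - v.1, v.2).
Definition refl_b p (v : V * V) := (v.1, p v.1 - v.2).
Definition cox p q (v : V * V) := refl_a q (refl_b p v).

(** The pair of consecutive terms [z_n], [z_(n+1)] of the sequence given by
    [z_0 = 0], [z_1 = x] and [z_(n+2) = p z_(n+1) - z_n], in which [p] and [q]
    take turns: these are noncommutative Chebyshev polynomials in [p] and [q],
    and the coordinates of the orbit of [(x, 0)] under [cox p q]. *)
Fixpoint alt_pair p q x n : V * V :=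
  if n is n'.+1 then
    let: (a, b) := alt_pair p q x n' in (b, (if odd n' then q b else p b) - a)
  else (0, x).

Definition alt p q x n := (alt_pair p q x n).1.

Arguments alt : simpl never.

Lemma alt0 p q x : alt p q x 0 = 0. Proof. by []. Qed.
Lemma alt1 p q x : alt p q x 1 = x. Proof. by []. Qed.

Lemma altSS p q x n : alt p q x n.+2 =
  (if odd n then q (alt p q x n.+1) else p (alt p q x n.+1)) - alt p q x n.
Proof. by rewrite /alt /=; case: (alt_pair p q x n). Qed.

Lemma iter_cox_alt p q x l :
  iter l (cox p q) (x, 0) = (alt p q x l.*2.+1, alt p q x l.*2).
Proof.
elim: l => [//|l IH]; rewrite iterS IH doubleS /cox /refl_a /refl_b /=.
by rewrite !altSS /= odd_double.
Qed.

Lemma iter_refl_ba_alt p q y l :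
  iter l (refl_b p \o refl_a q) (0, y) = (alt q p y l.*2, alt q p y l.*2.+1).
Proof.
elim: l => [//|l IH]; rewrite iterS IH doubleS /refl_a /refl_b /=.
by rewrite !altSS /= odd_double.
Qed.

(** The recursion read backwards from a zero [z_m] has the same coefficients, by
    parity, so that the sequence is antisymmetric about [m]. *)
Lemma alt_antisym p q x m : alt p q x m = 0 -> forall j t, m = (j + t.+1)%N ->
  alt p q x (m + j) = - alt p q x t.+1 /\ alt p q x (m + j).+1 = - alt p q x t.
Proof.
move=> zm; elim=> [|j IH] t mE.
  rewrite add0n in mE; rewrite addn0 zm -mE zm oppr0; split=> //.
  by rewrite mE altSS -mE zm !raddf0 if_same sub0r.
have [|zj zj1] := IH t.+1; first by rewrite mE addSnnS.
rewrite addnS; split=> //; rewrite altSS zj1 zj opprK.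
have -> : odd (m + j) = odd t.
  rewrite mE !oddD /=; by case: (odd j); case: (odd t).
by rewrite altSS; case: odd; rewrite raddfN addrA addNr sub0r.
Qed.

Lemma alt_period p q x m : (0 < m)%N -> alt p q x m = 0 ->
  alt p q x m.*2 = 0 /\ alt p q x m.*2.+1 = x.
Proof.
case: m => // m _ zm.
have [|z1 z0] := alt_antisym zm (j := m) (t := 0); first by rewrite addn1.
have -> : (m.+1).*2 = (m.+1 + m).+1 by rewrite -addnn addnS.
rewrite z0 oppr0; split=> //.
by rewrite altSS z0 z1 opprK oppr0 !raddf0 if_same add0r.
Qed.

Lemma refl_bK p : involutive (refl_b p).
Proof. by case=> x y; rewrite /refl_b /= subKr. Qed.

Lemma refl_aK q : involutive (refl_a q).
Proof. by case=> x y; rewrite /refl_a /= subKr. Qed.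

(** Vectors supported at [a] have period [m] by antisymmetry about [m]; those
    supported at [b] have it for the inverse of [cox p q]. *)
Lemma cox_period p q m : (0 < m)%N -> (forall x, alt p q x m = 0) ->
  (forall y, alt q p y m = 0) -> iter m (cox p q) =1 id.
Proof.
move=> m0 zp zq.
have fix1 x : iter m (cox p q) (x, 0) = (x, 0).
  by rewrite iter_cox_alt; have [-> ->] := alt_period m0 (zp x).
have fix2 y : iter m (cox p q) (0, y) = (0, y).
  have {1}<- : iter m (refl_b p \o refl_a q) (0, y) = (0, y).
    by rewrite iter_refl_ba_alt; have [-> ->] := alt_period m0 (zq y).
  elim: m {m0 zp zq fix1} (0, y) => // l IH v; rewrite iterSr iterS /cox /=.
  by rewrite refl_bK refl_aK IH.
have coxD v w : cox p q (v + w) = cox p q v + cox p q w.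
  case: v w => [a b] [c e]; rewrite /cox /refl_a /refl_b /=.
  have E : p (a + c) - (b + e) = (p a - b) + (p c - e).
    by rewrite raddfD opprD addrACA.
  by congr pair; rewrite /= E // raddfD opprD addrACA.
have iterD v w l : iter l (cox p q) (v + w) =
    iter l (cox p q) v + iter l (cox p q) w.
  by elim: l v w => //= l IH v w; rewrite IH coxD.
case=> x y; rewrite (_ : (x, y) = (x, 0) + (0, y)).
  by rewrite iterD fix1 fix2.
by congr pair; rewrite /= ?addr0 ?add0r.
Qed.

End AlternatingSequence.

Section Chebyshev.
Variable R : realType.
Implicit Types (d t : R).

(** The values U_(n-1)(d/2) of the Chebyshev polynomials of the second kind; the
    shift puts the zero of the sequence at [n = 0]. *)
Fixpoint cheb_pair d n : R * R :=
  if n is n'.+1 then let: (a, b) := cheb_pair d n' in (b, d * b - a)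
  else (0, 1).

Definition cheb d n := (cheb_pair d n).1.
Arguments cheb : simpl never.

Lemma chebSS d n : cheb d n.+2 = d * cheb d n.+1 - cheb d n.
Proof. by rewrite /cheb /=; case: (cheb_pair d n). Qed.

Lemma cheb_sin t n : cheb (2 * cos t) n * sin t = sin (n%:R * t).
Proof.
suff : cheb (2 * cos t) n * sin t = sin (n%:R * t) /\
    cheb (2 * cos t) n.+1 * sin t = sin (n.+1%:R * t) by case.
elim: n => [|n [IH1 IH2]]; first by rewrite mul0r !mul1r mul0r sin0.
split=> //; rewrite chebSS mulrBl -(mulrA (2 * cos t)) IH1 IH2.
rewrite -[n.+2]addn1 -[n.+1 in RHS]addn1 !natrD.
have -> : (n%:R + 1 + 1) * t = (n.+1%:R * t) + t :> R.
  by rewrite -natr1; ring.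
have -> : n%:R * t = (n.+1%:R * t) - t :> R.
  by rewrite -natr1; ring.
by rewrite sinB sinD; ring.
Qed.

Lemma cheb_incr d n : 2 <= d -> cheb d n < cheb d n.+1.
Proof.
move=> d2; suff /andP[] : (0 <= cheb d n) && (cheb d n < cheb d n.+1) by [].
elim: n => [|n /andP[n0 lt]]; first by rewrite lexx ltr01.
rewrite (le_trans n0 (ltW lt)) chebSS /=.
suff : 0 <= (d - 2) * cheb d n.+1 by lra.
by rewrite mulr_ge0 ?subr_ge0 // (le_trans n0 (ltW lt)).
Qed.

Lemma cheb_gt0 d n : 2 <= d -> (0 < n)%N -> 0 < cheb d n.
Proof.
move=> d2; case: n => // n _; elim: n => [|n IH]; first exact: ltr01.
exact: lt_trans IH (cheb_incr _ d2).
Qed.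

Lemma angle_of_norm d : 0 <= d < 2 ->
  exists t, [/\ 0 < t, t <= pi / 2 & d = 2 * cos t].
Proof.
move=> /andP[d0 d2].
have d1 : -1 <= d / 2 <= 1 by apply/andP; split; lra.
exists (acos (d / 2)); split.
- by apply: acos_gt0; apply/andP; split; lra.
- rewrite leNgt; apply/negP => lt.
  have lpi : acos (d / 2) < pi by apply: acos_ltpi; apply/andP; split; lra.
  have : 0 < cos (pi - acos (d / 2)).
    by apply: cos_gt0_pihalf; apply/andP; split; lra.
  rewrite cosB cospi sinpi mul0r addr0 acosK ?in_itv //=; lra.
- by rewrite acosK ?in_itv //= mulrC divfK // pnatr_eq0.
Qed.

(** The least [m] for which [m t] reaches [pi]. *)
Lemma angle_multiple t : 0 < t <= pi / 2 -> exists m : nat,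
  [/\ (2 <= m)%N, m.-1%:R * t < pi & pi <= m%:R * t].
Proof.
move=> /andP[t0 t1].
have pt : 0 <= pi / t by rewrite divr_ge0 ?pi_ge0 // ltW.
have ex : exists m : nat, pi <= m%:R * t.
  exists (Num.bound (pi / t)).
  rewrite -ler_pdivrMr //; exact/ltW/archi_boundP.
case: (ex_minnP ex) => m pm min; exists m.
have m2 : (2 <= m)%N.
  rewrite leqNgt; apply/negP => m1.
  have : m%:R * t <= 1 * t by rewrite ler_pM2r // (ler_nat R m 1).
  have := pi_gt0 R; lra.
split=> //; rewrite ltNge; apply/negP => /min.
by case: m m2 {pm min} => // m _; rewrite ltnn.
Qed.
End Chebyshev.

(** * Sign coherence from the Tits form *)

Section TitsForm.
Variables (n : nat) (N : 'M[int]_n).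
Hypothesis N0 : forall i j, 0 <= N i j.
Implicit Types x y : 'rV[int]_n.

Definition dot x y : int := (x *m y^T) 0 0.

(** The Tits form of the bipartite graph with [N i j] edges between the [i]th
    vertex on the side of [a] and the [j]th vertex on the side of [b]. *)
Definition tits x y := dot x x + dot y y - dot (x *m N) y.

Lemma dotC x y : dot x y = dot y x.
Proof. by rewrite /dot -[x *m y^T]trmxK trmx_mul trmxK mxE. Qed.

Lemma dotDl x x' y : dot (x + x') y = dot x y + dot x' y.
Proof. by rewrite /dot mulmxDl mxE. Qed.

Lemma dotDr x x' y : dot y (x + x') = dot y x + dot y x'.
Proof. by rewrite !(dotC y) dotDl. Qed.

Lemma dotNl x y : dot (- x) y = - dot x y.
Proof. by rewrite /dot mulNmx mxE. Qed.

Lemma dotNr x y : dot x (- y) = - dot x y.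
Proof. by rewrite !(dotC x) dotNl. Qed.

Lemma dot_adj x y : dot x (y *m N^T) = dot (x *m N) y.
Proof. by rewrite /dot trmx_mul trmxK mulmxA. Qed.

Lemma dotE x y : dot x y = \sum_i x 0 i * y 0 i.
Proof. by rewrite /dot mxE; apply: eq_bigr => i _; rewrite mxE. Qed.

Lemma tits_refl_b x y : tits x (x *m N - y) = tits x y.
Proof.
rewrite /tits !(dotDl, dotDr, dotNl, dotNr) (dotC y); ring.
Qed.

Lemma tits_refl_a x y : tits (y *m N^T - x) y = tits x y.
Proof.
rewrite /tits -!dot_adj; set u := y *m N^T.
by rewrite !(dotDl, dotDr, dotNl, dotNr) (dotC u x); ring.
Qed.

Hypothesis tits_pos : forall x y, (x != 0) || (y != 0) -> 0 < tits x y.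

Definition nonneg x := forall i, 0 <= x 0 i.

Lemma disjoint_parts x : exists xp xn,
  [/\ x = xp - xn, nonneg xp, nonneg xn & dot xp xn = 0].
Proof.
pose xp : 'rV[int]_n := map_mx (Num.max 0) x.
exists xp, (xp - x); split=> [|i|i|]; first by rewrite subKr.
- by rewrite mxE le_max lexx.
- by rewrite !mxE subr_ge0 le_max lexx orbT.
rewrite dotE big1 // => i _; rewrite !mxE.
by case: (lerP 0 (x 0 i)) => _; rewrite ?subrr ?mulr0 ?mul0r.
Qed.

Lemma dot_ge0 x y : nonneg x -> nonneg y -> 0 <= dot (x *m N) y.
Proof.
move=> x0 y0; rewrite dotE sumr_ge0 // => j _; rewrite mulr_ge0 // mxE.
by rewrite sumr_ge0 // => i _; rewrite mulr_ge0.
Qed.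

(** The off-diagonal part of the form is nonpositive, so that the positive and the
    negative part of a vector have values that add up to at most that of the
    vector; each is a positive integer unless the part vanishes. *)
Lemma tits_sign_coherent x y : tits x y = 1 ->
  (nonneg x /\ nonneg y) \/ (nonneg (- x) /\ nonneg (- y)).
Proof.
have [xp [xn [-> xp_ge xn_ge xpn]]] := disjoint_parts x.
have [yp [yn [-> yp_ge yn_ge ypn]]] := disjoint_parts y.
move=> q1; have qE : tits xp yp + tits xn yn <= 1.
  rewrite -q1 /tits mulmxBl.
  rewrite !(dotDl, dotDr, dotNl, dotNr) (dotC xn xp) (dotC yn yp) xpn ypn.
  have := dot_ge0 xp_ge yn_ge; have := dot_ge0 xn_ge yp_ge; lra.
have [/andP[/eqP xn0 /eqP yn0]|nz] := boolP ((xn == 0) && (yn == 0)).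
  by left; rewrite xn0 yn0 !subr0.
have [/andP[/eqP xp0 /eqP yp0]|pz] := boolP ((xp == 0) && (yp == 0)).
  by right; rewrite xp0 yp0 !sub0r !opprK.
rewrite negb_and in nz; rewrite negb_and in pz.
have := tits_pos nz; have := tits_pos pz; rewrite !gtz0_ge1 => p1 p2.
exfalso; lra.
Qed.

End TitsForm.

Section FiniteType.
Variables (R : realType) (n : nat) (N : 'M[int]_n) (w : 'I_n -> R) (d : R).
Hypothesis N0 : forall i j, 0 <= N i j.
Hypothesis w0 : forall i, 0 < w i.
Hypothesis Nw : forall i, \sum_j (N i j)%:~R * w j = d * w i.
Hypothesis NTw : forall j, \sum_i (N i j)%:~R * w i = d * w j.
Implicit Types x y : 'rV[int]_n.

Local Notation p := (mulmxr N : {additive 'rV[int]_n -> 'rV[int]_n}).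
Local Notation q := (mulmxr N^T : {additive 'rV[int]_n -> 'rV[int]_n}).

Definition weight x : R := \sum_i w i * (x 0 i)%:~R.

Lemma weightD x y : weight (x + y) = weight x + weight y.
Proof.
rewrite /weight -big_split; apply: eq_bigr => i _.
by rewrite mxE rmorphD mulrDr.
Qed.

Lemma weightN x : weight (- x) = - weight x.
Proof. by rewrite /weight -sumrN; apply: eq_bigr => i _; rewrite mxE rmorphN mulrN. Qed.

Lemma weight_mul x : weight (x *m N) = d * weight x.
Proof.
rewrite /weight mulr_sumr.
under eq_bigr do rewrite mxE rmorph_sum mulr_sumr.
rewrite exchange_big; apply: eq_bigr => i _ /=.
rewrite mulrA -Nw mulr_suml; apply: eq_bigr => j _.
by rewrite rmorphM /=; ring.
Qed.

Lemma weight_mulT x : weight (x *m N^T) = d * weight x.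
Proof.
rewrite /weight mulr_sumr.
under eq_bigr do rewrite mxE rmorph_sum mulr_sumr.
rewrite exchange_big; apply: eq_bigr => i _ /=.
rewrite mulrA -NTw mulr_suml; apply: eq_bigr => j _.
by rewrite mxE rmorphM /=; ring.
Qed.

Lemma weight_ge0 x : nonneg x -> 0 <= weight x.
Proof. by move=> x0; apply: sumr_ge0 => i _; rewrite mulr_ge0 ?ler0z ?(ltW (w0 i)). Qed.

Lemma weight_eq0 x : nonneg x -> weight x = 0 -> x = 0.
Proof.
move=> x0 /eqP; rewrite psumr_eq0 => [|i _]; last by rewrite mulr_ge0 ?ler0z ?(ltW (w0 i)).
move=> /allP all0; apply/rowP => i; have := all0 i (mem_index_enum _).
by rewrite /= mulf_eq0 gt_eqF //= intr_eq0 mxE => /eqP.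
Qed.

(** Schur's test: [N] has norm at most [d], as [w] is a positive eigenvector of
    both [N] and its transpose. *)
Lemma tits_pos x y : d < 2 -> (x != 0) || (y != 0) -> 0 < tits N x y.
Proof.
move=> d2 nz; rewrite -(ltr0z R).
pose X i : R := (x 0 i)%:~R; pose Y i : R := (y 0 i)%:~R.
have dotR u v : (dot u v)%:~R = \sum_i (u 0 i)%:~R * (v 0 i)%:~R :> R.
  by rewrite dotE rmorph_sum; apply: eq_bigr => i _; rewrite rmorphM.
have xNy : (dot (x *m N) y)%:~R <= d / 2 * ((dot x x)%:~R + (dot y y)%:~R) :> R.
  rewrite !dotR.
  have -> : \sum_i ((x *m N) 0 i)%:~R * (y 0 i)%:~R =
      \sum_i \sum_j (N i j)%:~R * (X i * Y j) :> R.
    rewrite exchange_big; apply: eq_bigr => j _ /=.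
    rewrite mxE rmorph_sum mulr_suml; apply: eq_bigr => i _.
    by rewrite rmorphM /X /Y /=; ring.
  apply: (@le_trans _ _ (\sum_i \sum_j (N i j)%:~R *
      (X i ^+ 2 / w i * w j / 2 + Y j ^+ 2 / w j * w i / 2))).
    apply: ler_sum => i _; apply: ler_sum => j _.
    apply: ler_wpM2l; first by rewrite ler0z.
    (* The arithmetic-geometric mean inequality, weighted by [w j / w i]. *)
    rewrite -subr_ge0.
    have -> : X i ^+ 2 / w i * w j / 2 + Y j ^+ 2 / w j * w i / 2 - X i * Y j
        = (X i * w j - Y j * w i) ^+ 2 / (2 * w i * w j).
      by field; rewrite !gt_eqF.
    by rewrite divr_ge0 ?sqr_ge0 // !mulr_ge0 // ltW.
  rewrite le_eqVlt; apply/orP; left; apply/eqP.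
  under eq_bigr do under eq_bigr do rewrite mulrDr.
  under eq_bigr do rewrite big_split.
  rewrite big_split /= mulrDr; congr (_ + _); last first.
    rewrite exchange_big mulr_sumr; apply: eq_bigr => j _ /=.
    transitivity (Y j ^+ 2 / w j / 2 * \sum_i (N i j)%:~R * w i).
      by rewrite mulr_sumr; apply: eq_bigr => i _; ring.
    by rewrite NTw /Y; field; rewrite gt_eqF.
  rewrite mulr_sumr; apply: eq_bigr => i _ /=.
  transitivity (X i ^+ 2 / w i / 2 * \sum_j (N i j)%:~R * w j).
    by rewrite mulr_sumr; apply: eq_bigr => j _; ring.
  by rewrite Nw /X; field; rewrite gt_eqF.
have dot_pos u : 0 <= (dot u u)%:~R ?= iff (u == 0) :> R.
  rewrite dotR; split.
    by apply: sumr_ge0 => i _; rewrite -expr2 sqr_ge0.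
  rewrite eq_sym psumr_eq0 => [|i _]; last by rewrite -expr2 sqr_ge0.
  apply/allP/eqP => [u0|->]; last by move=> i _; rewrite /= mxE rmorph0 mul0r.
  apply/rowP => i; have := u0 i (mem_index_enum _).
  by rewrite /= mulf_eq0 orbb intr_eq0 mxE => /eqP.
have sum_pos : 0 < (dot x x)%:~R + (dot y y)%:~R :> R.
  rewrite lt_neqAle addr_ge0 ?dot_pos // andbT eq_sym paddr_eq0 ?dot_pos //.
  by rewrite ![_%:~R == _]eq_sym !dot_pos negb_and.
have : 0 < (1 - d / 2) * ((dot x x)%:~R + (dot y y)%:~R) by apply: mulr_gt0; lra.
rewrite /tits rmorphB rmorphD /=; lra.
Qed.

Lemma weight_alt x m : weight (alt p q x m) = cheb d m * weight x.
Proof.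
suff : weight (alt p q x m) = cheb d m * weight x /\
    weight (alt p q x m.+1) = cheb d m.+1 * weight x by case.
elim: m => [|m [IH1 IH2]].
  split; last by rewrite mul1r.
  by rewrite mul0r; apply: big1 => i _; rewrite mxE mulr0.
split=> //; rewrite altSS weightD weightN chebSS mulrBl -mulrA -IH2 -IH1.
by congr (_ - _); case: odd; rewrite /= (weight_mul, weight_mulT).
Qed.

(** Consecutive terms differ by reflections, which preserve the form. *)
Lemma tits_alt x m : let z := alt p q x in
  tits N (if odd m then z m else z m.+1) (if odd m then z m.+1 else z m)
    = dot x x.
Proof.
move=> z; elim: m => [|m IH].
  by rewrite /= /z alt0 alt1 /tits !(dotC _ 0) /dot !mul0mx !mxE addr0 subr0.
rewrite -IH /= /z altSS; case: (odd m) => /=; first exact: tits_refl_a.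
exact: tits_refl_b.
Qed.

Lemma alt_sign_coherent x m : d < 2 -> dot x x = 1 ->
  (nonneg (alt p q x m) /\ nonneg (alt p q x m.+1)) \/
  (nonneg (- alt p q x m) /\ nonneg (- alt p q x m.+1)).
Proof.
move=> d2 x1; have := tits_alt x m; rewrite x1 /= => /tits_sign_coherent.
case=> [||[]|[]] => //; first by move=> u v; apply: tits_pos.
  by case: odd; [left|left].
by case: odd; [right|right].
Qed.

(** A positive weight decides the common sign of two consecutive terms. *)
Lemma alt_coherent_weight x m : d < 2 -> dot x x = 1 -> nonneg x ->
  0 < cheb d m -> 0 < weight x /\ nonneg (alt p q x m.+1).
Proof.
move=> d2 x1 x0 cm; have wx : 0 < weight x.
  rewrite lt_def weight_ge0 // andbT; apply/eqP => /(weight_eq0 x0) xx.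
  by move: x1; rewrite xx /dot mul0mx mxE => /eqP; rewrite eq_sym oner_eq0.
split=> //; have [[]//|[/weight_ge0]] := alt_sign_coherent m d2 x1.
rewrite weightN weight_alt oppr_ge0 leNgt.
by rewrite mulr_gt0.
Qed.

(** With [d = 2 cos t] the weights of the alternating sequence are proportional
    to [sin (m t)]; when this first fails to be positive it cannot become
    negative, by sign coherence, so that [t] divides [pi]. *)
Lemma norm_cos x : 0 <= d < 2 -> dot x x = 1 -> nonneg x ->
  exists m : nat, (2 <= m)%N /\ d = 2 * cos (pi / m%:R).
Proof.
move=> d02 x1 x0; have /andP[d0 d2] := d02.
have [t [t0 t1 dt]] := angle_of_norm d02.
have [|m [m2 lt le]] := @angle_multiple _ t; first by rewrite t0 t1.
exists m; split=> //; rewrite dt; congr (2 * cos _).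
case: m m2 lt le => [//|[//|m]] _; rewrite /= => lt le.
have pi0 := pi_gt0 R.
have st : 0 < sin t by apply: sin_gt0_pi; apply/andP; split; lra.
have cm : 0 < cheb d m.+1.
  rewrite -(pmulr_lgt0 _ st) dt cheb_sin; apply: sin_gt0_pi.
  by rewrite lt andbT mulr_gt0 // ltr0n.
have [wx zm] := alt_coherent_weight d2 x1 x0 cm.
have := weight_ge0 zm; rewrite weight_alt pmulr_lge0 // -(pmulr_lge0 _ st).
rewrite dt cheb_sin => s0.
have E : m.+2%:R * t = m.+1%:R * t + t by rewrite -[m.+2]addn1 natrD; ring.
have : sin (m.+2%:R * t - pi) <= 0.
  by rewrite sinB cospi sinpi mulr0 subr0 mulrN1 oppr_le0.
have [<- _|ne] := eqVneq (m.+2%:R * t) pi.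
  by rewrite [m.+2%:R * t]mulrC mulfK // pnatr_eq0.
rewrite leNgt sin_gt0_pi //.
have : m.+2%:R * t - pi != 0 by rewrite subr_eq0.
by rewrite neq_lt => /orP[]; lra.
Qed.

(** The term [z_m] has weight zero, and is nonnegative by sign coherence with
    [z_(m-1)]. *)
Lemma alt_vanish x m : (2 <= m)%N -> d = 2 * cos (pi / m%:R) -> d < 2 ->
  dot x x = 1 -> nonneg x -> alt p q x m = 0.
Proof.
case: m => [//|[//|m]] _ dm d2 x1 x0; have pi0 := pi_gt0 R.
set t := pi / _ in dm.
have tm : m.+2%:R * t = pi by rewrite mulrC divfK // pnatr_eq0.
have t0 : 0 < t by rewrite divr_gt0 // ltr0n.
have E : m.+2%:R * t = m.+1%:R * t + t by rewrite -[m.+2]addn1 natrD; ring.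
have mt : 0 < m.+1%:R * t by rewrite mulr_gt0 // ltr0n.
have st : 0 < sin t by apply: sin_gt0_pi; apply/andP; split; lra.
have cm : 0 < cheb d m.+1.
  by rewrite -(pmulr_lgt0 _ st) dm cheb_sin; apply: sin_gt0_pi; apply/andP; split; lra.
have [wx zm] := alt_coherent_weight d2 x1 x0 cm.
apply: weight_eq0 => //; rewrite weight_alt.
have /eqP : cheb d m.+2 * sin t = 0 by rewrite dm cheb_sin tm sinpi.
by rewrite mulf_eq0 (gt_eqF st) orbF => /eqP ->; rewrite mul0r.
Qed.

Lemma alt_vanish_all m : (2 <= m)%N -> d = 2 * cos (pi / m%:R) -> d < 2 ->
  forall x, alt p q x m = 0.
Proof.
move=> m2 dm d2 x.
have altD y z l : alt p q (y + z) l = alt p q y l + alt p q z l.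
  suff : alt p q (y + z) l = alt p q y l + alt p q z l /\
    alt p q (y + z) l.+1 = alt p q y l.+1 + alt p q z l.+1 by case.
  elim: l => [|l [IH1 IH2]]; first by rewrite !alt0 !alt1 addr0.
  split=> //; rewrite !altSS IH1 IH2 opprD addrACA; congr (_ + _).
  by case: odd; rewrite raddfD.
have alt0x : alt p q 0 m = 0.
  by apply: (addrI (alt p q 0 m)); rewrite -altD !addr0.
rewrite (row_sum_delta x).
elim/big_ind: _ => // [y z y0 z0|i _]; first by rewrite altD y0 z0 addr0.
have delta1 : alt p q (delta_mx 0 i) m = 0.
  apply: alt_vanish => //.
    rewrite dotE (bigD1 i) //= big1 => [|j ji]; first by rewrite !mxE !eqxx.
    by rewrite !mxE (negPf ji) andbF mul0r.
  by move=> j; rewrite mxE.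
have nat_case l : alt p q (delta_mx 0 i *+ l) m = 0.
  elim: l => [|l IH]; first by rewrite mulr0n alt0x.
  by rewrite mulrS altD delta1 IH addr0.
rewrite -[x 0 i]intz scaler_int; case: (x 0 i) => l; first exact: nat_case.
rewrite NegzE mulrNz; apply: (addrI (alt p q (delta_mx 0 i *~ l.+1) m)).
by rewrite -altD subrr alt0x addr0 [in RHS]nat_case.
Qed.

End FiniteType.

Section ChebyshevPeriod.
Variable R : realType.

(** The orbit of the weights under the Coxeter element turns by the angle
    [2 pi / m] at each step. *)
Lemma cheb_period_ge (m l : nat) (d := 2 * cos (pi / m%:R) : R) : (2 <= m)%N ->
  (0 < l)%N -> cheb d l.*2 = 0 -> cheb d l.*2.+1 = 1 -> (m <= l)%N.
Proof.
move=> m2 l0 c0 c1; rewrite leqNgt; apply/negP => lm.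
have m0 : 0 < m%:R :> R by rewrite ltr0n (leq_trans _ m2).
set t := pi / m%:R in d c0 c1; have pi0 := pi_gt0 R.
have t0 : 0 < t by rewrite divr_gt0.
have tm : m%:R * t = pi by rewrite mulrC divfK // gt_eqF.
have lt1 : l%:R * t < pi by rewrite -tm ltr_pM2r // ltr_nat.
have lt0 : 0 < l%:R * t by rewrite mulr_gt0 // ltr0n.
have t2 : 2 * t <= pi by rewrite -tm ler_pM2r // ler_nat.
have st : 0 < sin t by apply: sin_gt0_pi; apply/andP; split; lra.
have s0 : sin (l.*2%:R * t) = 0 by rewrite -cheb_sin -/d c0 mul0r.
have := cheb_sin t l.*2.+1; rewrite -/d c1 mul1r.
have E2 : l.*2%:R * t = l%:R * t + l%:R * t by rewrite -addnn natrD mulrDl.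
have -> : l.*2.+1%:R * t = l.*2%:R * t + t by rewrite -natr1 mulrDl mul1r.
rewrite sinD s0 mul0r add0r => /eqP; rewrite -subr_eq0 -{1}[sin t]mul1r -mulrBl.
rewrite mulf_eq0 (gt_eqF st) orbF subr_eq0 => /eqP c2.
have sl : 0 < sin (l%:R * t) by apply: sin_gt0_pi; apply/andP; split.
have := cos2Dsin2 (l%:R * t).
move: c2; rewrite E2 cosD -!expr2 => c2 c3.
by have := exprn_gt0 2 sl; lra.
Qed.

End ChebyshevPeriod.

(** * Representations and their reflections *)

Lemma indecomposable_of_idempotents (k : fieldType) (A : linCat k) (X : A) :
  ~ is_zero X -> (forall e : hom X X, e \oc e = e -> e = 0 \/ e = idm X) ->
  is_indecomposable X.
Proof.
move=> X0 trivX; split=> // Y Z [i1 [i2 [p1 [p2 [e1 e2 e12 e21 e]]]]].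
have ee : i1 \oc p1 \oc (i1 \oc p1) = i1 \oc p1.
  by rewrite -compA [p1 \oc _]compA e1 comp1m.
case: (trivX _ ee) => E.
  by left; apply: is_zeroP; rewrite -e1 -[i1]compm1 -e1 [i1 \oc _]compA E comp0m compm0.
right; apply: is_zeroP; move: e; rewrite E => /(canRL (addKr _)); rewrite addNr => E2.
by rewrite -e2 -[i2]compm1 -e2 [i2 \oc _]compA E2 comp0m compm0.
Qed.

Section Representations.
Variables (k : fieldType) (C : monCat k) (M : modCat C).
Hypothesis abM : is_abelian M.
Implicit Types (P L : C).

Local Notation "X <| f" := (actm (idm X) f) (at level 39).

Section FixedArrow.
Variable P : C.
Implicit Types X Y : RepCat M P.

Definition rep_mk X Y (f : hom (rep_a X) (rep_a Y)) (g : hom (rep_b X) (rep_b Y))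
    (fg : g \oc rep_map X = rep_map Y \oc P <| f) : hom X Y :=
  @RepHom k C M P X Y (f, g) (introT eqP fg).

Lemma rep_hom_comm X Y (u : hom X Y) :
  (rep_hom_val u).2 \oc rep_map X = rep_map Y \oc P <| (rep_hom_val u).1.
Proof. exact: (eqP (rep_homP u)). Qed.

Lemma rep_hom_eq X Y (u v : hom X Y) :
  (rep_hom_val u).1 = (rep_hom_val v).1 ->
  (rep_hom_val u).2 = (rep_hom_val v).2 -> u = v.
Proof.
move=> e1 e2; apply: val_inj => /=.
by move: e1 e2; case: (rep_hom_val u) => ? ?; case: (rep_hom_val v) => ? ? /= -> ->.
Qed.

Lemma rep_zero X : is_zero (rep_a X) -> is_zero (rep_b X) -> is_zero X.
Proof. by move=> a0 b0; apply: is_zeroP; apply: rep_hom_eq; apply: zero_id. Qed.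

Lemma zero_rep X : is_zero X -> is_zero (rep_a X) /\ is_zero (rep_b X).
Proof.
move=> /zero_id X0; split; apply: is_zeroP.
  exact: (congr1 (fun u : hom X X => (rep_hom_val u).1) X0).
exact: (congr1 (fun u : hom X X => (rep_hom_val u).2) X0).
Qed.

Lemma isomorphic_rep X Y : isomorphic X Y ->
  isomorphic (rep_a X) (rep_a Y) /\ isomorphic (rep_b X) (rep_b Y).
Proof.
case=> -[f g gf fg]; split; exists.
  exists (rep_hom_val f).1 (rep_hom_val g).1.
    exact: (congr1 (fun u : hom X X => (rep_hom_val u).1) gf).
  exact: (congr1 (fun u : hom Y Y => (rep_hom_val u).1) fg).
exists (rep_hom_val f).2 (rep_hom_val g).2.
  exact: (congr1 (fun u : hom X X => (rep_hom_val u).2) gf).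
exact: (congr1 (fun u : hom Y Y => (rep_hom_val u).2) fg).
Qed.

Lemma rep_isomorphic X Y (f : hom (rep_a X) (rep_a Y)) (f' : hom (rep_a Y) (rep_a X))
    (g : hom (rep_b X) (rep_b Y)) (g' : hom (rep_b Y) (rep_b X)) :
  f' \oc f = idm _ -> f \oc f' = idm _ -> g' \oc g = idm _ -> g \oc g' = idm _ ->
  g \oc rep_map X = rep_map Y \oc P <| f -> isomorphic X Y.
Proof.
move=> f'f ff' g'g gg' fg.
have fg' : g' \oc rep_map Y = rep_map X \oc P <| f'.
  rewrite -[rep_map Y]compm1 -actm1 -ff' actl_comp [rep_map Y \oc _]compA -fg.
  by rewrite !compA g'g comp1m.
by exists; exists (rep_mk fg) (rep_mk fg'); apply: rep_hom_eq.
Qed.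

(** The idempotents at both vertices split, compatibly with the structure map,
    into complementary subrepresentations. *)
Lemma rep_idempotent X (e : hom X X) : is_indecomposable X -> e \oc e = e ->
  e = 0 \/ e = idm X.
Proof.
move=> [_ indX] ee.
pose ea := (rep_hom_val e).1; pose eb := (rep_hom_val e).2.
have eea : ea \oc ea = ea.
  exact: (congr1 (fun u : hom X X => (rep_hom_val u).1) ee).
have eeb : eb \oc eb = eb.
  exact: (congr1 (fun u : hom X X => (rep_hom_val u).2) ee).
have ec : eb \oc rep_map X = rep_map X \oc P <| ea := rep_hom_comm e.
have [Ya [Za [i1 [i2 [p1 [p2 [bia ia1 ia2]]]]]]] := idempotent_dsum abM eea.
have [Yb [Zb [j1 [j2 [q1 [q2 [bib ib1 ib2]]]]]]] := idempotent_dsum abM eeb.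
have [a1 a2 a12 a21 a] := bia; have [b1 b2 b12 b21 b] := bib.
have i1E : i1 = ea \oc i1 by rewrite -ia1 -compA a1 compm1.
have p1E : p1 = p1 \oc ea by rewrite -ia1 compA a1 comp1m.
have j1E : j1 = eb \oc j1 by rewrite -ib1 -compA b1 compm1.
have q1E : q1 = q1 \oc eb by rewrite -ib1 compA b1 comp1m.
have i2E : i2 = (idm _ - ea) \oc i2 by rewrite -ia2 -compA a2 compm1.
have p2E : p2 = p2 \oc (idm _ - ea) by rewrite -ia2 compA a2 comp1m.
have j2E : j2 = (idm _ - eb) \oc j2 by rewrite -ib2 -compA b2 compm1.
have q2E : q2 = q2 \oc (idm _ - eb) by rewrite -ib2 compA b2 comp1m.
have actB : P <| (idm _ - ea) = idm _ - P <| ea.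
  by rewrite addrC -scaleN1r actm_linr actm1 scaleN1r addrC.
have fc : (idm _ - eb) \oc rep_map X = rep_map X \oc P <| (idm _ - ea).
  by rewrite actB compBl compBr comp1m compm1 ec.
pose Y : RepCat M P := @Rep k C M P Ya Yb (q1 \oc rep_map X \oc P <| i1).
pose Z : RepCat M P := @Rep k C M P Za Zb (q2 \oc rep_map X \oc P <| i2).
have Hi1 : (j1 : hom (rep_b Y) _) \oc rep_map Y
    = rep_map X \oc P <| (i1 : hom (rep_a Y) _).
  by rewrite /= !compA ib1 ec -compA -actl_comp -i1E.
have Hi2 : (j2 : hom (rep_b Z) _) \oc rep_map Z
    = rep_map X \oc P <| (i2 : hom (rep_a Z) _).
  by rewrite /= !compA ib2 fc -compA -actl_comp -i2E.
have Hp1 : (q1 : hom _ (rep_b Y)) \oc rep_map X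
    = rep_map Y \oc P <| (p1 : hom _ (rep_a Y)).
  by rewrite /= -compA -actl_comp ia1 -[q1 \oc rep_map X \oc _]compA -ec compA -q1E.
have Hp2 : (q2 : hom _ (rep_b Z)) \oc rep_map X
    = rep_map Z \oc P <| (p2 : hom _ (rep_a Z)).
  by rewrite /= -compA -actl_comp ia2 -[q2 \oc rep_map X \oc _]compA -fc compA -q2E.
have dX : is_dsum Y Z X.
  exists (rep_mk Hi1), (rep_mk Hi2), (rep_mk Hp1), (rep_mk Hp2).
  by split; apply: rep_hom_eq.
case: (indX _ _ dX) => /zero_rep[/zero_id za /zero_id zb].
  left; apply: rep_hom_eq; rewrite -/ea -/eb /=.
    by rewrite -ia1 -[i1]compm1 za compm0 comp0m.
  by rewrite -ib1 -[j1]compm1 zb compm0 comp0m.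
right; apply: rep_hom_eq; rewrite -/ea -/eb /=.
  by rewrite -a ia1 -[i2]compm1 za compm0 comp0m addr0.
by rewrite -b ib1 -[j2]compm1 zb compm0 comp0m addr0.
Qed.

Hypothesis ssM : is_semisimple M.

(** Semisimplicity of [M] splits off the cokernel of the structure map as a
    representation concentrated at [b]. *)
Lemma indecomposable_epi_or_simple X : is_indecomposable X ->
  is_epi (rep_map X) \/ is_zero (rep_a X) /\ is_simple (rep_b X).
Proof.
move=> iX; have [_ _ kc _ _] := abM.
have [_ [Q [c cok]]] := kc _ _ (rep_map X).
have [s cs] := epi_section abM ssM (cokernel_epi cok).
have e0 : s \oc c \oc rep_map X = rep_map X \oc P <| (0 : hom (rep_a X) (rep_a X)).
  by rewrite -compA cok.1 actl0 !compm0.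
have ee : rep_mk e0 \oc rep_mk e0 = rep_mk e0.
  apply: rep_hom_eq; rewrite /= ?compm0 //.
  by rewrite -compA [c \oc _]compA cs comp1m.
case: (rep_idempotent iX ee) => E.
  have c0 : c = 0.
    have /= sc0 := congr1 (fun u : hom X X => (rep_hom_val u).2) E.
    by rewrite -[c]comp1m -cs -compA sc0 compm0.
  left=> T g h gh; have [|u [uc _]] := cok.2 _ (g - h).
    by rewrite compBl gh subrr.
  by apply/eqP; rewrite -subr_eq0 -uc c0 compm0.
right; have a0 : is_zero (rep_a X).
  apply: is_zeroP.
  by have /= <- := congr1 (fun u : hom X X => (rep_hom_val u).1) E.
split=> //.
have b0 : ~ is_zero (rep_b X) by move=> b0; apply: iX.1; apply: rep_zero.
have [T sT [i [p pi]]] := nonzero_simple_summand abM ssM b0.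
have f0 : i \oc p \oc rep_map X = rep_map X \oc P <| (0 : hom (rep_a X) (rep_a X)).
  have Pa0 := act_zero P a0.
  by rewrite ((Pa0 _).2 (rep_map X)) ((Pa0 _).2 (_ \oc 0)) ((Pa0 _).2 (0 \oc _)).
have ff : rep_mk f0 \oc rep_mk f0 = rep_mk f0.
  apply: rep_hom_eq; rewrite /= ?compm0 //.
  by rewrite -compA [p \oc _]compA pi comp1m.
case: (rep_idempotent iX ff) => F.
  have /= ip0 := congr1 (fun u : hom X X => (rep_hom_val u).2) F.
  case: sT.1; apply: is_zeroP.
  by rewrite -pi -[i]compm1 -pi [i \oc _]compA ip0 comp0m compm0.
have /= ip := congr1 (fun u : hom X X => (rep_hom_val u).2) F.
by apply: simple_isomorphic sT; exists; exists i p.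
Qed.

End FixedArrow.
End Representations.

Section Reflection.
Variables (k : fieldType) (C : monCat k) (M : modCat C).
Hypothesis abM : is_abelian M.
Variables (L P : C) (ev : hom (L \ox P) (tunit C)) (coev : hom (tunit C) (P \ox L)).
Hypothesis zigP : runit P \oc tensm (idm P) ev \oc assoc P L P
        \oc tensm coev (idm P) \oc bwd (lunit P) = idm P.
Hypothesis zigL : lunit L \oc tensm ev (idm L) \oc bwd (assoc L P L)
        \oc tensm (idm L) coev \oc bwd (runit L) = idm L.

Local Notation "X <| f" := (actm (idm X) f) (at level 39).

(** The reflection of [X] at the sink [b]: the inclusion of the kernel [K] of
    the structure map in [P \act rep_a X], read through the adjunction. *)
Definition reflected (X : RepCat M P) K (i : hom K (P \act rep_a X)) : RepCat M L :=
  @Rep k C M L K (rep_a X) (adj_down ev i).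

(** Morphisms of reflected representations are commutative squares over the
    kernel inclusions. *)
Lemma reflected_comm (X Y : RepCat M P) KX KY (i : hom KX (P \act rep_a X))
    (j : hom KY (P \act rep_a Y)) (u : hom (reflected i) (reflected j)) :
  P <| (rep_hom_val u).2 \oc i = j \oc (rep_hom_val u).1.
Proof.
have := rep_hom_comm u; rewrite /= -adj_down_nat => /(congr1 (@adj_up _ _ M _ _ coev KX (rep_a Y))).
by rewrite adj_up_nat !(adj_downK zigP).
Qed.

Lemma reflected_lift (X Y : RepCat M P) KX KY (i : hom KX (P \act rep_a X))
    (j : hom KY (P \act rep_a Y)) (u : hom (reflected i) (reflected j)) :
  is_kernel (rep_map X) i -> is_kernel (rep_map Y) j -> is_epi (rep_map X) ->
  exists g : hom (rep_b X) (rep_b Y),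
    g \oc rep_map X = rep_map Y \oc P <| (rep_hom_val u).2.
Proof.
move=> ki kj eX; have [_ cX] := epi_cokernel abM ki eX.
have [|g [gX _]] := cX _ (rep_map Y \oc P <| (rep_hom_val u).2); last by exists g.
by rewrite -compA reflected_comm compA kj.1 comp0m.
Qed.

Lemma reflected_isomorphic (X Y : RepCat M P) KX KY (i : hom KX (P \act rep_a X))
    (j : hom KY (P \act rep_a Y)) :
  is_kernel (rep_map X) i -> is_kernel (rep_map Y) j ->
  is_epi (rep_map X) -> is_epi (rep_map Y) ->
  isomorphic (reflected i) (reflected j) -> isomorphic X Y.
Proof.
move=> ki kj eX eY [[u v vu uv]].
have [g gX] := reflected_lift u ki kj eX.
have [h hY] := reflected_lift v kj ki eY.
have vu2 : (rep_hom_val v).2 \oc (rep_hom_val u).2 = idm (rep_a X) :=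
  congr1 (fun r : hom (reflected i) (reflected i) => (rep_hom_val r).2) vu.
have uv2 : (rep_hom_val u).2 \oc (rep_hom_val v).2 = idm (rep_a Y) :=
  congr1 (fun r : hom (reflected j) (reflected j) => (rep_hom_val r).2) uv.
apply: (rep_isomorphic (X := X) (Y := Y) vu2 uv2 (g := g) (g' := h)) => //.
  apply: eX; rewrite -compA gX compA hY -compA -actl_comp.
  by rewrite vu2 actm1 compm1 comp1m.
apply: eY; rewrite -compA hY compA gX -compA -actl_comp.
by rewrite uv2 actm1 compm1 comp1m.
Qed.

(** An idempotent of the reflected representation extends to the cokernel of [i],
    which is [rep_b X]; so it comes from an idempotent of [X]. *)
Lemma reflected_indecomposable (X : RepCat M P) K (i : hom K (P \act rep_a X)) :
  is_kernel (rep_map X) i -> is_epi (rep_map X) -> is_indecomposable X ->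
  is_indecomposable (reflected i).
Proof.
move=> ki eX iX; have mi := kernel_mono ki.
apply: indecomposable_of_idempotents => [/zero_rep[_ /= a0]|e ee].
  apply: iX.1; apply: rep_zero => //; apply: is_zeroP; apply: eX.
  by rewrite ((act_zero P a0 _).2 (idm _ \oc _)) comp0m.
have [g gX] := reflected_lift e ki ki eX.
pose a := (rep_hom_val e).2.
have aa : a \oc a = a.
  exact: (congr1 (fun r : hom (reflected i) (reflected i) => (rep_hom_val r).2) ee).
have gg : rep_mk gX \oc rep_mk gX = rep_mk gX.
  apply: rep_hom_eq => //=; apply: eX.
  by rewrite -compA gX compA gX -compA -actl_comp aa.
have ie := reflected_comm e.
case: (rep_idempotent abM iX gg) => E.
  have /= a0 := congr1 (fun u : hom X X => (rep_hom_val u).1) E.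
  left; apply: rep_hom_eq => //=; apply: mi; by rewrite -ie a0 actl0 comp0m compm0.
have /= a1 := congr1 (fun u : hom X X => (rep_hom_val u).1) E.
right; apply: rep_hom_eq => //=; apply: mi.
by rewrite -ie a1 actm1 comp1m compm1.
Qed.

Lemma reflected_class (X : RepCat M P) K (i : hom K (P \act rep_a X)) :
  is_kernel (rep_map X) i -> is_epi (rep_map X) ->
  cls (P \act rep_a X) = cls K + cls (rep_b X).
Proof.
move=> ki eX; apply: (cls_exact (f := i) (g := rep_map X)).
by split=> //; apply: epi_cokernel.
Qed.

End Reflection.

(** * Finite and infinite representation type *)

Lemma finitely_many_of_labels (k : fieldType) (A : linCat k) (Z : A)
    (T : finType) (label : A -> T -> Prop) :
  (forall X, is_indecomposable X -> exists i, label X i) ->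
  (forall X Y i, label X i -> label Y i -> isomorphic X Y) ->
  finitely_many_indecomposables A.
Proof.
move=> ex uniq.
exists #|T|, (fun i => if pselect (exists X, label X (enum_val i)) is left e
  then sval (cid e) else Z) => X /ex[i Xi]; exists (enum_rank i).
rewrite enum_rankK; case: pselect => [e|]; last by case; exists X.
exact: uniq Xi (svalP (cid e)).
Qed.

Section RightDual.
Variables (k : fieldType) (C : fusionCat k).

Lemma right_dual_exists (P : C) : exists L, is_left_dual L P.
Proof. by have [_ _ rigC _] := fusionP C; case: (rigC P). Qed.

(** A functional choice of duals and evaluations, along which reflections can be
    iterated. *)
Definition rdual (P : C) : C := sval (cid (right_dual_exists P)).
Definition rdualP (P : C) : is_left_dual (rdual P) P :=
  svalP (cid (right_dual_exists P)).
Definition rdual_ev (P : C) : hom (rdual P \ox P) (tunit C) :=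
  sval (cid (rdualP P)).

End RightDual.

Section FiniteRepresentationType.
Variables (R : realType) (k : closedFieldType) (C : fusionCat k).
Variables (M : fssModCat C) (f : GrMod M -> R).
Hypothesis fD : {morph f : y z / y + z}.
Hypothesis f0 : forall T, is_simple T -> 0 < f (clsM T).
Hypothesis fX : forall (X : C) y, f (clsC X *: y) = FPdim R X * f y.
Let abM := fss_abelian M.
Let finM := @fss_fin_dim k C M.
Let ssM := fmod_semisimple M.

Local Notation F N := (f (clsM N)).

Lemma functional_zero : f 0 = 0.
Proof. by apply: (addrI (f 0)); rewrite -fD !addr0. Qed.

(** The functional plays the role of a dimension: it is positive on nonzero
    objects. *)
Lemma functional_object (N : M) : 0 <= F N /\ (F N = 0 -> is_zero N).
Proof.
move: N; apply: (semisimple_ind abM _ _ ssM) => [Z Z0|S X Y sS dY [X0 _]].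
  have -> : F Z = 0 by rewrite -functional_zero; congr f; apply: cls_zero.
  by rewrite lexx.
have -> : F Y = F S + F X by rewrite -fD; congr f; apply: cls_dsum dY.
have S0 := f0 sS; split; first by rewrite addr_ge0 // ltW.
by move=> /eqP; rewrite gt_eqF // ltr_pwDl.
Qed.

Lemma functional_act (X : C) (N : M) : F (X \act N) = FPdim R X * F N.
Proof. by rewrite -fX clsM_act. Qed.

Lemma functional_isomorphic (X Y : M) : isomorphic X Y -> F X = F Y.
Proof. by move=> XY; congr f; apply: cls_isomorphic. Qed.

Lemma functional_reflected (P : C) (X : RepCat M P) K (i : hom K (P \act rep_a X)) :
  is_kernel (rep_map X) i -> is_epi (rep_map X) ->
  F K = FPdim R P * F (rep_a X) - F (rep_b X).
Proof.
move=> ki eX; rewrite -functional_act.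
have -> : F (P \act rep_a X) = F K + F (rep_b X).
  by rewrite -fD; congr f; exact: (reflected_class abM ki eX).
by rewrite addrK.
Qed.

Section Reduction.
Variables (n : nat) (S : 'I_n -> M).
Hypothesis repS : simple_reps S.

(** The data [l] and [j] determine [X], since each reflection can be undone. *)
Fixpoint reduces (l : nat) (P : C) : RepCat M P -> 'I_n -> Prop :=
  match l with
  | 0 => fun X j => is_zero (rep_a X) /\ isomorphic (rep_b X) (S j)
  | l'.+1 => fun X j => is_epi (rep_map X) /\
      exists K (i : hom K (P \act rep_a X)), is_kernel (rep_map X) i /\
        reduces l' (reflected (rdual_ev P) i) j
  end.

Lemma reduces_isomorphic l (P : C) (X Y : RepCat M P) j :
  reduces l X j -> reduces l Y j -> isomorphic X Y.
Proof.
elim: l P X Y => [|l IH] P X Y /=.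
  move=> [aX bX] [aY bY].
  have [[g h hg gh]] := isomorphic_trans bX (isomorphic_sym bY).
  apply: (rep_isomorphic (f := 0) (f' := 0) _ _ hg gh).
  - by rewrite comp0m zero_id.
  - by rewrite comp0m zero_id.
  - have z := act_zero P aX (rep_b Y).
    by rewrite (z.2 (g \oc _)) (z.2 (_ \oc _)).
move=> [eX [KX [i [ki rX]]]] [eY [KY [j' [kj rY]]]].
have [coev [z1 z2]] := svalP (cid (rdualP P)).
exact: (reflected_isomorphic abM z1 ki kj eX eY (IH _ _ _ rX rY)).
Qed.

(** One reflection replaces the dimensions [b] and [a] of a representation by
    [a] and [d a - b]. *)
Fixpoint dims (d b a : R) (i : nat) : R :=
  if i is i'.+1 then dims d a (d * a - b) i' else b.

Lemma reduces_or_continue l (P : C) (X : RepCat M P) : is_indecomposable X ->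
  (exists l' j, (l' < l)%N /\ reduces l' X j) \/
  (forall i, (i <= l.+1)%N -> 0 <= dims (FPdim R P) (F (rep_b X)) (F (rep_a X)) i).
Proof.
elim: l P X => [|l IH] P X iX.
  right=> -[|[|i]] // _ /=; apply: (functional_object _).1.
case: (indecomposable_epi_or_simple abM ssM iX) => [eX|[a0 sb]]; last first.
  have [_ _ /(_ _ sb)[j bj]] := repS.
  by left; exists 0%N, j.
have [coev [z1 z2]] := svalP (cid (rdualP P)).
have [_ _ /(_ _ _ (rep_map X))[[K [i ki]] _] _ _] := abM.
have iX' := reflected_indecomposable (coev := coev) abM z1 ki eX iX.
case: (IH _ _ iX') => [[l' [j [l'l red]]]|ge0].
  by left; exists l'.+1, j; split=> //; split=> //; exists K, i.
right=> -[_|h hl]; first exact: (functional_object _).1.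
have := ge0 h hl.
by rewrite /= (FPdim_dual R (rdualP P)) (functional_reflected ki eX) (FPdim_dual R (rdualP P)).
Qed.

Lemma dims_sin t b a i : dims (2 * cos t) b a i * sin t
  = a * sin (i%:R * t) - b * sin (i%:R * t - t).
Proof.
elim: i b a => [|i IH] b a /=.
  by rewrite mul0r sub0r sin0 mulr0 sub0r sinN mulrN opprK.
have E : i.+1%:R * t = i%:R * t + t by rewrite -natr1 mulrDl mul1r.
rewrite IH E addrK.
rewrite sinB sinD; ring.
Qed.

(** Since the angle is [pi / m], the dimensions would change sign after [m]
    reflections; so the reflections stop before, at a simple representation. *)
Lemma finite_reps (P : C) m : (2 <= m)%N -> FPdim R P = 2 * cos (pi / m%:R) ->
  finitely_many_indecomposables (RepCat M P).
Proof.
move=> m2 dm; set t := pi / m%:R in dm; have pi0 := pi_gt0 R.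
have m0 : 0 < m%:R :> R by rewrite ltr0n (leq_trans _ m2).
have tm : m%:R * t = pi by rewrite mulrC divfK // gt_eqF.
have t0 : 0 < t by rewrite divr_gt0.
have t2 : 2 * t <= pi by rewrite -tm ler_pM2r // ler_nat.
have st : 0 < sin t by apply: sin_gt0_pi; apply/andP; split; lra.
pose label (X : RepCat M P) (i : 'I_m * 'I_n) := reduces i.1 X i.2.
have [Z zZ] : exists Z : M, is_zero Z by have [] := abM.
apply: (@finitely_many_of_labels _ (RepCat M P)
  (@Rep k C M P Z Z 0) _ label) => [X iX|X Y i].
  case: (reduces_or_continue m iX) => [[l [j [lm red]]]|ge0].
    by exists (Ordinal lm, j).
  have [a0 aP] := functional_object (rep_a X).
  have [b0 bP] := functional_object (rep_b X).
  (* The terms of index [m] and [m + 1] are the opposites of the first two. *)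
  have := ge0 m (leqnSn _); rewrite -(pmulr_lge0 _ st) dm dims_sin tm sinpi mulr0.
  rewrite sinB sinpi cospi => bneg.
  have := ge0 m.+1 (leqnn _); rewrite -(pmulr_lge0 _ st) dm dims_sin.
  rewrite -natr1 mulrDl tm mul1r addrK sinD sinpi cospi => aneg.
  case: iX.1; apply: rep_zero; [apply: aP|apply: bP]; nra.
exact: reduces_isomorphic.
Qed.

End Reduction.
(** The endomorphisms are the scalars of the simple object. *)
Lemma simple_at_a_indecomposable (P : C) (T Z : M) : is_simple T -> is_zero Z ->
  is_indecomposable (@Rep k C M P T Z 0 : RepCat M P).
Proof.
move=> sT Z0; apply: indecomposable_of_idempotents => [/zero_rep[/sT.1]//|e ee].
have b0 (u : hom (rep_b (@Rep k C M P T Z 0)) Z) : u = 0 by apply: (Z0 Z).1.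
have [c ec] := endo_simple_scalar abM finM (rep_hom_val e).1 sT.
have := congr1 (fun u : hom (@Rep k C M P T Z 0 : RepCat M P) _ =>
  (rep_hom_val u).1) ee.
rewrite /= ec -[c *: idm T]addr0 comp_linl comp_linr comp1m !compm0 comp0m.
rewrite !addr0 scalerA => /eqP; rewrite -subr_eq0 -scalerBl scaler_eq0.
have /negPf -> : idm T != 0 by apply/eqP => /is_zeroP /sT.1.
rewrite orbF -[X in _ - X]mulr1 -mulrBr mulf_eq0 subr_eq0 => /orP[]/eqP cE.
  by left; apply: rep_hom_eq; rewrite /= ?ec ?cE ?scale0r // [LHS]b0.
by right; apply: rep_hom_eq; rewrite /= ?ec ?cE ?scale1r // [LHS]b0 [RHS]b0.
Qed.

(** Reflecting [l] times a simple representation at the source of the [l]th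
    iterated dual of [P] never meets a representation concentrated at [b],
    because the dimensions keep growing. *)
Lemma preprojective (T : M) l (P : C) : is_simple T -> 2 <= FPdim R P ->
  exists X : RepCat M P, [/\ is_indecomposable X,
    F (rep_a X) = cheb (FPdim R P) l.+1 * F T
    & F (rep_b X) = cheb (FPdim R P) l * F T].
Proof.
move=> sT; elim: l P => [|l IH] P d2.
  have [Z zZ] : exists Z : M, is_zero Z by have [] := abM.
  exists (@Rep k C M P T Z 0 : RepCat M P).
  split; [exact: simple_at_a_indecomposable|by rewrite /= mul1r|].
  rewrite /= mul0r -functional_zero; congr f; exact: cls_zero.
have PQ : is_left_dual P (ldual P) := svalP (cid (left_dual_exists P)).
have [ev [coev [z1 z2]]] := PQ.
have dQ := FPdim_dual R PQ.
have [|X [iX aX bX]] := IH (ldual P); first by rewrite dQ.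
have eX : is_epi (rep_map X).
  case: (indecomposable_epi_or_simple abM ssM iX) => [//|[a0 _]].
  have : 0 < F (rep_a X) by rewrite aX dQ mulr_gt0 ?cheb_gt0 ?f0.
  rewrite (_ : clsM (rep_a X) = 0); last exact: cls_zero.
  by rewrite functional_zero ltxx.
have [_ _ /(_ _ _ (rep_map X))[[K [i ki]] _] _ _] := abM.
exists (reflected ev i); split=> /=.
- exact: (reflected_indecomposable abM z1 ki eX iX).
- by rewrite (functional_reflected ki eX) aX bX dQ chebSS mulrBl mulrA.
- by rewrite aX dQ.
Qed.

(** The preprojective representations have distinct dimensions. *)
Lemma infinite_reps (P : C) : (exists X : M, ~ is_zero X) -> 2 <= FPdim R P ->
  ~ finitely_many_indecomposables (RepCat M P).
Proof.
move=> [Y Y0] d2 [n [I allI]].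
have [T sT _] := nonzero_simple_summand abM ssM Y0.
have ex (l : 'I_n.+1) : exists i, F (rep_b (I i)) = cheb (FPdim R P) l * F T.
  have [X [iX _ bX]] := preprojective l sT d2.
  have [i Xi] := allI X iX; exists i; rewrite -bX; apply: functional_isomorphic.
  by case: (isomorphic_rep (isomorphic_sym Xi)).
(* One more dimension than there are listed representations. *)
pose g l := sval (cid (ex l)).
have gP l : F (rep_b (I (g l))) = cheb (FPdim R P) l * F T := svalP (cid (ex l)).
have cheb_inj : injective (cheb (FPdim R P)).
  by apply/inc_inj/Order.NatMonotonyTheory.incnP => a; apply: cheb_incr.
have : injective g.
  move=> a b ab; have := gP a; rewrite ab gP.
  by move=> /(mulIf (lt0r_neq0 (f0 sT))) /cheb_inj /val_inj.
by move=> /leq_card; rewrite !card_ord ltnn.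
Qed.

End FiniteRepresentationType.

(** * The order of the Coxeter operator *)

Lemma iter_conj (T U : Type) (phi : T -> U) (g : T -> T) (h : U -> U) n :
  injective phi -> (forall u, exists v, phi v = u) ->
  (forall v, phi (g v) = h (phi v)) ->
  (iter n g =1 id) <-> (iter n h =1 id).
Proof.
move=> inj surj conj.
have E v : phi (iter n g v) = iter n h (phi v).
  by elim: n => //= n IH; rewrite conj IH.
split=> H => [u|v]; last by apply: inj; rewrite E H.
by have [v <-] := surj u; rewrite -E H.
Qed.

Section CoxeterOnModule.
Variables (R : realType) (k : closedFieldType) (C : fusionCat k) (P : C).
Variable M : fssModCat C.
Let abM := fss_abelian M.
Let finM := @fss_fin_dim k C M.
Let ssM := fmod_semisimple M.

Lemma coxM_entries (v : 'cV[GrMod M]_2) :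
  let y := clsC P *: v 0 0 - v 1 0 in
  coxM P v 0 0 = clsC (ldual P) *: y - v 0 0 /\ coxM P v 1 0 = y.
Proof.
rewrite /coxM /mxact !mxE !big_ord_recl !big_ord0 !mxE /= !big_ord_recl !big_ord0 !mxE /=.
rewrite (_ : lift ord0 ord0 = 1 :> 'I_2); last exact: val_inj.
rewrite (_ : ord0 = 0 :> 'I_2) //.
rewrite !(mulr1, mulr0, mul1r, mul0r, mulrN1, addr0, add0r, scaleNr, scale1r).
by rewrite scalerDl scaleN1r scalerBr scalerA addrC addrA addrAC [- _ + _]addrC addrAC.
Qed.

Section Coordinates.
Variables (n : nat) (S : 'I_n -> M).
Hypothesis repS : simple_reps S.
Let N := actmx S P.
Let p : {additive 'rV[int]_n -> 'rV[int]_n} := mulmxr N.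
Let q : {additive 'rV[int]_n -> 'rV[int]_n} := mulmxr N^T.

Definition coord2 (v : 'cV[GrMod M]_2) : 'rV[int]_n * 'rV[int]_n :=
  (K0coord S (v 0 0), K0coord S (v 1 0)).

Lemma coord2_inj : injective coord2.
Proof.
move=> u v [/(K0coord_inj abM finM ssM repS) u0 /(K0coord_inj abM finM ssM repS) u1].
apply/colP => i; case: i => [[|[|//]]] i.
  by rewrite (_ : Ordinal i = 0) //; apply: val_inj.
by rewrite (_ : Ordinal i = 1) //; apply: val_inj.
Qed.

Lemma coord2_surj u : exists v, coord2 v = u.
Proof.
have [x xE] := K0coord_surj abM finM ssM repS u.1.
have [y yE] := K0coord_surj abM finM ssM repS u.2.
exists (\col_i if i == 0 then (x : GrMod M) else y).
by rewrite /coord2 !mxE /= xE yE; case: u {xE yE}.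
Qed.

(** In coordinates the dual of [P] acts by the transposed matrix. *)
Lemma coord2_cox v : coord2 (coxM P v) = cox p q (coord2 v).
Proof.
have [e0 e1] := coxM_entries v; rewrite /coord2 e0 e1 /cox /refl_a /refl_b /=.
have PQ : is_left_dual P (ldual P) := svalP (cid (left_dual_exists P)).
have NT : actmx S (ldual P) = N^T by rewrite (actmx_dual repS PQ).
have K0coordB x y : K0coord S (x - y : GrMod M) = K0coord S x - K0coord S y.
  by rewrite -(K0coordN abM finM ssM repS) -(K0coordD abM finM ssM repS).
by rewrite !(K0coordB, K0coord_act repS) NT.
Qed.

Variable f : GrMod M -> R.
Hypothesis fD : {morph f : y z / y + z}.
Hypothesis f0 : forall T, is_simple T -> 0 < f (clsM T).
Hypothesis fX : forall (X : C) y, f (clsC X *: y) = FPdim R X * f y.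

Let w i := f (clsM (S i)).

Lemma actmx_weight (X : C) i :
  \sum_j (actmx S X i j)%:~R * w j = FPdim R X * w i.
Proof.
rewrite -fX (additive_expand abM finM ssM repS _ fD).
by apply: eq_bigr => j _; rewrite -[RHS]mulrzl mxE.
Qed.

Lemma N_ge0 i j : 0 <= N i j.
Proof. by rewrite /N (actmxE repS). Qed.

Lemma w_gt0 i : 0 < w i.
Proof. by apply: f0; have [] := repS. Qed.

Lemma N_weight i : \sum_j (N i j)%:~R * w j = FPdim R P * w i.
Proof. exact: actmx_weight. Qed.

Lemma NT_weight j : \sum_i (N i j)%:~R * w i = FPdim R P * w j.
Proof.
have PQ : is_left_dual P (ldual P) := svalP (cid (left_dual_exists P)).
rewrite -(FPdim_dual R PQ) -actmx_weight (actmx_dual repS PQ).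
by apply: eq_bigr => i _; rewrite [in RHS]mxE.
Qed.

End Coordinates.

Hypothesis M0 : exists X : M, ~ is_zero X.

Lemma module_simple : exists n (S : 'I_n -> M) (i : 'I_n), simple_reps S.
Proof.
have [n [S repS]] := fss_simple_reps M; have [X X0] := M0.
have [T sT _] := nonzero_simple_summand abM ssM X0.
by have [_ _ /(_ T sT)[i _]] := repS; exists n, S, i.
Qed.

Lemma dot_delta n (i : 'I_n) : dot (delta_mx 0 i) (delta_mx 0 i) = 1.
Proof.
rewrite dotE (bigD1 i) //= big1 => [|j ji]; first by rewrite !mxE !eqxx.
by rewrite !mxE (negPf ji) andbF mul0r.
Qed.

Lemma nonneg_delta n (i : 'I_n) : nonneg (delta_mx 0 i).
Proof. by move=> j; rewrite mxE. Qed.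

(** Sign coherence for one simple class of [M] forces the angle. *)
Lemma FPdim_cos : FPdim R P < 2 ->
  exists m : nat, (2 <= m)%N /\ FPdim R P = 2 * cos (pi / m%:R).
Proof.
have [n [S [i repS]]] := module_simple.
have [f [fD f0 fX]] := FPdim_functional R M => d2.
apply: (norm_cos (N_ge0 repS) (w_gt0 repS f0) (N_weight repS fD fX)
  (NT_weight repS fD fX) _ (dot_delta i) (nonneg_delta i)).
by rewrite FPdim_ge0.
Qed.

(** A period of the Coxeter element brings the weights [cheb d l] of the orbit
    of a simple class back to their initial values. *)
Lemma cox_period_cheb l : iter l (@coxM k C P M) =1 id ->
  cheb (FPdim R P) l.*2 = 0 /\ cheb (FPdim R P) l.*2.+1 = 1.
Proof.
have [n [S [i repS]]] := module_simple.
have [f [fD f0 fX]] := FPdim_functional R M.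
rewrite (iter_conj _ (coord2_inj repS) (coord2_surj repS) (coord2_cox repS)).
move=> /(_ (delta_mx 0 i, 0)); rewrite iter_cox_alt /= => -[z1 z0].
pose w j := f (clsM (S j)).
have wi : 0 < weight w (delta_mx 0 i).
  rewrite /weight (bigD1 i) //= mxE !eqxx mulr1 ltr_pwDl ?(w_gt0 repS f0) //.
  apply: sumr_ge0 => j _; rewrite mulr_ge0 ?(ltW (w_gt0 repS f0 j)) //.
  by rewrite ler0z mxE.
have wa := weight_alt (N_weight repS fD fX) (NT_weight repS fD fX) (delta_mx 0 i).
split; apply: (mulIf (lt0r_neq0 wi)); rewrite -wa.
  by rewrite z0 mul0r; apply: big1 => j _; rewrite mxE mulr0.
by rewrite z1 mul1r.
Qed.

Lemma finite_order_lt2 : finite_order (@coxM k C P M) -> FPdim R P < 2.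
Proof.
case=> l l0 /cox_period_cheb[c0 _]; rewrite ltNge; apply/negP => d2.
by have := cheb_gt0 (n := l.*2) d2; rewrite double_gt0 c0 ltxx => /(_ l0).
Qed.

Lemma coxM_order m : (2 <= m)%N -> FPdim R P = 2 * cos (pi / m%:R) ->
  FPdim R P < 2 -> has_order (@coxM k C P M) m.
Proof.
move=> m2 dm d2; have [n [S [i repS]]] := module_simple.
have [f [fD f0 fX]] := FPdim_functional R M.
have m0 : (0 < m)%N by apply: leq_trans m2.
split=> // [|l /andP[l0 lm] /cox_period_cheb[]].
  rewrite (iter_conj _ (coord2_inj repS) (coord2_surj repS) (coord2_cox repS)).
  have Nge := N_ge0 repS; have wgt := w_gt0 repS f0.
  have Nw := N_weight repS fD fX; have NTw := NT_weight repS fD fX.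
  apply: cox_period => //.
    exact: (alt_vanish_all Nge wgt Nw NTw m2 dm d2).
  have := @alt_vanish_all R n (actmx S P)^T _ (FPdim R P) _ wgt _ _ m m2 dm d2.
  rewrite trmxK; apply.
  - by move=> a b; rewrite mxE.
  - by move=> a; under eq_bigr do rewrite mxE; apply: NTw.
  - by move=> a; under eq_bigr do rewrite mxE; apply: Nw.
by rewrite dm => c0 c1; have := cheb_period_ge m2 l0 c0 c1; rewrite leqNgt lm.
Qed.

End CoxeterOnModule.

Lemma coxC_regular (k : closedFieldType) (C : fusionCat k) (P : C) :
  @coxC k C P = @coxM k C P (regular_fss C).
Proof. by apply: funext => v; apply/matrixP => i j; rewrite !mxE ord1. Qed.

Lemma regular_neq0 (k : closedFieldType) (C : fusionCat k) :
  exists X : regular_fss C, ~ is_zero X.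
Proof. by have [_ _ _ [u _]] := fusionP C; exists (tunit C). Qed.

Theorem theorem5p26 (R : realType) (k : closedFieldType) (C : fusionCat k)
    (P : C) (M : fssModCat C) (M_neq0 : exists X : M, ~ is_zero X) :
  [/\ [<-> finitely_many_indecomposables (RepCat M P);
           finite_order (@coxM k C P M);
           in_W P (sigma_a P *m sigma_b P) /\ finite_order (@coxC k C P);
           exists m : nat,
             [/\ (2 <= m)%N, FPdim R P = 2 * cos (pi / m%:R)
               & 2 * cos (pi / m%:R) < 2 :> R]],
      forall m : nat, (2 <= m)%N -> FPdim R P = 2 * cos (pi / m%:R) ->
        2 * cos (pi / m%:R) < 2 :> R ->
        has_order (@coxM k C P M) m /\ has_order (@coxC k C P) m
    & forall M' : fssModCat C, (exists X : M', ~ is_zero X) ->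
        (finitely_many_indecomposables (RepCat M P) <->
         finitely_many_indecomposables (RepCat M' P))].
Proof.
have C_neq0 := regular_neq0 C.
have orderM (M' : fssModCat C) (M'0 : exists X : M', ~ is_zero X) m :
    (2 <= m)%N -> FPdim R P = 2 * cos (pi / m%:R) ->
    2 * cos (pi / m%:R) < 2 :> R -> has_order (@coxM k C P M') m.
  by move=> m2 dm; rewrite -dm; apply: coxM_order.
have finite_repsP (M' : fssModCat C) (M'0 : exists X : M', ~ is_zero X) :
    finitely_many_indecomposables (RepCat M' P) <-> FPdim R P < 2.
  have [f [fD f0 fX]] := FPdim_functional R M'.
  split=> [fin|d2].
    by rewrite ltNge; apply/negP => /(infinite_reps fD f0 fX M'0).
  have [m [m2 dm]] := FPdim_cos M'0 d2.
  have [n [S repS]] := fss_simple_reps M'.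
  exact: (finite_reps fD f0 fX repS m2 dm).
have lt2_order : FPdim R P < 2 ->
    finite_order (@coxM k C P M) /\ finite_order (@coxC k C P).
  move=> d2; have [m [m2 dm]] := FPdim_cos M_neq0 d2.
  have [m0 perM _] := coxM_order M_neq0 m2 dm d2.
  have [_ perC _] := coxM_order C_neq0 m2 dm d2.
  by split; exists m; rewrite ?coxC_regular.
split=> [|m m2 dm c2|M' M'0]; last by rewrite !finite_repsP.
- tfae.
  + by move=> /(finite_repsP M M_neq0) /lt2_order[].
  + move=> /(finite_order_lt2 R M_neq0) /lt2_order[_ finC]; split=> //.
    by apply: W_mul; [apply: W_a|apply: W_b].
  + rewrite coxC_regular => -[_ /(finite_order_lt2 R C_neq0) d2].
    by have [m [m2 dm]] := FPdim_cos M_neq0 d2; exists m; rewrite -dm.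
  + by case=> m [_ dm c2]; apply/(finite_repsP M M_neq0); rewrite dm.
- split; first exact: orderM.
  by rewrite coxC_regular; exact: (orderM (regular_fss C) C_neq0 m m2 dm c2).
Qed.
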